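(* There is a deterministic algorithm (called RouteOrCut-1Pair) that, given a connected $n$-vertex $m$-edge graph $G=(V,E)$ with maximum vertex degree $\Delta$, two disjoint subsets $A_1,B_1$ of its vertices with $|A_1|\le|B_1|$ and $|A_1|=n_1$, an integer $z\ge0$, and a parameter $0<\psi<1/2$, computes one of the following: either a partial routing of the sets $A_1,B_1$ of value at least $n_1-z$ that causes congestion at most $4\Delta/\psi$; or a cut $(X,Y)$ in $G$ with $|X|,|Y|\ge z/\Delta$ and $\Psi_G(X,Y)\le\psi$. The running time of the algorithm is $O\left(\frac{m\Delta\log m}{\psi}\right)$.
   Context: Graphs are undirected and unweighted, possibly with parallel edges but no self-loops. For a cut $(X,Y)$ of $G$, $\Psi_G(X,Y)=\frac{|E_G(X,Y)|}{\min\{|X|,|Y|\}}$. A partial routing of disjoint sets $A_1,B_1$ with $|A_1|\le|B_1|$ consists of a matching $M_1$ of vertex pairs between $A_1$ and $B_1$ (pairs need not be edges of $G$) together with a path $P(u,v)$ in $G$ connecting $u$ to $v$ for each $(u,v)\in M_1$; it causes congestion $c$ if every edge of $G$ lies on at most $c$ of these paths, and its value is $|M_1|$. *)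

(* Defs.v *)
From mathcomp Require Import all_boot all_order all_algebra.
From mathcomp Require Import reals exp.
Set Implicit Arguments.
Unset Strict Implicit.
Unset Printing Implicit Defensive.
Import Order.TTheory GRing.Theory Num.Theory.

Section Multigraph.
Local Open Scope nat_scope.

(* Vertices are the elements of 'I_n and edges those of 'I_m, so that parallel
   edges are distinct objects. The order of the two endpoints is immaterial. *)
Record multigraph (n m : nat) := Multigraph {
  ends : 'I_m -> 'I_n * 'I_n;
  ends_neq : forall e, (ends e).1 != (ends e).2
}.

Variables (n m : nat) (G : multigraph n m).

Definition joins (e : 'I_m) (u v : 'I_n) : bool :=
  (ends G e == (u, v)) || (ends G e == (v, u)).

Definition adj : rel 'I_n := [rel u v | [exists e, joins e u v]].

Definition connected_graph : Prop := 0 < n /\ forall u v, connect adj u v.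

Definition degree (v : 'I_n) : nat :=
  #|[set e | (v == (ends G e).1) || (v == (ends G e).2)]|.

Definition max_degree : nat := \max_(v < n) degree v.

Definition edges_between (X Y : {set 'I_n}) : {set 'I_m} :=
  [set e | [exists u in X, exists v in Y, joins e u v]].

Definition is_cut (X Y : {set 'I_n}) : bool :=
  [&& X != set0, Y != set0 & Y == ~: X].

(* A path is given by its first vertex and the list of its steps; a step is the
   edge that is traversed, together with the vertex that is reached. *)
Definition gpath := seq ('I_m * 'I_n).

Fixpoint walk (u : 'I_n) (p : gpath) : bool :=
  if p is (e, w) :: p' then joins e u w && walk w p' else true.

Definition is_path (u v : 'I_n) (p : gpath) : bool :=
  [&& walk u p, last u (unzip2 p) == v & uniq (u :: unzip2 p)].

Definition routing := seq ('I_n * 'I_n * gpath).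

Definition partial_routing (A B : {set 'I_n}) (r : routing) : bool :=
  [&& all (fun q => [&& q.1.1 \in A, q.1.2 \in B & is_path q.1.1 q.1.2 q.2]) r,
      uniq [seq q.1.1 | q <- r] & uniq [seq q.1.2 | q <- r]].

Definition edge_load (r : routing) (e : 'I_m) : nat :=
  count (fun q => e \in unzip1 q.2) r.

Definition routing_value (r : routing) : nat := size r.

End Multigraph.

Section RealQuantities.
Local Open Scope ring_scope.
Variables (R : realType) (n m : nat) (G : multigraph n m).

Definition sparsity (X Y : {set 'I_n}) : R :=
  #|edges_between G X Y|%:R / (minn #|X| #|Y|)%:R.

Definition has_congestion (r : routing n m) (c : R) : Prop :=
  forall e : 'I_m, (edge_load r e)%:R <= c.

End RealQuantities.

Section WordRAM.
Local Open Scope nat_scope.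

(* The memory is a family of arrays of natural numbers. The identifier of an
   array is a constant of the program, so a program uses finitely many arrays;
   the index in an array is computed at run time. A scalar variable is a cell
   with a constant index. *)
Definition state := nat -> nat -> nat.

Inductive binop := OAdd | OSub | OMul | ODiv | OMod | OLeq | OEq.

(* [Test e1 e2] queries an external relation on words; it is the only access
   that a program has to a real parameter (see [real_test]). *)
Inductive expr :=
  | Cst of nat
  | Read of nat & expr
  | Bin of binop & expr & expr
  | Test of expr & expr.

Inductive cmd :=
  | Skip
  | Write of nat & expr & expr
  | Seq of cmd & cmd
  | If of expr & cmd & cmd
  | While of expr & cmd.

Definition apply_binop (o : binop) (x y : nat) : nat :=
  match o with
  | OAdd => x + y
  | OSub => x - y
  | OMul => x * y
  | ODiv => x %/ y
  | OMod => x %% y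
  | OLeq => x <= y
  | OEq => x == y
  end.

Definition update (s : state) (a i v : nat) : state :=
  fun b j => if (b == a) && (j == i) then v else s b j.

Variables (W : nat) (test : nat -> nat -> bool).

(* A value above the largest word W is an overflow, on which the evaluation is
   stuck; in particular addresses and all intermediate results are words. *)
Definition word (v : nat) : option nat := if v <= W then Some v else None.

Fixpoint eval (s : state) (e : expr) : option nat :=
  match e with
  | Cst c => word c
  | Read a e1 => obind (fun i => word (s a i)) (eval s e1)
  | Bin o e1 e2 =>
      obind (fun x => obind (fun y => word (apply_binop o x y)) (eval s e2))
            (eval s e1)
  | Test e1 e2 =>
      obind (fun x => obind (fun y => word (test x y)) (eval s e2)) (eval s e1)
  end.

Fixpoint expr_cost (e : expr) : nat :=
  match e with
  | Cst _ => 1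
  | Read _ e1 => (expr_cost e1).+1
  | Bin _ e1 e2 | Test e1 e2 => (expr_cost e1 + expr_cost e2).+1
  end.

(* [exec c s t s'] : started in s, the program c halts in s' after t elementary
   operations, without overflow. *)
Inductive exec : cmd -> state -> nat -> state -> Prop :=
  | ExecSkip s : exec Skip s 1 s
  | ExecWrite a e1 e2 s i v of eval s e1 = Some i & eval s e2 = Some v :
      exec (Write a e1 e2) s (expr_cost e1 + expr_cost e2).+1 (update s a i v)
  | ExecSeq c1 c2 s1 s2 s3 t1 t2 of exec c1 s1 t1 s2 & exec c2 s2 t2 s3 :
      exec (Seq c1 c2) s1 (t1 + t2) s3
  | ExecIf e c1 c2 s s' v t of
      eval s e = Some v & exec (if v != 0 then c1 else c2) s t s' :
      exec (If e c1 c2) s (expr_cost e + t).+1 s'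
  | ExecWhileEnd e c s of eval s e = Some 0 :
      exec (While e c) s (expr_cost e).+1 s
  | ExecWhileStep e c s1 s2 s3 v t1 t2 of
      eval s1 e = Some v.+1 & exec c s1 t1 s2 & exec (While e c) s2 t2 s3 :
      exec (While e c) s1 (expr_cost e + t1 + t2).+1 s3.

Lemma exec_deterministic c s t1 s1 t2 s2 :
  exec c s t1 s1 -> exec c s t2 s2 -> t1 = t2 /\ s1 = s2.
Proof.
move=> H; elim: H t2 s2 => {c s t1 s1}
  [s|a e1 e2 s i v E1 E2|c1 c2 sa sb sc ta tb _ IH1 _ IH2|e c1 c2 s s' v t E _ IH
  |e c s E|e c sa sb sc v ta tb E _ IH1 _ IH2] t2 s2 H;
  inversion H; subst; try congruence; first by split; congruence.
- by split; congruence.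
- match goal with H1 : exec c1 _ _ _, H2 : exec c2 _ _ _ |- _ =>
    have [-> ?] := IH1 _ _ H1; subst; by have [-> ->] := IH2 _ _ H2 end.
- match goal with H1 : eval _ e = Some ?w, H2 : exec _ _ _ _ |- _ =>
    have ? : w = v by [congruence]; subst; by have [-> ->] := IH _ _ H2 end.
- by [].
- match goal with H1 : exec c _ _ _, H2 : exec (While _ _) _ _ _ |- _ =>
    have [-> ?] := IH1 _ _ H1; subst; by have [-> ->] := IH2 _ _ H2 end.
Qed.

End WordRAM.

(* Array 0 holds the input; all the other cells are initially 0. *)
Definition input_state (inp : seq nat) : state :=
  fun a i => if a == 0%N then nth 0%N inp i else 0%N.

(* Array 1 holds the output. *)
Definition outputs (s : state) (out : seq nat) : Prop :=
  forall i, (i < size out)%N -> s 1%N i = nth 0%N out i.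

(* A real number, known to a program through its comparisons to fractions b / a
   of words; it need not be rational. *)
Definition real_test (R : realType) (x : R) (a b : nat) : bool :=
  (a%:R * x <= b%:R)%R.

Section Encodings.
Local Open Scope nat_scope.
Variables n m : nat.

Definition encode_input (G : multigraph n m) (A B : {set 'I_n}) (z : nat) :
    seq nat :=
  [:: n; m; #|A|; #|B|; z]
  ++ flatten [seq [:: val (ends G e).1; val (ends G e).2] | e <- enum 'I_m]
  ++ [seq val v | v <- enum A] ++ [seq val v | v <- enum B].

Inductive outcome :=
  | Routed of routing n m
  | Separated of {set 'I_n} & {set 'I_n}.

Definition encode_route (q : 'I_n * 'I_n * gpath n m) : seq nat :=
  [:: val q.1.1; val q.1.2; size q.2]
  ++ flatten [seq [:: val x.1; val x.2] | x <- q.2].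

(* The first entry says which kind of result follows. For a cut (X, Y), where Y
   is the complement of X, the next n entries are the indicator of X. *)
Definition encode_outcome (o : outcome) : seq nat :=
  match o with
  | Routed r => [:: 1; size r] ++ flatten [seq encode_route q | q <- r]
  | Separated X _ => 0 :: [seq nat_of_bool (v \in X) | v <- enum 'I_n]
  end.

End Encodings.

Local Open Scope ring_scope.

Definition correct_outcome (R : realType) (n m : nat) (G : multigraph n m)
    (A B : {set 'I_n}) (z : nat) (psi : R) (o : outcome n m) : Prop :=
  match o with
  | Routed r =>
      [/\ partial_routing G A B r,
          (#|A| - z <= routing_value r)%N
        & has_congestion r (4 * (max_degree G)%:R / psi)]
  | Separated X Y =>
      [/\ is_cut X Y,
          z%:R / (max_degree G)%:R <= #|X|%:R :> R,
          z%:R / (max_degree G)%:R <= #|Y|%:R :> R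
        & sparsity R G X Y <= psi]
  end.

(* Main.v *)
Require Import Defs.
From mathcomp Require Import all_boot all_order all_algebra.
From mathcomp Require Import reals exp.
From mathcomp Require Import zify ring lra.
Import Order.TTheory GRing.Theory Num.Theory.
Set Implicit Arguments.
Unset Strict Implicit.
Unset Printing Implicit Defensive.

(** Replace each edge by two opposite arcs, give every arc the capacity [2 q],
    where [q] is the least integer with [q psi > 1], and send one unit of
    flow (a token) from each source by push-relabel with heights at most
    [H = 8 q Delta l], where [2 ^ l > n]. A token moves along a residual arc that
    descends by one level, stops at a free sink, and is stuck on reaching height
    [H]. As tokens move one at a time and each vertex keeps a pointer to its
    current arc, a potential function bounds the number of steps by [O(m H)].

    If at most [z] tokens are stuck, the flow is decomposed into paths by walking
    along it from each source; the pointers to the last exits from the vertices of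
    a walk form its loop erasure. Each edge is on at most [2 q <= 4 Delta / psi]
    paths.

    Otherwise the vertices of height [H] contain more than [z / 2] vertices, since
    at most two tokens are stuck on a vertex, and those of height [0] contain the
    more than [z] free sinks. Let [S] be the set of vertices of height at least
    [i]. An edge that leaves [S] is saturated outwards unless it joins the levels
    [i] and [i - 1], and the net flow out of [S] is at most [min(|S|, |V - S|)];
    so, if [4 q k <= min(|S|, |V - S|)] for the number [k] of edges between the
    two levels, then [q |E(S, V - S)| <= min(|S|, |V - S|)]. If this failed for all
    [i], then [k <= Delta] times the size of either level would make [|S|] double
    every [4 q Delta] levels downwards while it is the smaller side, and the
    complement double upwards while that is the smaller side, so [H] levels are too
    many. The algorithm tries all [i]. *)
Local Open Scope nat_scope.

(** * A time-bounded program logic for the word RAM *)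

(** Why the capacity is [2 q] and not [q]: for the set S of vertices of height at least [i],
    conservation summed over S gives [2 q |E(S, V - S)| <= 4 q k + f], where each of the [k] edges
    between the levels [i] and [i - 1] may be fully residual and [f] is the net flow out of S. Each
    of the two terms may then use up one copy of [min(|S|, |V - S|)]. The same 4 makes [4 q Delta]
    levels a doubling block, and [H] holds [l] blocks for each of the two directions of doubling.

    Pushes need no count of their own: a push lowers the only moving token by one level, and only a
    relabelling raises it, so pushes are paid for by relabellings and by the starts of tokens.

    More than [z / 2] vertices of height [H] are enough because a connected graph with at least two
    edges has [Delta >= 2]. With a single edge this fails, and so does the time bound: [ln m]
    vanishes, while [psi] is known only through comparisons and finding [q] takes about [1 / psi]
    steps. Hence graphs with at most one edge are treated apart.

    The invariants speak of plain functions on numbers; each step of an algorithm is verified on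
    them before any program appears. *)

Fixpoint mods (c : cmd) : seq nat :=
  match c with
  | Skip => [::]
  | Write a _ _ => [:: a]
  | Seq c1 c2 | If _ c1 c2 => mods c1 ++ mods c2
  | While _ c1 => mods c1
  end.

(** Untouched arrays agree as functions, not cell by cell, so that facts about whole arrays are
    carried over by rewriting. *)
Definition same_off (l : seq nat) (s s' : state) : Prop :=
  forall a, a \notin l -> s' a = s a.

Lemma same_off_refl l s : same_off l s s. Proof. by []. Qed.

Lemma same_off_trans l s1 s2 s3 :
  same_off l s1 s2 -> same_off l s2 s3 -> same_off l s1 s3.
Proof. by move=> H1 H2 a Ha; rewrite H2 // H1. Qed.

Lemma same_off_sub l1 l2 s s' :
  {subset l1 <= l2} -> same_off l1 s s' -> same_off l2 s s'.
Proof. by move=> sub H a Ha; apply: H; apply: contra Ha; apply: sub. Qed.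

Lemma same_off_cat l1 l2 s1 s2 s3 :
  same_off l1 s1 s2 -> same_off l2 s2 s3 -> same_off (l1 ++ l2) s1 s3.
Proof.
by move=> H1 H2 a; rewrite mem_cat negb_or => /andP[n1 n2]; rewrite H2 // H1.
Qed.

Lemma exec_same_off W test c s t s' : exec W test c s t s' -> same_off (mods c) s s'.
Proof.
elim=> {c s t s'} //=.
- move=> a e1 e2 s i v _ _ b; rewrite inE => /negbTE nab; rewrite /update nab //.
- move=> c1 c2 s1 s2 s3 t1 t2 _ H1 _ H2; apply: (same_off_trans (s2 := s2)).
    by apply: same_off_sub H1 => a; rewrite mem_cat => ->.
  by apply: same_off_sub H2 => a; rewrite mem_cat orbC => ->.
- move=> e c1 c2 s s' v t _ _; apply: same_off_sub => a; rewrite mem_cat.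
  by case: (v != 0) => -> //; rewrite orbT.
- by move=> e c s1 s2 s3 v t1 t2 _ _ H1 _ H2; apply: same_off_trans H2.
Qed.

(* A polynomial bound: on cells at most B >= 2, every intermediate value of the
   expression is at most B ^ edeg. *)
Fixpoint edeg (e : expr) : nat :=
  match e with
  | Cst c => c.+1
  | Read _ e1 => maxn 1 (edeg e1)
  | Bin OAdd e1 e2 => (maxn (edeg e1) (edeg e2)).+1
  | Bin OMul e1 e2 => edeg e1 + edeg e2
  | Bin _ e1 e2 | Test e1 e2 => maxn 1 (maxn (edeg e1) (edeg e2))
  end.

Fixpoint cdeg (c : cmd) : nat :=
  match c with
  | Skip => 0
  | Write _ e1 e2 => maxn (edeg e1) (edeg e2)
  | Seq c1 c2 => maxn (cdeg c1) (cdeg c2)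
  | If e c1 c2 => maxn (edeg e) (maxn (cdeg c1) (cdeg c2))
  | While e c1 => maxn (edeg e) (cdeg c1)
  end.

Fixpoint loopfree (c : cmd) : bool :=
  match c with
  | Skip | Write _ _ _ => true
  | Seq c1 c2 | If _ c1 c2 => loopfree c1 && loopfree c2
  | While _ _ => false
  end.

(** Meaningful for loop-free commands only; the value at [While] is a placeholder. *)
Fixpoint ccost (c : cmd) : nat :=
  match c with
  | Skip | While _ _ => 1
  | Write _ e1 e2 => (expr_cost e1 + expr_cost e2).+1
  | Seq c1 c2 => ccost c1 + ccost c2
  | If e c1 c2 => (expr_cost e + maxn (ccost c1) (ccost c2)).+1
  end.

Section Logic.
Variables (W : nat) (test : nat -> nat -> bool) (B D : nat).
Hypothesis B_ge2 : 2 <= B.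
Hypothesis W_ge : B ^ D <= W.

Fixpoint ev (s : state) (e : expr) : nat :=
  match e with
  | Cst c => c
  | Read a e1 => s a (ev s e1)
  | Bin o e1 e2 => apply_binop o (ev s e1) (ev s e2)
  | Test e1 e2 => test (ev s e1) (ev s e2)
  end.

Definition bounded (s : state) : Prop := forall a i, s a i <= B.

(** Degrees do not pile up during a run: whatever is read is a cell, hence again at most [B], and
    only the operations inside one expression raise the degree. A fixed power of [B] therefore
    excludes overflow. *)
Lemma eval_ev s e : bounded s -> edeg e <= D ->
  eval W test s e = Some (ev s e) /\ ev s e <= B ^ edeg e.
Proof.
move=> bs; have B0 : 0 < B by lia.
have wordE v k : v <= B ^ k -> k <= D -> word W v = Some v.
  move=> vk kD; rewrite /word (leq_trans vk) // (leq_trans _ W_ge) //.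
  by rewrite leq_pexp2l.
have pos k : 0 < B ^ k by rewrite expn_gt0 B0.
have mono j k : j <= k -> B ^ j <= B ^ k by move=> ?; rewrite leq_pexp2l.
elim: e => [c|a e1 IH1|o e1 IH1 e2 IH2|e1 IH1 e2 IH2] /= He.
- have Hc : c <= B ^ c.+1.
    by apply: ltnW; apply: (leq_trans (ltn_expl c B_ge2)); apply: mono.
  by split=> //; apply: wordE Hc He.
- have [E1 _] := IH1 ltac:(lia).
  have Hr : s a (ev s e1) <= B ^ maxn 1 (edeg e1).
    by apply: leq_trans (bs _ _) _; rewrite -{1}(expn1 B) mono //; lia.
  by rewrite E1 /=; split=> //; apply: wordE Hr He.
- have [E1 L1] := IH1 ltac:(case: o He => /=; lia).
  have [E2 L2] := IH2 ltac:(case: o He => /=; lia).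
  set k := (X in _ /\ _ <= B ^ X).
  suff Hv : apply_binop o (ev s e1) (ev s e2) <= B ^ k.
    by rewrite E1 E2 /=; split=> //; apply: wordE Hv He.
  rewrite {}/k {He}; case: o => /=.
  + have := mono _ _ (leq_maxl (edeg e1) (edeg e2)).
    have := mono _ _ (leq_maxr (edeg e1) (edeg e2)).
    rewrite expnS; have : 2 * B ^ maxn (edeg e1) (edeg e2) <= B * B ^ maxn (edeg e1) (edeg e2).
      by rewrite leq_mul2r B_ge2 orbT.
    lia.
  + apply: leq_trans (leq_subr _ _) _; apply: leq_trans L1 _; apply: mono; lia.
  + by rewrite expnD leq_mul.
  + apply: leq_trans (leq_div _ _) _; apply: leq_trans L1 _; apply: mono; lia.
  + apply: leq_trans (leq_mod _ _) _; apply: leq_trans L1 _; apply: mono; lia.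
  + by apply: leq_trans (leq_b1 _) _.
  + by apply: leq_trans (leq_b1 _) _.
- have [E1 L1] := IH1 ltac:(lia).
  have [E2 L2] := IH2 ltac:(lia).
  have Hv : test (ev s e1) (ev s e2) <= B ^ maxn 1 (maxn (edeg e1) (edeg e2)).
    by apply: leq_trans (leq_b1 _) _.
  by rewrite E1 E2 /=; split=> //; apply: wordE Hv He.
Qed.

(** A total-correctness triple with a time bound. Boundedness of the cells and the frame are built
    in, so that loop invariants need not mention them. *)
Definition runs (c : cmd) (s : state) (T : nat) (Q : state -> Prop) : Prop :=
  bounded s -> exists t s',
    [/\ exec W test c s t s', t <= T, bounded s', same_off (mods c) s s' & Q s'].

Lemma runs_weaken c s T T' (Q Q' : state -> Prop) :
  T <= T' ->
  (forall s', bounded s' -> same_off (mods c) s s' -> Q s' -> Q' s') ->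
  runs c s T Q -> runs c s T' Q'.
Proof.
move=> TT QQ H bs; have [t [s' [E tT b' f q]]] := H bs.
by exists t, s'; split=> //; [apply: leq_trans TT | apply: QQ].
Qed.

Lemma runs_seq c1 c2 s T1 T2 Q :
  runs c1 s T1 (fun s' => runs c2 s' T2 Q) -> runs (Seq c1 c2) s (T1 + T2) Q.
Proof.
move=> H bs; have [t1 [s1 [E1 L1 b1 f1 H1]]] := H bs.
have [t2 [s2 [E2 L2 b2 f2 H2]]] := H1 b1.
have E := ExecSeq E1 E2.
exists (t1 + t2), s2; split=> //; [exact: leq_add | exact: exec_same_off E].
Qed.

(** The only side condition left by a loop-free command is that each value written fits in a cell.
    Loops are excluded by [False] and handled by [runs_while]. *)
Fixpoint wp (c : cmd) (s : state) (Q : state -> Prop) : Prop :=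
  match c with
  | Skip => Q s
  | Write a e1 e2 => ev s e2 <= B /\ Q (update s a (ev s e1) (ev s e2))
  | Seq c1 c2 => wp c1 s (fun s' => wp c2 s' Q)
  | If e c1 c2 => if ev s e != 0 then wp c1 s Q else wp c2 s Q
  | While _ _ => False
  end.

Lemma wp_runs c s Q : loopfree c -> cdeg c <= D -> wp c s Q -> runs c s (ccost c) Q.
Proof.
elim: c s Q => [|a e1 e2|c1 IH1 c2 IH2|e c1 IH1 c2 IH2|//] s Q /=.
- by move=> _ _ HQ bs; exists 1, s; split=> //; apply: ExecSkip.
- move=> _; rewrite geq_max => /andP[D1 D2] [vB HQ] bs.
  have [E1 _] := eval_ev bs D1; have [E2 _] := eval_ev bs D2.
  have E := ExecWrite a E1 E2.
  exists (expr_cost e1 + expr_cost e2).+1, (update s a (ev s e1) (ev s e2)).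
  split=> //; last exact: exec_same_off E.
  by move=> b i; rewrite /update; case: ifP.
- case/andP=> l1 l2; rewrite geq_max => /andP[D1 D2] H.
  apply: runs_seq; apply: runs_weaken (IH1 _ _ l1 D1 H) => // s' _ _.
  exact: IH2.
- case/andP=> l1 l2; rewrite !geq_max => /and3P[De D1 D2] H bs.
  have [Ee _] := eval_ev bs De.
  have [t [s' [E tT b f q]]] : exists t s',
      [/\ exec W test (if ev s e != 0 then c1 else c2) s t s',
          t <= maxn (ccost c1) (ccost c2), bounded s', True & Q s'].
    case: ifP H => _ H.
      have [t [s' [? ? ? ? ?]]] := IH1 _ _ l1 D1 H bs.
      by exists t, s'; split=> //; rewrite leq_max; apply/orP; left.
    have [t [s' [? ? ? ? ?]]] := IH2 _ _ l2 D2 H bs.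
    by exists t, s'; split=> //; rewrite leq_max; apply/orP; right.
  have E' := ExecIf Ee E.
  exists (expr_cost e + t).+1, s'; split=> //; last exact: exec_same_off E'.
  by rewrite ltnS leq_add2l.
Qed.

(** Unlike [wp], this rule allows loops in the branches. *)
Lemma runs_if e c1 c2 s T Q : edeg e <= D ->
  (ev s e != 0 -> runs c1 s T Q) -> (ev s e = 0 -> runs c2 s T Q) ->
  runs (If e c1 c2) s (expr_cost e + T).+1 Q.
Proof.
move=> De H1 H2 bs; have [Ee _] := eval_ev bs De.
have [t [s' [E tT b q]]] : exists t s',
    [/\ exec W test (if ev s e != 0 then c1 else c2) s t s',
        t <= T, bounded s' & Q s'].
  have [e0|e0] := eqVneq (ev s e) 0.
    by have [t [s' [? ? ? ? ?]]] := H2 e0 bs; exists t, s'; split.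
  by have [t [s' [? ? ? ? ?]]] := H1 e0 bs; exists t, s'; split.
have E' := ExecIf Ee E.
exists (expr_cost e + t).+1, s'; split=> //; last exact: exec_same_off E'.
by rewrite ltnS leq_add2l.
Qed.

(* [I k s] is the loop invariant together with the fact that the potential of
   the state is k; the bound on the time of an iteration must be uniform. *)
Lemma runs_while e c s0 (I : nat -> state -> Prop) k0 K : edeg e <= D ->
  (forall k s, bounded s -> same_off (mods c) s0 s -> I k s -> ev s e != 0 ->
     runs c s K (fun s' => exists2 k', k' < k & I k' s')) ->
  I k0 s0 ->
  runs (While e c) s0 ((K + expr_cost e).+1 * k0.+1)
    (fun s' => ev s' e = 0 /\ exists k, I k s').
Proof.
move=> De body I0 b0.
suff H k s : bounded s -> same_off (mods c) s0 s -> I k s ->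
    exists t s', [/\ exec W test (While e c) s t s',
      t <= (K + expr_cost e).+1 * k.+1, bounded s' & ev s' e = 0 /\ exists k, I k s'].
  have [t [s' [E tT b q]]] := H _ _ b0 (@same_off_refl _ _) I0.
  by exists t, s'; split=> //; apply: exec_same_off E.
elim/ltn_ind: k s => k IH s b f Ik; have [Ee _] := eval_ev b De.
have [e0|e0] := eqVneq (ev s e) 0.
  exists (expr_cost e).+1, s; split=> //.
  - by apply: ExecWhileEnd; rewrite Ee e0.
  - by nia.
  - by split=> //; exists k.
have [t1 [s1 [E1 L1 b1 f1 [k' kk Ik']]]] := body k s b f Ik e0 b.
have [t2 [s2 [E2 L2 b2 q]]] := IH _ kk _ b1 (same_off_trans f f1) Ik'.
exists (expr_cost e + t1 + t2).+1, s2; split=> //.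
  by apply: (ExecWhileStep (v := (ev s e).-1)) E1 E2; rewrite prednK ?lt0n.
nia.
Qed.

End Logic.

(** * Sums over arcs, cuts and levels *)

Definition upd (f : nat -> nat) (i w : nat) : nat -> nat :=
  fun j => if j == i then w else f j.

Lemma upd_eq f i w : upd f i w i = w. Proof. by rewrite /upd eqxx. Qed.

Lemma upd_neq f i w j : j != i -> upd f i w j = f j.
Proof. by rewrite /upd => /negbTE ->. Qed.

(** Stated without truncated subtraction, so that changes of potentials and balances become linear
    arithmetic. *)
Lemma sum_upd (F : nat -> nat -> nat) k f i w : i < k ->
  \sum_(x < k) F x (upd f i w x) + F i (f i) = \sum_(x < k) F x (f x) + F i w.
Proof.
move=> ik; rewrite (bigD1 (Ordinal ik)) //= [in RHS](bigD1 (Ordinal ik)) //= upd_eq.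
rewrite (eq_bigr (fun x : 'I_k => F x (f x))); first by lia.
by move=> x xi; rewrite upd_neq.
Qed.

Lemma leq_sum1 (k : nat) (F : nat -> nat) i : i < k -> F i <= \sum_(x < k) F x.
Proof. by move=> ik; rewrite (bigD1 (Ordinal ik)) //= leq_addr. Qed.

Lemma sum_eq1 k i : i < k -> \sum_(v < k) (i == v) = 1.
Proof.
move=> ik; rewrite (bigD1 (Ordinal ik)) //= eqxx big1 // => v.
by rewrite eq_sym -val_eqE /= => /negbTE ->.
Qed.

Lemma sum_mem k (s : seq nat) : uniq s -> all (ltn^~ k) s ->
  \sum_(v < k) (val v \in s) = size s.
Proof.
elim: s => [_ _|a s IH /= /andP[nas us] /andP[ak sk]]; first by rewrite big1.
rewrite /= -IH // -add1n -[1 in RHS](sum_eq1 ak) -big_split /=; apply: eq_bigr => v _.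
rewrite inE; case: eqP => [->|]; case: eqP => //=; first by rewrite (negbTE nas).
all: by move=> *; congruence.
Qed.

(** Within a block of [M] steps each increment is at least [1 / M] of the value at the start of the
    block, so the block doubles that value. *)
Lemma doubling (g : nat -> nat) M l : 0 < M -> 0 < g 0 ->
  (forall i, i < M * l -> g i <= g i.+1 /\ g i <= M * (g i.+1 - g i)) ->
  2 ^ l <= g (M * l).
Proof.
move=> M0 g0; elim: l => [|l IH] H; first by rewrite muln0 expn0.
have {}IH := IH (fun i Hi => H i ltac:(nia)).
have J j : j <= M -> g (M * l) <= g (M * l + j) /\
    j * g (M * l) <= M * (g (M * l + j) - g (M * l)).
  elim: j => [|j IHj] jM; first by rewrite addn0 subnn.
  have [le1 le2] := IHj (ltnW jM).
  have [le3 le4] := H (M * l + j) ltac:(nia).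
  rewrite addnS; split; first by lia.
  rewrite mulSn; move: le1 le2 le3 le4.
  move: (g (M * l)) (g (M * l + j)) (g _.+1) => a b d le1 le2 le3 le4.
  rewrite (_ : d - a = (d - b) + (b - a)); last by lia.
  by rewrite mulnDr leq_add // (leq_trans le1).
have [le1 le2] := J M (leqnn _); rewrite leq_pmul2l // in le2.
rewrite expnS mulnS addnC; move: IH le1 le2; set a := g _; set b := g _; lia.
Qed.

Section Arcs.

(* Arc x is edge x / 2 traversed in the direction given by the parity of x, so
   that an edge and its reverse are 2e and 2e + 1. *)
Variables (n m : nat) (tl : nat -> nat).

Definition rarc x := if odd x then x - 1 else x + 1.
Definition ahead x := tl (rarc x).

Lemma rarcK x : rarc (rarc x) = x.
Proof. by rewrite /rarc; case: (boolP (odd x)) => ox; case: ifP; lia. Qed.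
Lemma rarc_lt x : x < 2 * m -> rarc x < 2 * m. Proof. by rewrite /rarc; case: ifP; lia. Qed.
Lemma rarc_neq x : rarc x != x. Proof. by rewrite /rarc; case: ifP; lia. Qed.
Lemma ahead_rarc x : ahead (rarc x) = tl x. Proof. by rewrite /ahead rarcK. Qed.

Lemma sum_arcs (f : nat -> nat) k :
  \sum_(x < 2 * k) f x = \sum_(e < k) (f (2 * e) + f (2 * e + 1)).
Proof.
elim: k => [|k IH]; first by rewrite !big_ord0.
rewrite [RHS]big_ord_recr /= -IH (_ : 2 * k.+1 = (2 * k).+2); last by lia.
by rewrite !big_ord_recr /= addn1; lia.
Qed.

Lemma sum_rarc (f : nat -> nat) : \sum_(x < 2 * m) f (rarc x) = \sum_(x < 2 * m) f x.
Proof.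
rewrite (sum_arcs (fun x => f (rarc x))) (sum_arcs f); apply: eq_bigr => e _.
have -> : rarc (2 * e) = 2 * e + 1 by rewrite /rarc; case: ifP; lia.
have -> : rarc (2 * e + 1) = 2 * e by rewrite /rarc; case: ifP; lia.
by rewrite addnC.
Qed.

Definition deg v := \sum_(x < 2 * m) (tl x == v).
(** As the arc lists run downwards, this is the number of arcs out of [v] that the pointer [p] has
    yet to visit. *)
Definition rank v p := \sum_(x < p) (tl x == v).
Definition out_sum (r : nat -> nat) v := \sum_(x < 2 * m) (tl x == v) * r x.

Hypothesis tl_lt : forall x, x < 2 * m -> tl x < n.

Lemma ahead_lt x : x < 2 * m -> ahead x < n.
Proof. by move=> xm; apply/tl_lt/rarc_lt. Qed.

Lemma sum_out_sum (P r : nat -> nat) :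
  \sum_(v < n) P v * out_sum r v = \sum_(x < 2 * m) P (tl x) * r x.
Proof.
under eq_bigr do rewrite big_distrr /=.
rewrite exchange_big /=; apply: eq_bigr => x _.
have xn := tl_lt (ltn_ord x).
rewrite (bigD1 (Ordinal xn)) //= eqxx mul1n big1 ?addn0 // => v.
by rewrite eq_sym -val_eqE /= => /negbTE ->; rewrite mul0n muln0.
Qed.

Lemma deg_out_sum c v : c * deg v = out_sum (fun=> c) v.
Proof. by rewrite /deg big_distrr /=; apply: eq_bigr => x _; rewrite mulnC. Qed.

Lemma rank_deg v : rank v (2 * m) = deg v. Proof. by []. Qed.

Lemma rank_mono v p p' : p <= p' -> rank v p <= rank v p'.
Proof.
move=> pp; rewrite -(subnKC pp) /rank big_split_ord /=; lia.
Qed.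

Lemma rankS v p : rank v p.+1 = rank v p + (tl p == v).
Proof. by rewrite /rank big_ord_recr. Qed.

Lemma sum_deg : \sum_(v < n) deg v = 2 * m.
Proof.
have := sum_out_sum (fun=> 1) (fun=> 1); rewrite (eq_bigr (fun v : 'I_n => deg v)).
  by move=> ->; rewrite /= sum_nat_const card_ord; lia.
by move=> v _; rewrite mul1n -[deg v]mul1n deg_out_sum.
Qed.

Lemma sum_rank (p : nat -> nat) : (forall v, v < n -> p v <= 2 * m) ->
  \sum_(v < n) rank v (p v) <= 2 * m.
Proof.
move=> H; rewrite -[X in _ <= X]sum_deg; apply: leq_sum => v _.
by rewrite -rank_deg rank_mono // H.
Qed.

(** * Residual capacities and cuts *)

Section Residual.
Variables (c : nat) (r : nat -> nat).
Hypothesis res : forall x, x < 2 * m -> r x + r (rarc x) = 2 * c.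

(** An arc and its reverse have the same weight, and their residual capacities add up to [2 * c]. *)
Lemma sum_symmetric (w : nat -> nat) : (forall x, w (rarc x) = w x) ->
  \sum_(x < 2 * m) w x * r x = c * \sum_(x < 2 * m) w x.
Proof.
move=> wr; have /= E := sum_rarc (fun x => w x * r x).
have : \sum_(x < 2 * m) w x * r x + \sum_(x < 2 * m) w x * r x =
    2 * c * \sum_(x < 2 * m) w x.
  rewrite -{1}E big_distrr -big_split; apply: eq_bigr => x _ /=.
  by rewrite wr -mulnDr addnC res // mulnC.
rewrite -mulnA; move: (\sum_(x < _) w x * r x) (c * _) => a b; lia.
Qed.

(** Sum the balances over the set with indicator [P]. The arcs inside it cancel by symmetry; each
    arc that leaves it contributes nothing if saturated, and at most [2 * c] otherwise. *)
Lemma cut_bound (P supply used : nat -> nat) :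
  (forall v, P v <= 1) ->
  (forall v, v < n -> out_sum r v + supply v = c * deg v + used v) ->
  c * \sum_(x < 2 * m) P (tl x) * (1 - P (ahead x)) + \sum_(v < n) P v * used v
  <= 2 * c * \sum_(x < 2 * m) P (tl x) * (1 - P (ahead x)) * (0 < r x)
     + \sum_(v < n) P v * supply v.
Proof.
move=> P1 bal.
have E : \sum_(x < 2 * m) P (tl x) * r x + \sum_(v < n) P v * supply v =
    c * \sum_(x < 2 * m) P (tl x) + \sum_(v < n) P v * used v.
  have e1 := sum_out_sum P r; have e2 := sum_out_sum P (fun=> c).
  rewrite [c * _]mulnC big_distrl /= -e1 -e2 -!big_split /=.
  by apply: eq_bigr => v _; rewrite -!mulnDr -deg_out_sum bal.
have split_in (f : nat -> nat) : \sum_(x < 2 * m) P (tl x) * f x =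
    \sum_(x < 2 * m) P (tl x) * P (ahead x) * f x +
    \sum_(x < 2 * m) P (tl x) * (1 - P (ahead x)) * f x.
  rewrite -big_split; apply: eq_bigr => x _ /=.
  by rewrite -mulnDl -mulnDr subnKC ?muln1.
have sym := sum_symmetric (w := fun x => P (tl x) * P (ahead x))
  ltac:(by move=> x /=; rewrite ahead_rarc mulnC).
have := split_in r; have := split_in (fun=> 1).
under eq_bigr do rewrite muln1.
under [X in _ = X + _ -> _]eq_bigr do rewrite muln1.
under [X in _ = _ + X -> _]eq_bigr do rewrite muln1.
have bd : \sum_(x < 2 * m) P (tl x) * (1 - P (ahead x)) * r x <=
    2 * c * \sum_(x < 2 * m) P (tl x) * (1 - P (ahead x)) * (0 < r x).
  rewrite big_distrr /=; apply: leq_sum => x _.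
  rewrite mulnCA leq_mul2l; apply/orP; right.
  have := res (ltn_ord x); case: (posnP (r x)) => [->|]; lia.
move: E sym bd.
move: (\sum_(x < _) P (tl x) * r x) (\sum_(x < _) P (tl x))
      (\sum_(x < _) P (tl x) * P (ahead x)) => a1 a2 a3.
move: (\sum_(x < _) _ * _ * r x) (\sum_(x < _) _ * _ * r x) => a4 a5.
move: (\sum_(x < _) _ * (1 - _)) (\sum_(x < _) _ * (1 - _) * _) => a6 a7.
move: (\sum_(v < _) _) (\sum_(v < _) _) => a8 a9.
move=> E s b e1 e2; subst; move: E b; rewrite mulnDr; lia.
Qed.

End Residual.

(** * Level sets of a height function *)

Definition above (d : nat -> nat) i := \sum_(v < n) (i <= d v).
Definition below (d : nat -> nat) i := \sum_(v < n) (d v < i).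
Definition crossing (d : nat -> nat) i :=
  \sum_(x < 2 * m) ((i <= d (tl x)) * (d (ahead x) < i)).

Lemma above_below d i : above d i + below d i = n.
Proof.
rewrite -big_split /= -[RHS]card_ord -sum1_card; apply: eq_bigr => v _; lia.
Qed.

Lemma above_anti d i j : i <= j -> above d j <= above d i.
Proof. move=> ij; apply: leq_sum => v _; lia. Qed.

Lemma sparse_level d q D l : 0 < q -> 0 < D -> n < 2 ^ l ->
  (forall v, v < n -> deg v <= D) ->
  0 < above d (2 * (4 * q * D * l)) -> 0 < below d 1 ->
  exists i, [/\ 1 <= i, i <= 2 * (4 * q * D * l),
    4 * q * \sum_(x < 2 * m) ((d (tl x) == i) * (d (ahead x) == i - 1)) <= above d i &
    4 * q * \sum_(x < 2 * m) ((d (tl x) == i) * (d (ahead x) == i - 1)) <= below d i].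
Proof.
move=> q0 D0 nl degD.
set M := 4 * q * D => sh t1.
pose K i := \sum_(x < 2 * m) ((d (tl x) == i) * (d (ahead x) == i - 1)).
pose lev i := \sum_(v < n) (d v == i).
have M0 : 0 < M by rewrite /M; lia.
have lev_deg i : \sum_(x < 2 * m) (d (tl x) == i) <= D * lev i.
  have := sum_out_sum (fun v => (d v == i) : nat) (fun=> 1).
  under [RHS]eq_bigr do rewrite muln1.
  move=> <-; rewrite /lev big_distrr /=; apply: leq_sum => v _.
  rewrite -deg_out_sum mul1n mulnC leq_mul2r degD ?orbT //.
have K1 i : K i <= D * lev i.
  by apply: leq_trans (lev_deg i); apply: leq_sum => x _; case: eqP; case: eqP.
have K2 i : K i <= D * lev (i - 1).
  apply: leq_trans (lev_deg _).
  rewrite -(sum_rarc (fun x => (d (tl x) == i - 1) : nat)).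
  by apply: leq_sum => x _; rewrite -/(ahead x); case: eqP; case: eqP.
have levB i : below d i.+1 = below d i + lev i.
  by rewrite -big_split /=; apply: eq_bigr => v _; lia.
have levA i : above d i = above d i.+1 + lev i.
  by rewrite -big_split /=; apply: eq_bigr => v _; lia.
have sb := above_below d.
pose good i := (4 * q * K i <= above d i) && (4 * q * K i <= below d i).
have [/existsP[i Hi]|/existsPn none] :=
  boolP [exists i : 'I_(2 * (M * l)), good i.+1].
  by case/andP: Hi => H1 H2; exists i.+1; split=> //; apply: ltn_ord.
(* The edges between two levels are charged to either level: doubling downwards needs the lower one,
   doubling upwards the upper one. *)
have bad i : 1 <= i -> i <= 2 * (M * l) ->
    above d i < M * lev i /\ above d i < M * lev (i - 1) \/
    below d i < M * lev i /\ below d i < M * lev (i - 1).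
  move=> i1 i2; have ip : i.-1 < 2 * (M * l) by lia.
  have := none (Ordinal ip); rewrite /good /= prednK // negb_and -!ltnNge.
  have h1 : 4 * q * K i <= M * lev i by rewrite /M -[_ * D * _]mulnA leq_mul2l K1 orbT.
  have h2 : 4 * q * K i <= M * lev (i - 1) by rewrite /M -[_ * D * _]mulnA leq_mul2l K2 orbT.
  case/orP=> h; [left|right]; split; lia.
exfalso.
(* Either the upper side is the smaller one at some level of the lower half, hence throughout the
   upper half, where it doubles downwards; or the lower side is never the larger one in the lower
   half, where it doubles upwards. Both ways [M * l] levels yield more than [n] vertices. *)
have [/existsP[i Hi]|/existsPn none'] :=
  boolP [exists i : 'I_(M * l), above d i.+1 < below d i.+1].
- have := doubling (g := fun j => above d (2 * (M * l) - j)) (l := l) M0.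
  rewrite subn0 => /(_ sh) H; suff : 2 ^ l <= n by rewrite leqNgt nl.
  apply: leq_trans (H _) _ => [j jl|]; last first.
    by rewrite -(sb (2 * (M * l) - M * l)) leq_addr.
  have -> : 2 * (M * l) - j.+1 = (2 * (M * l) - j) - 1 by lia.
  set k := 2 * (M * l) - j.
  have k1 : 0 < k by rewrite /k; lia.
  have := levA (k - 1); rewrite subn1 prednK // => E.
  have ik : i.+1 <= k by have := ltn_ord i; rewrite /k; lia.
  have := above_anti d ik; have := sb k; have := sb i.+1.
  have := bad k k1 ltac:(rewrite /k; lia); rewrite subn1.
  move: Hi; rewrite E addKn; lia.
- have := doubling (g := fun j => below d j.+1) (l := l) M0 t1 => H.
  suff : 2 ^ l <= n by rewrite leqNgt nl.
  apply: leq_trans (H _) _ => [j jl|]; last first.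
    by rewrite -(sb (M * l).+1) leq_addl.
  have := none' (Ordinal jl); rewrite -leqNgt /= => le.
  have := bad j.+1 (ltn0Sn _) ltac:(lia); rewrite (levB j.+1) addKn; lia.
Qed.

End Arcs.

(** * The push-relabel loop *)

Section Flow.
Variables (n m : nat) (tl : nat -> nat).
Hypothesis tl_lt : forall x, x < 2 * m -> tl x < n.
Hypothesis tl_neq : forall x, x < 2 * m -> tl x != ahead tl x.

(* A pointer to an arc x is stored as x + 1, so that 0 is the null pointer. *)
Definition arc_ptr v p := p <= 2 * m /\ (0 < p -> tl (p - 1) = v).

Definition last_arc v p b :=
  [/\ p <= b, 0 < p -> tl (p - 1) = v & forall y, p <= y -> y < b -> tl y <> v].

(** Linked lists of the arcs out of each vertex. They are in decreasing order because a single pass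
    over the arcs prepends each arc to its list. *)
Definition arc_lists (h0 nx : nat -> nat) :=
  (forall v, v < n -> last_arc v (h0 v) (2 * m)) /\
  (forall x, x < 2 * m -> last_arc (tl x) (nx x) x).

Variables (h0 nx : nat -> nat).
Hypothesis lists : arc_lists h0 nx.
Variables (c H : nat) (As : seq nat) (Bs : pred nat).
Hypothesis As_uniq : uniq As.
Hypothesis As_lt : all (ltn^~ n) As.

Lemma mem_As a : a \in As -> a < n.
Proof. by move=> aA; apply: (allP As_lt). Qed.

Lemma nth_As j : j < size As -> nth 0 As j < n.
Proof. by move=> jA; apply/mem_As/mem_nth. Qed.

Lemma take_As (j:nat) (v : nat) : j < size As ->
  (v \in take (j + 1) As) = (v \in take j As) + (v == nth 0 As j) :> nat.
Proof.
move=> jA; rewrite addn1 (take_nth 0) // mem_rcons inE.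
case: eqP => [->|] //=; last by rewrite addn0.
suff -> : (nth 0 As j \in take j As) = false by [].
apply/negP => /(nthP 0)[i]; rewrite size_take jA => ij.
rewrite nth_take // => /eqP; rewrite nth_uniq //; first by lia.
exact: ltn_trans ij jA.
Qed.

Lemma drop_As j (v : nat) : j < size As ->
  (v \in drop j As) = (v \in drop (j + 1) As) + (v == nth 0 As j) :> nat.
Proof.
move=> jA; rewrite (drop_nth 0) // inE addn1.
case: eqP => [->|] //=; last by rewrite addn0.
suff -> : (nth 0 As j \in drop j.+1 As) = false by [].
by have := drop_uniq j As_uniq; rewrite (drop_nth 0 jA) /= => /andP[/negbTE ->].
Qed.

(* The state of the push-relabel loop: residual capacities r, heights d, current
   arcs cur, sinks sk (1 if free, 2 if used), numbers st of stuck tokens; the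
   first j sources have been started, and if act = 1 there is a token on u. *)
Record flow_inv (r d cur sk st : nat -> nat) (j act u abs : nat) : Prop := FlowInv {
  fi_res : forall x, x < 2 * m -> r x + r (rarc x) = 2 * c;
  fi_bal : forall v, v < n -> out_sum m tl r v + (v \in take j As) =
    c * deg m tl v + ((sk v == 2) + st v + ((act == 1) && (v == u)));
  fi_valid : forall x, x < 2 * m -> 0 < r x -> d (tl x) <= d (ahead tl x) + 1;
  fi_sk : forall v, v < n -> (sk v == 1) + (sk v == 2) = Bs v;
  fi_sk0 : forall v, v < n -> sk v = 1 -> d v = 0;
  fi_abs : \sum_(v < n) (sk v == 2) = abs;
  fi_d : forall v, v < n -> d v <= H;
  fi_st : forall v, v < n -> 0 < st v -> d v = H;
  fi_st2 : forall v, v < n ->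
    st v + [&& act == 1, v == u & d v == H] <= 1 + (v \in take j As);
  fi_ptr : forall v, v < n -> arc_ptr v (cur v);
  fi_cur : forall v y, v < n -> cur v <= y -> y < 2 * m -> tl y = v -> 0 < r y ->
    d v <= d (ahead tl y);
  fi_act : act <= 1;
  fi_u : act = 1 -> u < n;
  fi_j : j <= size As;
  fi_sk2 : forall v, v < n -> sk v <= 2
}.

(** A level still to be climbed by [v] is worth [deg + 2]: a new scan of its arcs, the rise of the
    token by one level, and one unit for the relabelling. The height of the token pays for its
    pushes, and [H + 3] covers the start of a token at any height. *)
Definition flow_pot (d cur : nat -> nat) (j act u : nat) :=
  \sum_(v < n) (H - d v) * (deg m tl v + 2) + \sum_(v < n) rank tl v (cur v)
  + act * (d u + 2) + (size As - j) * (H + 3).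

Variables (r d cur sk st : nat -> nat) (j u abs : nat).

Lemma flow_start : flow_inv r d cur sk st j 0 u abs -> j < size As ->
  flow_inv r d cur sk st (j + 1) 1 (nth 0 As j) abs /\
  flow_pot d cur (j + 1) 1 (nth 0 As j) < flow_pot d cur j 0 u.
Proof.
move=> [] res bal val sk1 sk0 abs1 dH st1 st2 ptr cu act0 u0 j0 sk2 jA.
have an := nth_As jA.
split; last first.
  rewrite /flow_pot (_ : size As - j = (size As - (j + 1)).+1); last by lia.
  rewrite mulSn; have := dH _ an; move: (_ - _) => k.
  by move: (\sum_(_ < _) _) (\sum_(_ < _) _) => x y; lia.
split=> // [v vn|v vn|]; last by lia.
- by have := bal v vn; rewrite take_As //=; lia.
- by have := st2 v vn; rewrite take_As //=; lia.
Qed.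

Lemma flow_absorb : flow_inv r d cur sk st j 1 u abs -> sk u = 1 ->
  flow_inv r d cur (upd sk u 2) st j 0 u (abs + 1) /\
  flow_pot d cur j 0 u < flow_pot d cur j 1 u.
Proof.
move=> [] res bal val sk1 sk0 abs1 dH st1 st2 ptr cu act0 u0 j0 sk2 su.
have un := u0 erefl.
split; first last.
  rewrite /flow_pot; move: (\sum_(_ < _) _) (\sum_(_ < _) _) => *; lia.
split=> // [v vn|v vn|v vn||v vn|v vn].
- have := bal v vn; rewrite /upd /=; have [->|_] := eqVneq v u; rewrite ?su /=; lia.
- have := sk1 v vn; rewrite /upd /=; have [->|_] := eqVneq v u; rewrite ?su //=; lia.
- by rewrite /upd /=; have [//|_] := eqVneq v u; apply: sk0.
- have := sum_upd (fun=> fun y : nat => (y == 2) : nat) sk 2 un.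
  by rewrite su /= abs1; lia.
- by have := st2 v vn; rewrite /=; lia.
- by rewrite /upd; case: eqP => // _; apply: sk2.
Qed.

Lemma flow_stuck : flow_inv r d cur sk st j 1 u abs -> H <= d u ->
  flow_inv r d cur sk (upd st u (st u + 1)) j 0 u abs /\
  flow_pot d cur j 0 u < flow_pot d cur j 1 u.
Proof.
move=> [] res bal val sk1 sk0 abs1 dH st1 st2 ptr cu act0 u0 j0 sk2 du.
have un := u0 erefl; have {}du : d u = H by have := dH u un; lia.
split; first last.
  rewrite /flow_pot; move: (\sum_(_ < _) _) (\sum_(_ < _) _) => *; lia.
split=> // [v vn|v vn|v vn].
- have := bal v vn; rewrite /upd /=; have [->|_] := eqVneq v u; rewrite /=; lia.
- by rewrite /upd; have [->|_] := eqVneq v u => //; apply: st1.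
- have := st2 v vn; rewrite /upd /=; have [->|_] := eqVneq v u; rewrite /= ?du ?eqxx; lia.
Qed.

(** A null current arc means that no residual arc out of [u] descends, so raising [u] by one level
    keeps the heights valid. Free sinks stay at height 0, since a token never remains on one. *)
Lemma flow_relabel : flow_inv r d cur sk st j 1 u abs -> sk u <> 1 -> d u < H ->
  cur u = 0 ->
  flow_inv r (upd d u (d u + 1)) (upd cur u (h0 u)) sk st j 1 u abs /\
  flow_pot (upd d u (d u + 1)) (upd cur u (h0 u)) j 1 u < flow_pot d cur j 1 u.
Proof.
move=> [] res bal val sk1 sk0 abs1 dH st1 st2 ptr cu act0 u0 j0 sk2 su du cu0.
have un := u0 erefl.
have [hu1 hu2 hu3] := (proj1 lists) u un.
have dup w : d w <= upd d u (d u + 1) w by rewrite /upd; case: eqP => [->|]; lia.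
split; last first.
  rewrite /flow_pot upd_eq.
  have := sum_upd (fun v dv => (H - dv) * (deg m tl v + 2)) d (d u + 1) un.
  have := sum_upd (fun v p => rank tl v p) cur (h0 u) un.
  rewrite cu0 {2}/rank big_ord0 /= -(rank_deg m tl u).
  have := rank_mono tl u hu1.
  have -> : H - d u = (H - (d u + 1)).+1 by lia.
  rewrite mulSn /=; set a := \sum_(_ < _) _; set b := \sum_(_ < _) _.
  set a' := \sum_(_ < _) _; set b' := \sum_(_ < _) _; lia.
split=> // [x xm rx|v vn sv|v vn|v vn|v vn|v vn|v y vn].
- have := val x xm rx; have := dup (ahead tl x).
  rewrite {2}/upd; case: eqP => [E|_]; last by lia.
  have hu : ahead tl x != u by rewrite -E eq_sym tl_neq.
  have := cu u x un; rewrite cu0 => /(_ isT xm E rx).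
  by rewrite upd_neq //; lia.
- by rewrite upd_neq ?sk0 //; apply/eqP => vu; rewrite vu in sv.
- by rewrite /upd; have [_|_] := eqVneq v u; [lia | apply: dH].
- rewrite /upd; have [->|_] := eqVneq v u; last by apply: st1.
  by move/st1=> /(_ un); lia.
- have := st2 v vn; rewrite /upd /=; have [->|_] := eqVneq v u => //=.
  by have := st1 u un; case: (st u) => [|k]; lia.
- by rewrite /upd; have [->|_] := eqVneq v u; [split | apply: ptr].
- rewrite /upd; have [->|vu] := eqVneq v u => h1 h2 h3 h4.
    by case: (hu3 y h1 h2 h3).
  by have := cu v y vn h1 h2 h3 h4; have := dup (ahead tl y); rewrite /upd; lia.
Qed.

Lemma flow_push : flow_inv r d cur sk st j 1 u abs -> sk u <> 1 -> d u < H ->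
  0 < cur u -> let x := cur u - 1 in
  0 < r x -> d u = d (ahead tl x) + 1 ->
  let r1 := upd r x (r x - 1) in
  flow_inv (upd r1 (rarc x) (r1 (rarc x) + 1)) d cur sk st j 1 (ahead tl x) abs /\
  flow_pot d cur j 1 (ahead tl x) < flow_pot d cur j 1 u.
Proof.
move=> [] res bal val sk1 sk0 abs1 dH st1 st2 ptr cu act0 u0 j0 sk2 su du cu0 x rx dx r1.
have un := u0 erefl.
have [p1 p2] := ptr u un; have {}p2 : tl x = u by apply: p2.
have xm : x < 2 * m by rewrite /x; lia.
have hn := ahead_lt tl_lt xm; have xu := tl_neq xm; rewrite p2 in xu.
have rxx := rarc_neq x.
split; first last.
  rewrite /flow_pot; move: (\sum_(_ < _) _) (\sum_(_ < _) _) => *; lia.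
have r1x : r1 (rarc x) = r (rarc x) by rewrite /r1 upd_neq.
set r2 := upd r1 _ _.
have r2E y : r2 y = if y == rarc x then r (rarc x) + 1 else
    if y == x then r x - 1 else r y by rewrite /r2 /r1 /upd (negbTE rxx).
have r2pos y : 0 < r2 y -> 0 < r y \/ y = rarc x.
  by rewrite r2E; case: eqP => [->|_]; [right | case: eqP => [->|_]; left; lia].
split=> // [y ym|v vn|y ym ry|v vn|v y vn h1 h2 h3 h4].
- rewrite !r2E (can_eq rarcK) (can2_eq rarcK rarcK).
  have := res y ym; have := res x xm; have [->|_] := eqVneq y (rarc x).
    by rewrite rarcK (negbTE rxx); lia.
  by have [->|_] := eqVneq y x; rewrite ?(negbTE rxx); lia.
- have := sum_upd (fun y ry => (tl y == v) * ry) r (r x - 1) xm.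
  have := sum_upd (fun y ry => (tl y == v) * ry) r1 (r1 (rarc x) + 1) (rarc_lt xm).
  rewrite -/(out_sum m tl r2 v) -/(out_sum m tl r1 v) -/(out_sum m tl r v) -/(ahead tl x) p2 r1x.
  have := bal v vn; rewrite [v == u]eq_sym [v == ahead _ _]eq_sym /=.
  have [<-|_] := eqVneq u v; first by rewrite eq_sym ?(negbTE xu) eq_sym ?(negbTE xu) /=; lia.
  by case: eqP => _ /=; lia.
- case: (r2pos _ ry) => [|->]; first exact: val.
  by rewrite ahead_rarc p2 /= -/(ahead tl x) dx; lia.
(* A push ends strictly below [H]. So a vertex of height [H] collects at most the token that lifted
   it there and the one that starts on it. *)
- have := st2 v vn => /=; have [->|_] := eqVneq v (ahead tl x); rewrite ?andbF; last by lia.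
  by have -> : (d (ahead tl x) == H) = false by [apply/eqP; lia]; lia.
- case: (r2pos _ h4) => [|yE]; first exact: cu h1 h2 h3.
  by move: h3; rewrite yE ahead_rarc p2 -/(ahead tl x) => <-; rewrite dx; lia.
Qed.

(** The arc skipped is saturated or does not descend by one level; in the latter case validity of
    the heights shows that it does not descend at all. This is what [fi_cur] records for skipped
    arcs. *)
Lemma flow_next : flow_inv r d cur sk st j 1 u abs ->
  0 < cur u -> let x := cur u - 1 in
  ~ (0 < r x /\ d u = d (ahead tl x) + 1) ->
  flow_inv r d (upd cur u (nx x)) sk st j 1 u abs /\
  flow_pot d (upd cur u (nx x)) j 1 u < flow_pot d cur j 1 u.
Proof.
move=> [] res bal val sk1 sk0 abs1 dH st1 st2 ptr cu act0 u0 j0 sk2 cu0 x nadm.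
have un := u0 erefl.
have [p1 p2] := ptr u un; have {}p2 : tl x = u by apply: p2.
have xm : x < 2 * m by rewrite /x; lia.
have [q1 q2 q3] := (proj2 lists) x xm; rewrite p2 in q2 q3.
have cE : cur u = x.+1 by rewrite /x; lia.
split; last first.
  rewrite /flow_pot.
  have := sum_upd (fun v p => rank tl v p) cur (nx x) un.
  rewrite cE rankS p2 eqxx /=; have := rank_mono tl u q1.
  set a := \sum_(_ < _) _; set b := \sum_(_ < _) _.
  by set a' := \sum_(_ < _) _; lia.
split=> // [v vn|v y vn].
- rewrite /upd; have [->|_] := eqVneq v u; last exact: ptr.
  by split=> //; lia.
- rewrite /upd; have [->|_] := eqVneq v u => h1 h2 h3 h4; last exact: cu h1 h2 h3 h4.
  have [yx|yx] := ltnP y x; first by case: (q3 y h1 yx h3).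
  have [yE|xy] := eqVneq y x; last by apply: cu h4 => //; lia.
  by rewrite yE in h4 *; have := val x xm h4; rewrite p2; lia.
Qed.

Lemma flow_init : (forall x, x < 2 * m -> r x = c) -> (forall v, v < n -> d v = 0) ->
  (forall v, v < n -> cur v = h0 v) -> (forall v, v < n -> sk v = Bs v) ->
  (forall v, v < n -> st v = 0) -> flow_inv r d cur sk st 0 0 u 0.
Proof.
move=> rE dE curE skE stE; split=> // [x xm|v vn|x xm _|v vn|v vn _|
  |v vn|v vn|v vn|v vn|v y vn h1 h2 h3 _|v vn].
- by rewrite !rE ?rarc_lt //; lia.
- rewrite take0 deg_out_sum skE ?stE //= !addn0 (_ : (_ == 2) = false) ?addn0;
    last by case: (Bs v).
  by apply: eq_bigr => x _; rewrite rE.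
- by rewrite (dE (tl x)) ?tl_lt.
- by rewrite skE //; case: (Bs v).
- exact: dE.
- by rewrite big1 // => v _; rewrite skE //; case: (Bs v).
- by rewrite dE.
- by rewrite stE.
- by rewrite stE.
- by rewrite curE //; case: (proj1 lists v vn).
- by rewrite dE.
- by rewrite skE //; case: (Bs v).
Qed.

(** Sum the balances over all vertices: by symmetry the residual capacities add up to [c] per arc
    and cancel against the degrees. *)
Lemma flow_conserve : flow_inv r d cur sk st (size As) 0 u abs ->
  size As = abs + \sum_(v < n) st v.
Proof.
move=> [] res bal _ _ _ abs1 _ _ _ _ _ _ _ _ _.
have E1 : \sum_(v < n) out_sum m tl r v = c * \sum_(x < 2 * m) 1.
  rewrite -(sum_symmetric res (w := fun=> 1)) //.
  by rewrite -(sum_out_sum tl_lt (fun=> 1) r); apply: eq_bigr => v _; rewrite mul1n.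
have E2 : \sum_(v < n) c * deg m tl v = c * \sum_(x < 2 * m) 1.
  by rewrite -big_distrr /= (sum_deg tl_lt) sum_nat_const card_ord muln1.
have : \sum_(v < n) (out_sum m tl r v + (val v \in take (size As) As)) =
    \sum_(v < n) (c * deg m tl v + ((sk v == 2) + st v)).
  by apply: eq_bigr => v _; rewrite bal //= addn0.
rewrite !big_split /= E1 E2 abs1 take_size sum_mem //; lia.
Qed.

Lemma flow_cut q D l z : flow_inv r d cur sk st (size As) 0 u abs ->
  0 < q -> c = 2 * q -> 0 < D -> n < 2 ^ l -> H = 2 * (4 * q * D * l) ->
  (forall v, v < n -> deg m tl v <= D) ->
  size As <= \sum_(v < n) Bs v -> abs + z < size As ->
  [/\ z < 2 * above n d H, z < below n d 1 &
    exists2 i, 1 <= i <= H & q * crossing m tl d i <= above n d i /\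
      q * crossing m tl d i <= below n d i].
Proof.
move=> inv q0 cE D0 nl HE degD AB absz.
have E := flow_conserve inv.
case: inv => [] res bal val sk1 sk0 abs1 dH st1 st2 _ _ _ _ _ _.
have zH : z < 2 * above n d H.
  apply: leq_trans (_ : \sum_(v < n) st v <= _); first by lia.
  rewrite /above big_distrr /=; apply: leq_sum => v _.
  have := st2 v (ltn_ord v); have := st1 v (ltn_ord v).
  rewrite /= !addn0; case: (posnP (st v)) => [->|st0 /(_ isT) ->] //.
  by rewrite leqnn; case: (_ \in _); lia.
(* There are at least as many sinks as sources and only [abs] of them are used, so more than [z] are
   free. *)
have z1 : z < below n d 1.
  apply: leq_trans (_ : \sum_(v < n) (sk v == 1) <= _).
    have : \sum_(v < n) ((sk v == 1) + (sk v == 2)) = \sum_(v < n) Bs v.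
      by apply: eq_bigr => v _; rewrite sk1.
    rewrite big_split /= abs1 => e; rewrite -e in AB.
    by move: AB absz; set k := \sum_(_ < _) _; lia.
  by apply: leq_sum => v _; case: eqP => // /sk0 ->.
have sH : 0 < above n d (2 * (4 * q * D * l)) by rewrite -HE; lia.
have [i [i1 iH ka kb]] := sparse_level tl_lt q0 D0 nl degD sH (ltac:(lia)).
split=> //; exists i; first by rewrite i1 HE.
pose P v : nat := i <= d v.
pose supply v : nat := v \in take (size As) As.
pose used v : nat := (sk v == 2) + st v.
have := cut_bound tl_lt res (P := P) (supply := supply) (used := used)
  ltac:(by move=> v; rewrite /P leq_b1)
  ltac:(by move=> v vn; rewrite /supply bal // /used /= addn0).
have -> : \sum_(x < 2 * m) P (tl x) * (1 - P (ahead tl x)) = crossing m tl d i.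
  by apply: eq_bigr => x _; rewrite /P ltnNge; case: (i <= d (ahead _ _)).
set Kp := (X in _ <= 2 * c * X + _); set K := \sum_(x < _) _ * _ in ka kb.
(* By validity of the heights, a residual arc that leaves the upper side goes from level [i] exactly
   to level [i - 1]. *)
have KK : Kp <= K.
  apply: leq_sum => x _; have := val x (ltn_ord x).
  rewrite /P; case: (posnP (r x)) => [_ _|_ /(_ isT)]; first by rewrite muln0.
  have [h1|//] := leqP i (d (tl x)); have [//|h2 h3] := leqP i (d (ahead tl x)).
  have -> : (d (tl x) == i) = true by lia.
  by have -> : (d (ahead tl x) == i - 1) = true by lia.
have s1 : \sum_(v < n) P v * supply v <= above n d i.
  by apply: leq_sum => v _; rewrite /supply; case: (_ \in _); rewrite ?muln0 ?muln1.
(* Since [i <= H], stuck tokens lie on the upper side. The tokens that end on the lower side are on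
   used sinks, one per vertex. *)
have s2 : \sum_(v < n) P v * supply v <= \sum_(v < n) P v * used v + below n d i.
  have t1 : \sum_(v < n) P v * supply v <= \sum_(v < n) supply v.
    by apply: leq_sum => v _; rewrite /P; case: (i <= _); rewrite ?mul1n.
  have t2 : \sum_(v < n) supply v = size As by rewrite /supply take_size sum_mem.
  have t3 : \sum_(v < n) used v = size As by rewrite big_split /= abs1 E.
  have t4 : \sum_(v < n) used v <= \sum_(v < n) P v * used v + below n d i.
    rewrite -big_split; apply: leq_sum => v _; rewrite /P /used /=.
    have [h|h] := leqP i (d v); rewrite /= ?mul1n ?leq_addr // mul0n add0n.
    have := st1 v (ltn_ord v); case: (st v) => [_|k /(_ isT)]; last by lia.
    by rewrite addn0 leq_b1.
  lia.
have M1 : 2 * c * Kp <= 4 * q * K.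
  by rewrite cE (_ : 2 * (2 * q) = 4 * q) ?leq_mul //; lia.
move=> cb; split.
- move: cb; rewrite cE -mulnA; lia.
- move: cb; rewrite cE -mulnA; lia.
Qed.

End Flow.

(** * Decomposition of the flow into paths *)

Lemma mem_take_le (T : eqType) (s : seq T) i j x : x \in take i s -> i <= j -> x \in take j s.
Proof. by move=> xi ij; move: xi; rewrite -(take_takel s ij) => /mem_take. Qed.

Section Decomposition.
Variables (n m : nat) (tl : nat -> nat).
Hypothesis tl_lt : forall x, x < 2 * m -> tl x < n.
Hypothesis tl_neq : forall x, x < 2 * m -> tl x != ahead tl x.
Local Notation hd := (ahead tl).

Fixpoint arc_walk (a : nat) (p : seq nat) : bool :=
  if p is x :: p' then [&& x < 2 * m, tl x == a & arc_walk (hd x) p'] else true.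

Definition arc_path a p := arc_walk a p && uniq (a :: map hd p).

Definition walk_end (q : nat * seq nat) := last q.1 (map hd q.2).

Definition step_code (x : nat) := [:: x %/ 2; hd x].
Definition steps_code p := flatten (map step_code p).
Definition route_code (q : nat * seq nat) :=
  [:: q.1; walk_end q; size q.2] ++ steps_code q.2.
Definition routes_code rs := flatten (map route_code rs).

Definition uses (p : seq nat) (e : nat) := e \in [seq x %/ 2 | x <- p].
Definition load (rs : seq (nat * seq nat)) e := count (fun q => uses q.2 e) rs.

Lemma size_steps_code p : size (steps_code p) = 2 * size p.
Proof. by elim: p => //= x p; rewrite /steps_code /=; lia. Qed.

Lemma arc_walk_lt a p x : arc_walk a p -> x \in p -> x < 2 * m.
Proof.
elim: p a => //= y p IH a /and3P[ym _ pw]; rewrite inE => /orP[/eqP->//|].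
exact: IH pw.
Qed.

Lemma arc_walk_tails a p x : arc_walk a p -> x \in p -> tl x \in belast a (map hd p).
Proof.
elim: p a => //= y p IH a /and3P[ym /eqP ya pw]; rewrite !inE => /orP[/eqP->|xp].
  by rewrite ya eqxx.
by rewrite (IH _ pw xp) orbT.
Qed.

Lemma arc_walk_take a p i : arc_walk a p -> arc_walk a (take i p).
Proof.
elim: p a i => [|y p IH] a [|i] //= /and3P[-> -> pw]; exact: IH.
Qed.

Lemma arc_walk_rcons a p x : arc_walk a p -> x < 2 * m -> tl x = last a (map hd p) ->
  arc_walk a (rcons p x).
Proof.
elim: p a => [|y p IH] a /=; first by move=> _ -> ->; rewrite eqxx.
by move=> /and3P[-> -> pw] xm xt; apply: IH.
Qed.

Lemma arc_walk_ends a p : a < n -> arc_walk a p -> all (ltn^~ n) (a :: map hd p).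
Proof.
elim: p a => [|y p IH] a an /=; first by rewrite an.
move=> /and3P[ym _ pw]; rewrite an /=; apply: IH => //; exact: ahead_lt ym.
Qed.

Lemma arc_path_size a p : a < n -> arc_path a p -> size p < n.
Proof.
move=> an /andP[pw pu]; rewrite -[size p](size_map hd) -(size_iota 0 n).
rewrite -[_.+1]/(size (a :: map hd p)); apply: uniq_leq_size pu _ => v vp.
by rewrite mem_iota; exact: (allP (arc_walk_ends an pw) v vp).
Qed.

Lemma arc_path_tail a p x : arc_path a p -> x \in p -> tl x <> walk_end (a, p).
Proof.
case/andP=> pw; rewrite lastI rcons_uniq => /andP[nb _] xp E.
by move: nb; rewrite -[last _ _]/(walk_end (a, p)) -E (arc_walk_tails pw xp).
Qed.

Definition follows (op : nat -> nat) (p : seq nat) := forall x, x \in p -> op (tl x) = x.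

(* The last exits from the vertices of a walk form its loop erasure. *)
Lemma loop_erasure a p op x : arc_path a p -> follows op p ->
  x < 2 * m -> tl x = walk_end (a, p) ->
  exists p', [/\ arc_path a p', walk_end (a, p') = hd x, follows (upd op (tl x) x) p',
    size p' <= (size p).+1 & {subset p' <= x :: p}].
Proof.
move=> pp fp xm xt; have [pw pu] := andP pp.
have old y : y \in p -> upd op (tl x) x (tl y) = y.
  move=> yp; rewrite upd_neq ?fp // xt; apply/eqP; exact: arc_path_tail pp yp.
(* If the walk returns to the path, the loop is cut off; the exits stored at its vertices become
   stale but are not consulted from the new path. Otherwise the path grows by one arc. *)
have [hx|hx] := boolP (hd x \in a :: map hd p).
- set s := a :: map hd p in hx pu; set i := index (hd x) s.
  have ip : i <= size p by rewrite -ltnS -(size_map hd p); rewrite -index_mem in hx; exact: hx.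
  have E : a :: map hd (take i p) = take i.+1 s by rewrite /s /= map_take.
  exists (take i p); split.
  + by rewrite /arc_path arc_walk_take //= -/(uniq (a :: _)) E take_uniq.
  + rewrite /walk_end /= (last_nth a) E size_map size_take_min (minn_idPl ip).
    by rewrite nth_take // nth_index.
  + by move=> y /mem_take /old.
  + by rewrite size_take_min; lia.
  + by move=> y /mem_take yp; rewrite inE yp orbT.
- exists (rcons p x); split.
  + rewrite /arc_path (arc_walk_rcons pw xm xt) map_rcons -rcons_cons rcons_uniq hx.
    exact: pu.
  + by rewrite /walk_end /= map_rcons last_rcons.
  + move=> y; rewrite mem_rcons inE => /orP[/eqP->|]; first by rewrite upd_eq.
    exact: old.
  + by rewrite size_rcons.
  + by move=> y; rewrite mem_rcons.
Qed.

Lemma same_edge x y : x %/ 2 = y %/ 2 -> x = y \/ x = rarc y.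
Proof. by rewrite /rarc; case: ifP; lia. Qed.

Lemma rarc_div x : rarc x %/ 2 = x %/ 2.
Proof. by rewrite /rarc; case: ifP; lia. Qed.

(** The budget of an edge: routes already written, the current path, and the flow left, of which one
    direction is zero by truncation. The unit of flow removed by a step pays for the use of the edge
    by the path. *)
Lemma walk_load (c l rx ry : nat) (b b' : bool) : rx + ry = 2 * c -> rx < c ->
  l + b + (c - rx) + (c - ry) <= c ->
  l + b' + (c - (rx + 1)) + (c - (ry - 1)) <= c.
Proof. by case: b'; lia. Qed.

Variables (c : nat) (As : seq nat) (Bs : pred nat).
Hypothesis As_uniq : uniq As.
Hypothesis As_lt : all (ltn^~ n) As.

(* The state of the decomposition loop: the first j sources have been treated; if
   act = 1, a walk that follows the flow from a to u is in progress and p is its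
   loop erasure; if act = 2, it has reached the used sink u and is being written.
   The routes rs are written. Collected sinks have sk = 3. *)
Record dec_inv (abs : nat) (r cu sk st op : nat -> nat) (j act a u : nat)
    (rs : seq (nat * seq nat)) (p : seq nat) : Prop := DecInv {
  di_res : forall x, x < 2 * m -> r x + r (rarc x) = 2 * c;
  di_bal : forall v, v < n ->
    out_sum m tl r v + (v \in drop j As) + ((act == 1) && (v == u)) =
    c * deg m tl v + ((sk v == 2) + st v);
  di_ptr : forall v, v < n -> arc_ptr m tl v (cu v);
  di_cur : forall v y, v < n -> cu v <= y -> y < 2 * m -> tl y = v -> c <= r y;
  di_sk : forall v, v < n -> (2 <= sk v -> Bs v) /\ sk v <= 3;
  di_load : forall x, x < 2 * m ->
    load rs (x %/ 2) + ((act != 0) && uses p (x %/ 2)) + (c - r x) + (c - r (rarc x)) <= c;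
  di_act : act <= 2;
  di_j : j <= size As;
  di_path : act <> 0 -> [/\ 0 < j, a = nth 0 As (j - 1), arc_path a p,
    walk_end (a, p) = u & follows op p];
  di_rs : forall q, q \in rs ->
    [/\ q.1 < n, arc_path q.1 q.2 & sk (walk_end q) = 3];
  di_src : uniq (map fst rs) /\ {subset map fst rs <= take (j - (act != 0)) As};
  di_end : uniq (map walk_end rs);
  di_u : act = 2 -> sk u = 3 /\ u \notin map walk_end rs;
  di_num : size rs + (act == 2) + \sum_(v < n) (sk v == 2) = abs
}.

(** A unit of flow on an arc is counted twice: once for walking along it, once for writing the arc
    later if it survives in the loop erasure, of length [lp]. *)
Definition dec_pot (r cu : nat -> nat) (j act lp : nat) :=
  2 * \sum_(x < 2 * m) (c - r x) + \sum_(v < n) rank tl v (cu v)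
  + (if act == 0 then 0 else if act == 1 then lp + 3 else lp + 1)
  + 5 * (size As - j).

Lemma dec_init h0 nx H r d cur cu sk st op a u abs : arc_lists n m tl h0 nx ->
  flow_inv n m tl c H As Bs r d cur sk st (size As) 0 u abs ->
  (forall v, v < n -> cu v = h0 v) ->
  dec_inv abs r cu sk st op 0 0 a u [::] [::].
Proof.
move=> lists [] res bal _ sk1 _ abs1 _ _ _ _ _ _ _ _ sk2 cuE.
split=> // [v vn|v vn|v y vn|v vn|x xm].
- by have := bal v vn; rewrite take_size drop0 /= !addn0.
- by rewrite cuE //; case: (proj1 lists v vn).
- by rewrite cuE // => h1 h2 h3; have [_ _ h] := proj1 lists v vn; case: (h y h1 h2).
- have := sk1 v vn; have := sk2 v vn; case: (Bs v) => //; first by lia.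
  by case: (sk v) => [|[|[|k]]].
- by have := res x xm; rewrite /=; lia.
Qed.

Variables (abs : nat) (r cu sk st op : nat -> nat) (j a u : nat).
Variables (rs : seq (nat * seq nat)) (p : seq nat).

Lemma dec_a act : dec_inv abs r cu sk st op j act a u rs p -> act <> 0 -> a < n.
Proof.
move=> inv a0; have [j0 -> _ _ _] := di_path inv a0; have := di_j inv => jA.
by apply: (nth_As As_lt); lia.
Qed.

Lemma dec_u act : dec_inv abs r cu sk st op j act a u rs p -> act <> 0 -> u < n.
Proof.
move=> inv a0; have an := dec_a inv a0.
have [_ _ /andP[pw _] <- _] := di_path inv a0.
by apply: (allP (arc_walk_ends an pw)); rewrite /walk_end /= mem_last.
Qed.

Lemma dec_start : dec_inv abs r cu sk st op j 0 a u rs p -> j < size As ->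
  let b := nth 0 As j in
  dec_inv abs r cu sk st op (j + 1) 1 b b rs [::] /\
  dec_pot r cu (j + 1) 1 0 < dec_pot r cu j 0 0.
Proof.
move=> [] res bal ptr cur sk1 ld act0 j0 path rs1 src ends u1 num jA b.
split; last first.
  rewrite /dec_pot /=; move: (\sum_(_ < _) _) (\sum_(_ < _) _) => *; lia.
split=> // [v vn||_|].
- have := bal v vn; rewrite (drop_As As_uniq v jA) /=; lia.
- lia.
- by rewrite addnK; split=> //; lia.
- by rewrite addnK; move: src; rewrite subn0.
Qed.

(** Tokens are interchangeable: a walk that meets a stuck token may end with it, whatever source
    that token came from, and its path is dropped. *)
Lemma dec_discard : dec_inv abs r cu sk st op j 1 a u rs p -> sk u <> 2 -> 0 < st u ->
  dec_inv abs r cu sk (upd st u (st u - 1)) op j 0 a u rs p /\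
  dec_pot r cu j 0 0 < dec_pot r cu j 1 (size p).
Proof.
move=> inv su stu; have un : u < n by apply: (dec_u inv).
case: inv => [] res bal ptr cur sk1 ld act0 j0 path rs1 src ends u1 num.
split; last first.
  rewrite /dec_pot /=; move: (\sum_(_ < _) _) (\sum_(_ < _) _) => *; lia.
split=> // [v vn|x xm|].
- have := bal v vn; rewrite /upd /=; have [->|_] := eqVneq v u; lia.
- by have := ld x xm; rewrite /=; lia.
- case: src => [s1 s2]; split=> // q /s2; rewrite subn0 /= => /mem_take_le; apply; lia.
Qed.

Lemma dec_collect : dec_inv abs r cu sk st op j 1 a u rs p -> sk u = 2 ->
  dec_inv abs r cu (upd sk u 3) st op j 2 a u rs p /\
  dec_pot r cu j 2 (size p) < dec_pot r cu j 1 (size p).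
Proof.
move=> inv su; have un : u < n by apply: (dec_u inv).
case: inv => [] res bal ptr cur sk1 ld act0 j0 path rs1 src ends u1 num.
split; last first.
  rewrite /dec_pot /=; move: (\sum_(_ < _) _) (\sum_(_ < _) _) => *; lia.
split=> // [v vn|v vn|_|q qrs|_|].
- have := bal v vn; rewrite /upd /=; have [->|_] := eqVneq v u; rewrite ?su /=; lia.
- rewrite /upd; have [->|_] := eqVneq v u; last exact: sk1.
  by have [s2 _] := sk1 u un; split=> // _; apply: s2; rewrite su.
- exact: path.
- have [q1 q2 q3] := rs1 q qrs; split=> //.
  by rewrite /upd; case: eqP => // E; rewrite q3.
- rewrite upd_eq; split=> //; apply/mapP => -[q qrs E].
  by have [_ _] := rs1 q qrs; rewrite -E su.
- have := sum_upd (fun=> fun y : nat => (y == 2) : nat) sk 3 un.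
  by rewrite su /= -num /=; lia.
Qed.

(** If no token ends at [u], the balance leaves less than [c * deg] of residual capacity out of [u].
    So some arc out of [u] still carries flow, whereas a null pointer would mean that none does. *)
Lemma dec_pointer : dec_inv abs r cu sk st op j 1 a u rs p -> sk u <> 2 -> st u = 0 ->
  0 < cu u.
Proof.
move=> inv su stu; have un : u < n by apply: (dec_u inv).
case: inv => [] res bal ptr cur _ _ _ _ _ _ _ _ _ _.
rewrite lt0n; apply/eqP => cu0; have := bal u un.
rewrite eqxx /= stu (_ : (sk u == 2) = false); last by apply/eqP.
suff : c * deg m tl u <= out_sum m tl r u by lia.
rewrite deg_out_sum; apply: leq_sum => x _; case: eqP => // xu.
by rewrite !mul1n; apply: cur un _ (ltn_ord x) xu; rewrite cu0.
Qed.

(** A step only removes flow: the reverse residual exceeds [c] before and is at least [c] after.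
    Hence no arc gains flow and the pointers never have to be reset. *)
Lemma dec_walk : dec_inv abs r cu sk st op j 1 a u rs p -> 0 < cu u ->
  let x := cu u - 1 in r x < c ->
  let r1 := upd r x (r x + 1) in
  let r2 := upd r1 (rarc x) (r1 (rarc x) - 1) in
  exists p',
    dec_inv abs r2 cu sk st (upd op u x) j 1 a (hd x) rs p' /\
    dec_pot r2 cu j 1 (size p') < dec_pot r cu j 1 (size p).
Proof.
move=> inv cu0 x rx r1 r2; have un : u < n by apply: (dec_u inv).
case: inv => [] res bal ptr cur sk1 ld act0 j0 path rs1 src ends u1 num.
have [p1 p2] := ptr u un; have {}p2 : tl x = u by apply: p2.
have xm : x < 2 * m by rewrite /x; lia.
have [jp aE pp pe fp] := path ltac:(by []).
have xt : tl x = walk_end (a, p) by rewrite p2 pe.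
have [p' [pp' pe' fp' sp' sub]] := loop_erasure pp fp xm xt.
have rxx := rarc_neq x; have resx := res x xm.
have r1x : r1 (rarc x) = r (rarc x) by rewrite /r1 upd_neq.
have r2E y : r2 y = if y == rarc x then r (rarc x) - 1 else
    if y == x then r x + 1 else r y by rewrite /r2 /r1 /upd (negbTE rxx).
have r2x : r2 x = r x + 1 by rewrite r2E eq_sym (negbTE rxx) eqxx.
have r2rx : r2 (rarc x) = r (rarc x) - 1 by rewrite r2E eqxx.
exists p'; split; last first.
  rewrite /dec_pot /=.
  have /= := sum_upd (fun _ y => c - y) r (r x + 1) xm.
  have /= := sum_upd (fun _ y => c - y) r1 (r1 (rarc x) - 1) (rarc_lt xm).
  rewrite -/r1 -/r2 r1x.
  set s1 := \sum_(_ < _) (c - r2 _); set s2 := \sum_(_ < _) (c - r1 _).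
  set s3 := \sum_(_ < _) (c - r _); move: (\sum_(_ < _) _); lia.
split=> // [y ym|v vn|v y vn h1 h2 h3|y ym|_].
- rewrite !r2E (can_eq rarcK) (can2_eq rarcK rarcK).
  have := res y ym; have [->|_] := eqVneq y (rarc x).
    by rewrite rarcK (negbTE rxx); lia.
  by have [->|_] := eqVneq y x; rewrite ?(negbTE rxx); lia.
- have := sum_upd (fun y ry => (tl y == v) * ry) r (r x + 1) xm.
  have := sum_upd (fun y ry => (tl y == v) * ry) r1 (r1 (rarc x) - 1) (rarc_lt xm).
  rewrite -/(out_sum m tl r2 v) -/(out_sum m tl r1 v) -/(out_sum m tl r v) -/(hd x) p2 r1x.
  have := bal v vn; rewrite [v == u]eq_sym [v == hd _]eq_sym /=.
  have xu := tl_neq xm; rewrite p2 in xu.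
  have [<-|_] := eqVneq u v; first by rewrite eq_sym ?(negbTE xu) eq_sym ?(negbTE xu) /=; lia.
  by case: eqP => _ /=; lia.
- have := cur v y vn h1 h2 h3; rewrite r2E; case: eqP => [->|_]; first by lia.
  by case: eqP => [->|_]; lia.
- have := ld y ym; rewrite /=.
  have up : uses p' (y %/ 2) -> y %/ 2 = x %/ 2 \/ uses p (y %/ 2).
    by case/mapP=> z /sub; rewrite inE => /orP[/eqP->|zp] ->; [left | right; apply: map_f].
  case: (y %/ 2 =P x %/ 2) => [/same_edge[->|->]|yx].
  + by rewrite r2x r2rx; apply: walk_load.
  + rewrite rarcK r2x r2rx => h; rewrite addnAC; apply: walk_load resx rx _.
    by rewrite addnAC; exact: h.
  + have yx1 : y <> rarc x by move=> E; case: yx; rewrite E rarc_div.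
    have yx2 : y <> x by move=> E; case: yx; rewrite E.
    have -> : r2 y = r y by rewrite r2E; do 2!case: eqP => //.
    have -> : r2 (rarc y) = r (rarc y).
      by rewrite r2E (can_eq rarcK) (can2_eq rarcK rarcK); do 2!case: eqP => //.
    apply: leq_trans; rewrite !leq_add2r leq_add2l.
    by case: (boolP (uses p' _)) => [/up[//|->]|].
- by rewrite p2 in fp'; split.
Qed.

Lemma dec_next h0 nx : arc_lists n m tl h0 nx ->
  dec_inv abs r cu sk st op j 1 a u rs p -> 0 < cu u ->
  let x := cu u - 1 in c <= r x ->
  dec_inv abs r (upd cu u (nx x)) sk st op j 1 a u rs p /\
  dec_pot r (upd cu u (nx x)) j 1 (size p) < dec_pot r cu j 1 (size p).
Proof.
move=> lists inv cu0 x rx; have un : u < n by apply: (dec_u inv).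
case: inv => [] res bal ptr cur sk1 ld act0 j0 path rs1 src ends u1 num.
have [p1 p2] := ptr u un; have {}p2 : tl x = u by apply: p2.
have xm : x < 2 * m by rewrite /x; lia.
have [q1 q2 q3] := (proj2 lists) x xm; rewrite p2 in q2 q3.
have cE : cu u = x.+1 by rewrite /x; lia.
split; last first.
  rewrite /dec_pot.
  have := sum_upd (fun v p => rank tl v p) cu (nx x) un.
  rewrite cE rankS p2 eqxx /=; have := rank_mono tl u q1.
  set s1 := \sum_(_ < _) _; set s2 := \sum_(_ < _) _.
  by set s3 := \sum_(_ < _) _; lia.
split=> // [v vn|v y vn].
- rewrite /upd; have [->|_] := eqVneq v u; last exact: ptr.
  by split=> //; lia.
- rewrite /upd; have [->|_] := eqVneq v u => h1 h2 h3; last exact: cur h1 h2 h3.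
  have [yx|yx] := ltnP y x; first by case: (q3 y h1 yx h3).
  have [yE|xy] := eqVneq y x; first by rewrite yE.
  by apply: cur un _ h2 h3; lia.
Qed.

(* In mode 2, the first k steps of p have been written, and v is their end. *)
Lemma dec_follow k : dec_inv abs r cu sk st op j 2 a u rs p -> k <= size p ->
  let v := walk_end (a, take k p) in
  (v <> u -> [/\ k < size p, op v = nth 0 p k,
     hd (op v) = walk_end (a, take (k + 1) p) & take (k + 1) p = rcons (take k p) (op v)])
  /\ (v = u -> k = size p).
Proof.
move=> inv kp v; have [_ _ /andP[pw pu] pe fp] := di_path inv ltac:(by []).
have vE : v = nth a (a :: map hd p) k.
  rewrite /v /walk_end /= (last_nth a) -(nth_take a (leqnn k.+1) (a :: map hd p)).
  by rewrite /= map_take size_take_min size_map (minn_idPl kp).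
have uE : u = nth a (a :: map hd p) (size p).
  by rewrite -pe /walk_end (last_nth a) size_map.
split=> [vu|vu]; last first.
  by move: vu; rewrite vE uE => /eqP; rewrite nth_uniq //= ?size_map ?ltnS // => /eqP.
have kl : k < size p.
  by rewrite ltn_neqAle kp andbT; apply/eqP => E; apply: vu; rewrite vE uE E.
have tv : tl (nth 0 p k) = v.
  have := pw; rewrite -{1}(cat_take_drop k p) (drop_nth 0 kl).
  rewrite /v /walk_end /=; move: (a) (take k p) => b s.
  by elim: s b => [|y s IH] b /= /and3P[_ /eqP ? //]; apply: IH.
have opv : op v = nth 0 p k by rewrite -tv; apply: fp; apply: mem_nth.
rewrite opv addn1 (take_nth 0 kl); split=> //.
by rewrite /walk_end /= map_rcons last_rcons.
Qed.

Lemma dec_finish : dec_inv abs r cu sk st op j 2 a u rs p ->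
  dec_inv abs r cu sk st op j 0 a u (rcons rs (a, p)) p.
Proof.
move=> inv; have an := dec_a inv ltac:(by []).
case: inv => [] res bal ptr cur sk1 ld act0 j0 path rs1 src ends u1 num.
have [jp aE pp pe fp] := path ltac:(by []).
have [su uend] := u1 erefl.
have jA : j - 1 < size As by lia.
split=> // [x xm|q|||].
- by have := ld x xm; rewrite /load -cats1 count_cat /=; lia.
- by rewrite mem_rcons inE => /orP[/eqP->|/rs1 //]; rewrite pe.
- case: src => s1 s2; rewrite map_rcons rcons_uniq /= subn0; split.
    rewrite s1 andbT; apply/negP => /s2 /=; rewrite aE => /(nthP 0)[i].
    rewrite size_take_min leq_min => /andP[ij iA].
    by rewrite nth_take // => /eqP; rewrite nth_uniq //; lia.
  move=> b; rewrite mem_rcons inE => /orP[/eqP->|/s2 /= /mem_take_le]; last by apply; lia.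
  rewrite aE; apply/(nthP 0); exists (j - 1); last by rewrite nth_take //; lia.
  by rewrite size_take_min leq_min jA andbT; lia.
- by rewrite map_rcons rcons_uniq pe uend.
- by rewrite size_rcons -num /=; lia.
Qed.

(** When all sources are treated, the summed balances leave no used sink uncollected. *)
Lemma dec_final : dec_inv abs r cu sk st op (size As) 0 a u rs p -> size rs = abs.
Proof.
case=> res bal _ _ _ _ _ _ _ _ _ _ _ <-.
have E1 : \sum_(v < n) out_sum m tl r v = c * \sum_(x < 2 * m) 1.
  rewrite -(sum_symmetric res (w := fun=> 1)) //.
  by rewrite -(sum_out_sum tl_lt (fun=> 1) r); apply: eq_bigr => v _; rewrite mul1n.
have E2 : \sum_(v < n) c * deg m tl v = c * \sum_(x < 2 * m) 1.
  by rewrite -big_distrr /= (sum_deg tl_lt) sum_nat_const card_ord muln1.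
have : \sum_(v < n) out_sum m tl r v = \sum_(v < n) (c * deg m tl v + ((sk v == 2) + st v)).
  by apply: eq_bigr => v _; rewrite -bal // drop_size /= !addn0.
rewrite !big_split /= E1 E2; lia.
Qed.

(** Distinct sources and simple paths bound the length of the output, so that the write position
    fits in a cell. *)
Lemma dec_size act : dec_inv abs r cu sk st op j act a u rs p ->
  size (routes_code rs) <= n * (2 * n + 3) /\ size rs <= n.
Proof.
case=> _ _ _ _ _ _ _ _ _ rs1 [s1 s2] _ _ _.
have srs : size rs <= n.
  rewrite -(size_map fst) -[X in _ <= X](size_iota 0 n); apply: uniq_leq_size s1 _ => v vrs.
  by rewrite mem_iota; apply: (allP As_lt); apply: mem_take (s2 v vrs).
split=> //; apply: leq_trans (leq_mul srs (leqnn _)).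
elim: (rs) rs1 => [|q l IH] rs1 //=; rewrite /routes_code /= size_cat.
have [qn qp _] := rs1 q (mem_head _ _); have := arc_path_size qn qp.
have := IH ltac:(by move=> q' ql; apply: rs1; rewrite inE ql orbT).
by rewrite /routes_code /route_code /= size_steps_code; lia.
Qed.

End Decomposition.

(** * The programs *)

(* A scalar variable is cell 0 of an array of its own, so that [same_off] tells
   which variables a command leaves unchanged. *)
Notation aInp := 0 (only parsing).
Notation aOut := 1 (only parsing).
Notation vX := 2 (only parsing).
Notation vQ := 3 (only parsing).
Notation vDelta := 4 (only parsing).
Notation vP := 5 (only parsing).
Notation vL := 6 (only parsing).
Notation vH := 7 (only parsing).
Notation vJ := 8 (only parsing).
Notation vAct := 9 (only parsing).
Notation vU := 10 (only parsing).
Notation vAbs := 11 (only parsing).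
Notation aHead := 12 (only parsing).
Notation aNext := 13 (only parsing).
Notation aCur := 14 (only parsing).
Notation aCur2 := 15 (only parsing).
Notation aDeg := 16 (only parsing).
Notation aRes := 17 (only parsing).
Notation aDist := 18 (only parsing).
Notation aSink := 19 (only parsing).
Notation aStuck := 20 (only parsing).
Notation aExit := 21 (only parsing).
Notation vV := 22 (only parsing).
Notation vCnt := 23 (only parsing).
Notation vWp := 24 (only parsing).
Notation vBase := 25 (only parsing).
Notation vLen := 26 (only parsing).
Notation vA := 27 (only parsing).
Notation vI := 28 (only parsing).
Notation vE := 29 (only parsing).
Notation vS := 30 (only parsing).
Notation vFound := 31 (only parsing).

Declare Scope ram_scope.
Delimit Scope ram_scope with ram.
Coercion Cst : nat >-> expr.
Notation "a @[ e ]" := (Read a e) (at level 2, e at level 200) : ram_scope.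
Notation "$ a" := (Read a (Cst 0)) (at level 2, a at level 1) : ram_scope.
Notation "e1 + e2" := (Bin OAdd e1 e2) : ram_scope.
Notation "e1 - e2" := (Bin OSub e1 e2) : ram_scope.
Notation "e1 * e2" := (Bin OMul e1 e2) : ram_scope.
Notation "e1 <= e2" := (Bin OLeq e1 e2) : ram_scope.
Notation "e1 == e2" := (Bin OEq e1 e2) : ram_scope.
Notation "'put' a [ e1 ] e2" := (Write a e1 e2)
  (at level 69, a at level 1, e1 at level 200, e2 at level 60) : ram_scope.
Notation "a ::= e" := (Write a (Cst 0) e) (at level 69) : ram_scope.
Notation "c1 ;; c2" := (Seq c1 c2) (at level 80, right associativity) : ram_scope.

(** Five header words precede the endpoints in the input, and the two endpoints of edge [e] are the
    tails of the arcs [2 e] and [2 e + 1]. *)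
Definition arc_tail (x : expr) : expr := (aInp @[5 + x])%ram.
Definition arc_rev (x : expr) : expr := (x + 1 - 2 * Bin OMod x 2)%ram.
Definition arc_head (x : expr) : expr :=
  (aInp @[5 + arc_rev x])%ram.
Notation inp_n := (Read aInp (Cst 0)) (only parsing).
Notation inp_m := (Read aInp (Cst 1)) (only parsing).
Notation inp_a := (Read aInp (Cst 2)) (only parsing).
Notation inp_b := (Read aInp (Cst 3)) (only parsing).
Notation inp_z := (Read aInp (Cst 4)) (only parsing).

Lemma rarcE x : x + 1 - 2 * (x %% 2) = rarc x.
Proof. by rewrite /rarc; case: ifP; lia. Qed.

Definition arcs_body : cmd :=
 (vV ::= arc_tail ($ vX) ;;
  put aNext [$ vX] (aHead @[$ vV]) ;;
  put aHead [$ vV] ($ vX + 1) ;;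
  put aCur [$ vV] ($ vX + 1) ;;
  put aCur2 [$ vV] ($ vX + 1) ;;
  put aRes [$ vX] (2 * $ vQ) ;;
  put aDeg [$ vV] (aDeg @[$ vV] + 1) ;;
  If (aDeg @[$ vV] <= $ vDelta) Skip (vDelta ::= aDeg @[$ vV]) ;;
  vX ::= $ vX + 1)%ram.

Definition arcs_loop : cmd :=
  (While ($ vX + 1 <= 2 * inp_m) arcs_body)%ram.

Definition inp_tail (inp : nat -> nat) x := inp (5 + x).

(** * Preprocessing: the scale [q], a logarithm, the sinks and the arc lists *)

Section Phases.
Variables (W : nat) (test : nat -> nat -> bool) (B : nat).
Local Notation D := 20.
Hypothesis B_ge2 : 2 <= B.
Hypothesis W_ge : B ^ D <= W.
Local Notation runs := (runs W test B).

Variables (inp : nat -> nat).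
Local Notation n := (inp 0).
Local Notation m := (inp 1).
Local Notation tl := (inp_tail inp).
Hypothesis tl_lt : forall x, x < 2 * m -> tl x < n.

Lemma runs_pre c1 c2 s T Q : loopfree c1 -> cdeg c1 <= D ->
  wp test B c1 s (fun s' => bounded B s' -> same_off (mods c1) s s' -> runs c2 s' T Q) ->
  runs (Seq c1 c2) s (ccost c1 + T) Q.
Proof.
move=> l1 d1 H; apply: runs_seq.
by apply: runs_weaken (wp_runs B_ge2 W_ge l1 d1 H) => // s' b f; apply.
Qed.

(** The test is [q psi <= 1]; a linear search is affordable as its length is of order [1 / psi]. *)
Definition scale_loop : cmd :=
  (While (Test ($ vQ) 1) (vQ ::= $ vQ + 1))%ram.

Lemma scale_runs s q : s vQ 0 = 1 -> 0 < q -> (forall a, test a 1 = (a < q)) ->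
  q <= B -> runs scale_loop s (100 * (q + 1)) (fun s' => s' vQ 0 = q).
Proof.
move=> sQ q0 testE qB.
pose I k (s' : state) := s' vQ 0 + k = q.
apply: runs_weaken
  (runs_while B_ge2 W_ge (I := I) (k0 := q - 1)
  (K := ccost (vQ ::= $ vQ + 1)%ram) _ _ _) => //.
- by apply: leq_trans (_ : 100 * (q - 1).+1 <= _); [rewrite leq_mul2r; apply/orP; right | lia].
- by move=> s' _ _ [/= + [k kE]]; rewrite testE; rewrite /I in kE; case: ltnP => //; lia.
- move=> k s' b f kE /=; rewrite testE; rewrite /I in kE; case: ltnP => // h _.
  apply: (wp_runs B_ge2 W_ge); [by [] | by [] |]; rewrite /= /update /=.
  by split; [lia | exists (k - 1); rewrite /I /=; lia].
- by rewrite /I sQ; lia.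
Qed.

Definition log_body : cmd := (vP ::= 2 * $ vP ;; vL ::= $ vL + 1)%ram.
Definition log_loop : cmd := (While ($ vP <= inp_n) log_body)%ram.

Lemma log_runs s : s aInp = inp -> s vP 0 = 1 -> s vL 0 = 0 -> 2 * n < B ->
  runs log_loop s (100 * (n + 1)) (fun s' =>
    n < 2 ^ s' vL 0 /\ (0 < s' vL 0 -> 2 ^ (s' vL 0 - 1) <= n)).
Proof.
move=> sI sP sL nB.
pose I k s' := [/\ k = n - s' vL 0, s' vP 0 = 2 ^ s' vL 0 &
  0 < s' vL 0 -> 2 ^ (s' vL 0 - 1) <= n].
apply: runs_weaken
  (runs_while B_ge2 W_ge (I := I) (k0 := n) (K := ccost log_body) _ _ _) => //.
- by rewrite [n + 1]addn1 leq_mul2r; apply/orP; right.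
- move=> s' _ f [/= H [k [_ kP kL]]]; rewrite (f 0) // sI kP in H.
  by split=> //; move: H; case: leqP.
- move=> k s' b f [kE kP kL] /=; rewrite (f 0) // sI kP; case: leqP => // h _.
  have lt : s' vL 0 < n by apply: leq_trans h; apply: ltn_expl.
  apply: (wp_runs B_ge2 W_ge); [by [] | by [] |]; rewrite /= /update /= kP.
  do 2!(split; first by lia).
  exists (k - 1); first by lia.
  by split=> /=; rewrite ?addnK ?expnD ?expn1; lia.
- by rewrite /I sP sL subn0.
Qed.

Local Notation na := (inp 2).
Local Notation nb := (inp 3).
Local Notation As := (mkseq (fun j => inp (5 + 2 * m + j)) na).
Local Notation Bl := (mkseq (fun j => inp (5 + 2 * m + na + j)) nb).

Definition sink_body : cmd :=
  (put aSink [aInp @[5 + 2 * inp_m + inp_a + $ vJ]] 1 ;; vJ ::= $ vJ + 1)%ram.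
Definition sink_loop : cmd := (While ($ vJ + 1 <= inp_b) sink_body)%ram.

Lemma sink_runs s : s aInp = inp -> s vJ 0 = 0 -> (forall v, s aSink v = 0) -> nb < B ->
  runs sink_loop s (100 * (nb + 1)) (fun s' => forall v, s' aSink v = (v \in Bl)).
Proof.
move=> sI sJ sS nB.
pose I k s' := s' vJ 0 + k = nb /\
  forall v, s' aSink v = (v \in mkseq (fun j => inp (5 + 2 * m + na + j)) (s' vJ 0)).
apply: runs_weaken
  (runs_while B_ge2 W_ge (I := I) (k0 := nb) (K := ccost sink_body) _ _ _) => //.
- by rewrite [nb + 1]addn1 leq_mul2r; apply/orP; right.
- move=> s' _ f [/= H [k [kE kS]]]; rewrite (f 0) // sI in H.
  have E : s' vJ 0 = nb by move: H; case: leqP => //; lia.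
  by move=> v; rewrite kS E.
- move=> k s' b f [kE kS] /=; rewrite (f 0) // sI; case: leqP => // h _.
  apply: (wp_runs B_ge2 W_ge); [by [] | by [] |]; rewrite /= /update /= (f 0) // sI.
  split; first by lia.
  split; first by lia.
  exists (k - 1); first by lia.
  split=> [|v] /=; first by lia.
  by rewrite addn1 mkseqS mem_rcons inE kS /=; case: eqP.
- by split=> [|v]; rewrite ?sJ ?sS.
Qed.

Lemma arcs_runs s dmax : s aInp = inp -> s vX 0 = 0 -> s vDelta 0 = 0 ->
  (forall a, a \in [:: aHead; aCur; aCur2; aDeg] -> forall v, s a v = 0) ->
  (forall v, v < n -> deg m tl v <= dmax) ->
  2 * m < B -> 2 * s vQ 0 <= B -> dmax <= B ->
  runs arcs_loop s (100 * (2 * m + 1)) (fun s' =>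
    [/\ arc_lists n m tl (s' aHead) (s' aNext),
        forall v, v < n -> s' aCur v = s' aHead v /\ s' aCur2 v = s' aHead v,
        forall x, x < 2 * m -> s' aRes x = 2 * s vQ 0 &
        s' vDelta 0 <= dmax /\ forall v, v < n -> deg m tl v <= s' vDelta 0]).
Proof.
move=> sI sX sDl zero dmaxP mB QB dB.
pose I k s' := [/\ s' vX 0 + k = 2 * m,
  (forall v, v < n -> last_arc tl v (s' aHead v) (s' vX 0)) /\
  (forall x, x < s' vX 0 -> last_arc tl (tl x) (s' aNext x) x),
  forall v, v < n -> s' aCur v = s' aHead v /\ s' aCur2 v = s' aHead v,
  forall x, x < s' vX 0 -> s' aRes x = 2 * s vQ 0 &
  [/\ s' vDelta 0 <= dmax, forall v, v < n -> s' aDeg v = rank tl v (s' vX 0) &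
    forall v, v < n -> rank tl v (s' vX 0) <= s' vDelta 0]].
apply: runs_weaken
  (runs_while B_ge2 W_ge (I := I) (k0 := 2 * m) (K := ccost arcs_body) _ _ _) => //.
- by rewrite [2 * m + 1]addn1 leq_mul2r; apply/orP; right.
- move=> s' _ f [/= H [k [kE [L1 L2] L3 L4 [L5 L6 L7]]]].
  have E : s' vX 0 = 2 * m.
    by move: H; rewrite (f 0) // sI; case: leqP => //; lia.
  by rewrite E in L1 L4 L7 L2; split.
- move=> k s' b f [kE [L1 L2] L3 L4 [L5 L6 L7]] /= xm.
  rewrite (f 0) // sI in xm.
  have {}xm : s' vX 0 < 2 * m by move: xm; rewrite addn1; case: leqP.
  set x := s' vX 0 in kE L1 L2 L4 L6 L7 xm.
  set t := tl x; have tn : t < n by apply: tl_lt.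
  have rk v : rank tl v (x + 1) = rank tl v x + (v == t).
    by rewrite addn1 rankS eq_sym.
  have rkd v : v < n -> rank tl v (x + 1) <= dmax.
    by move=> vn; apply: leq_trans (dmaxP v vn); apply: rank_mono; lia.
  (* The two branches of the body differ only in whether the maximum degree is raised; both are
     captured by [maxn]. *)
  have key s2 : s2 vX 0 = x + 1 -> s2 aHead =1 upd (s' aHead) t (x + 1) ->
      s2 aCur =1 upd (s' aCur) t (x + 1) -> s2 aCur2 =1 upd (s' aCur2) t (x + 1) ->
      s2 aNext =1 upd (s' aNext) x (s' aHead t) ->
      s2 aRes =1 upd (s' aRes) x (2 * s vQ 0) ->
      s2 aDeg =1 upd (s' aDeg) t (s' aDeg t + 1) ->
      s2 vDelta 0 = maxn (s' vDelta 0) (rank tl t (x + 1)) ->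
      exists2 k', k' < k & I k' s2.
    move=> E1 E2 E3 E4 E5 E6 E7 E8; exists (k - 1); first by lia.
    split; rewrite ?E1; first by lia.
    - split=> [v vn|y yx].
        rewrite E2 /upd; have [->|vt] := eqVneq v t.
          split=> //; last by move=> y; lia.
          by rewrite addnK.
        have [l1 l2 l3] := L1 v vn; split=> [||y y1 y2]; [lia | exact: l2 | ].
        have [->|yx] := eqVneq y x; first by move=> E; rewrite -E eqxx in vt.
        by apply: l3 => //; lia.
      rewrite E5 /upd; have [->|yt] := eqVneq y x; first exact: L1.
      by apply: L2; lia.
    - by move=> v vn; rewrite E2 E3 E4 /upd; case: eqP => // _; apply: L3.
    - by move=> y yx; rewrite E6 /upd; have [//|yx'] := eqVneq y x; apply: L4; lia.
    - rewrite E8; split=> [|v vn|v vn].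
      + by rewrite geq_max L5 rkd.
      + by rewrite E7 rk /upd; have [->|_] := eqVneq v t; rewrite L6 // addn0.
      + rewrite leq_max rk; have [->|_] := eqVneq v t; last by rewrite addn0 L7.
        by rewrite rk eqxx leqnn orbT.
  apply: (wp_runs B_ge2 W_ge); [by [] | by [] |]; rewrite /arcs_body /arc_tail /= /update /=.
  rewrite (f 0) // (f vQ) // sI -/(tl _) -/x -/t eqxx.
  have tB : t <= B by rewrite /t /inp_tail -sI -(f 0).
  have degB : s' 16 t + 1 <= B.
    by have := rkd t tn; rewrite rk eqxx L6 //; lia.
  do !(split; first by [| lia | exact: b]).
  case: leqP => h /=; do ?(split; first by lia).
  - by apply: key => //=; rewrite rk eqxx -L6 //; lia.
  - by apply: key => //=; rewrite rk eqxx -L6 //; lia.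
- rewrite /I sX; split=> //.
  + split=> // v vn; split; rewrite ?zero ?inE //.
  + by move=> v vn; rewrite !zero ?inE.
  + rewrite sDl; split=> // v vn; first by rewrite zero ?inE // /rank big_ord0.
    by rewrite /rank big_ord0.
Qed.

End Phases.

(** * Push-relabel and flow decomposition as programs *)

Definition flow_body : cmd :=
 (If ($ vAct == 0)
    (vU ::= aInp @[5 + 2 * inp_m + $ vJ] ;; vJ ::= $ vJ + 1 ;; vAct ::= 1)
 (If (aSink @[$ vU] == 1)
    (put aSink [$ vU] 2 ;; vAbs ::= $ vAbs + 1 ;; vAct ::= 0)
 (If ($ vH <= aDist @[$ vU])
    (put aStuck [$ vU] (aStuck @[$ vU] + 1) ;; vAct ::= 0)
 (If (aCur @[$ vU] == 0)
    (put aDist [$ vU] (aDist @[$ vU] + 1) ;; put aCur [$ vU] (aHead @[$ vU]))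
    (vX ::= aCur @[$ vU] - 1 ;;
     vV ::= arc_head ($ vX) ;;
     If ((1 <= aRes @[$ vX]) * (aDist @[$ vU] == aDist @[$ vV] + 1))
       (put aRes [$ vX] (aRes @[$ vX] - 1) ;;
        put aRes [arc_rev ($ vX)] (aRes @[arc_rev ($ vX)] + 1) ;;
        vU ::= $ vV)
       (put aCur [$ vU] (aNext @[$ vX])))))))%ram.

Definition flow_loop : cmd := (While ($ vAct + ($ vJ + 1 <= inp_a)) flow_body)%ram.

Definition walk_body : cmd :=
 (vX ::= aCur2 @[$ vU] - 1 ;;
  If (2 * $ vQ <= aRes @[$ vX]) (put aCur2 [$ vU] (aNext @[$ vX]))
    (put aRes [$ vX] (aRes @[$ vX] + 1) ;;
     put aRes [arc_rev ($ vX)] (aRes @[arc_rev ($ vX)] - 1) ;;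
     put aExit [$ vU] ($ vX) ;;
     vU ::= arc_head ($ vX)))%ram.

(** The length of the path becomes known only after following the exits from the source, so its
    cell, at [vBase], is skipped and filled in last. *)
Definition collect_body : cmd :=
 (put aSink [$ vU] 3 ;; put aOut [$ vWp] ($ vA) ;; put aOut [$ vWp + 1] ($ vU) ;;
  vBase ::= $ vWp + 2 ;; vWp ::= $ vWp + 3 ;; vLen ::= 0 ;; vV ::= $ vA ;;
  vCnt ::= $ vCnt + 1 ;; vAct ::= 2)%ram.

Definition follow_body : cmd :=
 (vX ::= aExit @[$ vV] ;; vV ::= arc_head ($ vX) ;;
  put aOut [$ vWp] (Bin ODiv ($ vX) 2) ;; put aOut [$ vWp + 1] ($ vV) ;;
  vWp ::= $ vWp + 2 ;; vLen ::= $ vLen + 1)%ram.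

Definition dec_body : cmd :=
 (If ($ vAct == 0)
    (vA ::= aInp @[5 + 2 * inp_m + $ vJ] ;; vU ::= $ vA ;; vJ ::= $ vJ + 1 ;;
     vAct ::= 1)
 (If ($ vAct == 1)
    (If (aSink @[$ vU] == 2) collect_body
    (If (1 <= aStuck @[$ vU])
       (put aStuck [$ vU] (aStuck @[$ vU] - 1) ;; vAct ::= 0)
       walk_body))
    (If ($ vV == $ vU) (put aOut [$ vBase] ($ vLen) ;; vAct ::= 0) follow_body)))%ram.

Definition dec_loop : cmd := (While ($ vAct + ($ vJ + 1 <= inp_a)) dec_body)%ram.

Ltac by_cells := repeat (case: eqP => ? /=); by [|lia].

Section Phases.
Variables (W : nat) (test : nat -> nat -> bool) (B : nat).
Local Notation D := 20.
Hypothesis B_ge2 : 2 <= B.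
Hypothesis W_ge : B ^ D <= W.
Local Notation runs := (runs W test B).

Variables (inp : nat -> nat).
Local Notation n := (inp 0).
Local Notation m := (inp 1).
Local Notation na := (inp 2).
Local Notation tl := (inp_tail inp).
Local Notation As := (mkseq (fun j => inp (5 + 2 * m + j)) na).
Hypothesis tl_lt : forall x, x < 2 * m -> tl x < n.
Hypothesis tl_neq : forall x, x < 2 * m -> tl x != ahead tl x.
Hypothesis As_uniq : uniq As.
Hypothesis As_lt : all (ltn^~ n) As.

Lemma na_le : na <= n.
Proof.
rewrite -[na](size_mkseq (fun j => inp (5 + 2 * m + j))) -[n](size_iota 0).
by apply: uniq_leq_size As_uniq _ => v vA; rewrite mem_iota; apply: (allP As_lt).
Qed.

Lemma flow_runs s c Bs K :
  let H := s vH 0 in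
  let inv s' := flow_inv n m tl c H As Bs (s' aRes) (s' aDist) (s' aCur) (s' aSink)
    (s' aStuck) (s' vJ 0) (s' vAct 0) (s' vU 0) (s' vAbs 0) in
  s aInp = inp -> arc_lists n m tl (s aHead) (s aNext) -> inv s ->
  2 * c <= B -> n + 4 <= B -> H <= B ->
  flow_pot n m tl H As (s aDist) (s aCur) (s vJ 0) (s vAct 0) (s vU 0) <= K ->
  runs flow_loop s (200 * (K + 1)) (fun s' =>
    [/\ inv s', s' vJ 0 = na & s' vAct 0 = 0]).
Proof.
move=> H inv sI lists inv0 cB nB HB potK.
have sA : size As = na by rewrite size_mkseq.
pose pot (s' : state) :=
  flow_pot n m tl H As (s' aDist) (s' aCur) (s' vJ 0) (s' vAct 0) (s' vU 0).
pose I k s' := inv s' /\ pot s' = k.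
apply: runs_weaken
  (runs_while B_ge2 W_ge (I := I) (k0 := pot s) (K := ccost flow_body) _ _ _) => //.
- apply: leq_trans (_ : 200 * (pot s).+1 <= _); last by rewrite addn1 leq_mul2l ltnS potK.
  by rewrite leq_mul2r; apply/orP; right.
- move=> s' _ f [/= E [k [iv _]]]; rewrite (f 0) // sI in E.
  have := fi_j iv; rewrite sA => ?.
  by split=> //; move: E; case: leqP; lia.
- move=> k s' b f [iv kE] /=; rewrite (f 0) // sI => E.
  have jn := fi_j iv; rewrite sA in jn; have nan := na_le.
  apply: (wp_runs B_ge2 W_ge); [by [] | by [] |]; rewrite /= /update /= (f 0) // (f vH) // sI -/H.
  have start : s' vAct 0 = 0 ->
    [/\ inp (5 + 2 * m + s' vJ 0) <= B, s' vJ 0 + 1 <= B & s' vJ 0 < na].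
    move=> a0; rewrite a0 in E; have jl : s' vJ 0 < na by move: E; case: leqP; lia.
    by split=> //; [rewrite -sI -(f 0) | lia].
  rewrite /I /pot -kE /pot; move: iv; rewrite /inv => iv {inv0 potK kE E}.
  have [a0|a0] := eqVneq (s' vAct 0) 0; rewrite /=.
    have [h1 h2 h3] := start a0; do 3!(split; first by lia).
    rewrite a0 in iv *; have [F1 F2] := flow_start As_uniq As_lt iv (ltac:(by rewrite sA)).
    rewrite nth_mkseq // in F1 F2.
    by eexists; [exact: F2 | split; [exact: F1 | reflexivity]].
  have a1 : s' vAct 0 = 1 by have := fi_act iv; lia.
  rewrite a1 in iv *; have un := fi_u iv erefl.
  have dB v : v < n -> s' aDist v <= B by move=> vn; have := fi_d iv vn; lia.
  have [su|su] := eqVneq (s' aSink _) 1; rewrite /=.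
    split; first by lia.
    have [F1 F2] := flow_absorb As_uniq As_lt iv su.
    split; last by split; [lia | eexists; [exact: F2 | split; [exact: F1 | reflexivity]]].
    rewrite -(fi_abs F1); apply: leq_trans (_ : \sum_(v < n) 1 <= _).
      by apply: leq_sum => v _; apply: leq_b1.
    by rewrite sum_nat_const card_ord; lia.
  have {}su : s' aSink (s' vU 0) <> 1 by apply/eqP.
  have [du|du] := leqP H (s' aDist (s' vU 0)); rewrite /=.
    have [F1 F2] := flow_stuck As_uniq As_lt iv du.
    split; last by split; [lia | eexists; [exact: F2 | split; [exact: F1 | reflexivity]]].
    by have := fi_st2 iv un; case: (_ \in _); lia.
  have [lh lx] := lists; have [hu _ _] := lh _ un.
  have [cu0|cu0] := eqVneq (s' aCur _) 0; rewrite /=.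
    have [F1 F2] := flow_relabel tl_neq lists As_uniq As_lt iv su du cu0.
    split; first by lia.
    split; first exact: b.
    rewrite (f aHead) //.
    by eexists; [exact: F2 | split; [exact: F1 | reflexivity]].
  have {}cu0 : 0 < s' aCur (s' vU 0) by rewrite lt0n.
  have [p1 p2] := fi_ptr iv un.
  have xm : s' aCur (s' vU 0) - 1 < 2 * m by lia.
  have rx := fi_res iv xm.
  rewrite !rarcE -/(inp_tail inp _) -/(ahead tl _).
  split; first by exact: leq_trans (leq_subr _ _) (b _ _).
  split; first by rewrite /ahead /inp_tail -sI -(f 0).
  case: ifP => [adm|nadm].
    have r1 : 0 < s' aRes (s' aCur (s' vU 0) - 1) by move: adm; case: leqP; lia.
    have dE : s' aDist (s' vU 0) = s' aDist (ahead tl (s' aCur (s' vU 0) - 1)) + 1.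
      by apply/eqP; apply: contraT => /negbTE ne; rewrite ne muln0 in adm.
    have [F1 F2] := flow_push tl_lt tl_neq As_uniq As_lt iv su du cu0 r1 dE.
    rewrite (negbTE (rarc_neq _)).
    split; first by exact: leq_trans (leq_subr _ _) (b _ _).
    split; first by lia.
    split; first by rewrite /ahead /inp_tail -sI -(f 0).
    rewrite /upd (negbTE (rarc_neq _)) in F1.
    by eexists; [exact: F2 | split; [exact: F1 | reflexivity]].
  have [F1 F2] := flow_next lists As_uniq As_lt iv cu0 ltac:(
    by case=> r1 dE; move: nadm; rewrite r1 dE eqxx).
  rewrite (f aNext) //; split; first by rewrite -(f aNext).
  by eexists; [exact: F2 | split; [exact: F1 | reflexivity]].
Qed.

Local Notation code := (routes_code tl).

(** Cells 0 and 1 hold the kind of the result and the number of routes; they are written at the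
    end. *)
Definition written (o : nat -> nat) rs :=
  forall i, i < size (code rs) -> o (2 + i) = nth 0 (code rs) i.

Lemma written_upd o rs a w : written o rs -> 2 + size (code rs) <= a ->
  written (upd o a w) rs.
Proof. by move=> H la i il; rewrite upd_neq ?H //; apply/eqP; lia. Qed.

(* While the path p is being written, its first k steps are in place, and the cell
   of its length is still open. *)
Definition out_inv (s : state) rs p k :=
  [/\ s vCnt 0 = size rs + (s vAct 0 == 2), written (s aOut) rs,
    s vAct 0 <> 2 -> s vWp 0 = 2 + size (code rs) &
    s vAct 0 = 2 -> [/\ k <= size p, s vV 0 = walk_end tl (s vA 0, take k p),
      s vLen 0 = k,
      s vBase 0 = size (code rs) + 4 /\ s vWp 0 = size (code rs) + 5 + 2 * k &
      [/\ s aOut (size (code rs) + 2) = s vA 0, s aOut (size (code rs) + 3) = s vU 0 &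
        forall i, i < 2 * k ->
          s aOut (size (code rs) + 5 + i) = nth 0 (steps_code tl (take k p)) i]]].

Lemma written_rcons o rs q : written o rs -> let l := size (code rs) in
  o (l + 2) = q.1 -> o (l + 3) = walk_end tl q -> o (l + 4) = size q.2 ->
  (forall i, i < 2 * size q.2 -> o (l + 5 + i) = nth 0 (steps_code tl q.2) i) ->
  written o (rcons rs q).
Proof.
move=> H l h1 h2 h3 h4 i.
rewrite /routes_code map_rcons -cats1 flatten_cat size_cat nth_cat -/(code rs) -/l.
rewrite /= cats0 /= size_steps_code => il; case: ltnP => [|li]; first exact: H.
have [d dE] : exists d, i = l + d by exists (i - l); lia.
rewrite dE addKn; case: d dE => [|[|[|d]]] dE /=.
- by rewrite -h1; congr o; lia.
- by rewrite -h2; congr o; lia.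
- by rewrite -h3; congr o; lia.
- by rewrite -h4; [congr o; lia | lia].
Qed.

Lemma size_code_rcons rs q :
  size (code (rcons rs q)) = size (code rs) + 3 + 2 * size q.2.
Proof.
rewrite /routes_code map_rcons -cats1 flatten_cat size_cat /= cats0 /=.
by rewrite size_steps_code; lia.
Qed.

Lemma dec_runs s c Bs abs K :
  let inv s' := dec_inv n m tl c As Bs abs (s' aRes) (s' aCur2) (s' aSink)
    (s' aStuck) (s' aExit) (s' vJ 0) (s' vAct 0) (s' vA 0) (s' vU 0) in
  s aInp = inp -> arc_lists n m tl (s aHead) (s aNext) -> 2 * s vQ 0 = c ->
  inv s [::] [::] -> s vAct 0 = 0 -> s vCnt 0 = 0 -> s vWp 0 = 2 ->
  2 * c <= B -> n * (2 * n + 3) + 2 * n + 10 <= B ->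
  dec_pot n m tl c As (s aRes) (s aCur2) (s vJ 0) 0 0 <= K ->
  runs dec_loop s (300 * (K + 1)) (fun s' => exists rs p,
    [/\ inv s' rs p, s' vJ 0 = na, s' vAct 0 = 0, s' vCnt 0 = size rs &
        written (s' aOut) rs]).
Proof.
move=> inv sI lists cE inv0 sAct sCnt sWp cB nB potK.
have sA : size As = na by rewrite size_mkseq.
(* In mode 2 only the part of the path that is not yet written counts. *)
pose pot (s' : state) (p : seq nat) w := dec_pot n m tl c As (s' aRes) (s' aCur2)
  (s' vJ 0) (s' vAct 0) (if s' vAct 0 == 2 then size p - w else size p).
pose I k s' := exists rs p w, [/\ inv s' rs p, out_inv s' rs p w & pot s' p w = k].
apply: runs_weaken
  (runs_while B_ge2 W_ge (I := I) (k0 := pot s [::] 0) (K := ccost dec_body) _ _ _) => //.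
- have -> : pot s [::] 0 = dec_pot n m tl c As (s aRes) (s aCur2) (s vJ 0) 0 0.
    by rewrite /pot sAct.
  apply: leq_trans (_ : 300 * (_).+1 <= _); last by rewrite addn1 leq_mul2l ltnS; exact: potK.
  by rewrite leq_mul2r; apply/orP; right.
- move=> s' _ f [/= E [k [rs [p [w [iv [o1 o2 o3 o4] _]]]]]]; rewrite (f 0) // sI in E.
  have := di_j iv; rewrite sA => ?.
  have a0 : s' vAct 0 = 0 by lia.
  exists rs, p; split=> //; last by rewrite o1 a0 addn0.
  by move: E; case: leqP; lia.
- move=> k s' b f [rs [p [w [iv ov kE]]]] /=; rewrite (f 0) // sI => E.
  have jn := di_j iv; rewrite sA in jn; have nan := na_le.
  have [szc szr] := dec_size tl_lt As_uniq As_lt iv.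
  have start : s' vAct 0 = 0 ->
    [/\ inp (5 + 2 * m + s' vJ 0) <= B, s' vJ 0 + 1 <= B & s' vJ 0 < na].
    move=> a0; rewrite a0 in E; have jl : s' vJ 0 < na by move: E; case: leqP; lia.
    by split=> //; [rewrite -sI -(f 0) | lia].
  have psz : s' vAct 0 <> 0 -> size p < n.
    move=> a0; have an := dec_a As_uniq As_lt iv a0.
    by have [_ _ pp _ _] := di_path iv a0; apply: arc_path_size pp.
  apply: (wp_runs B_ge2 W_ge); [by [] | by [] |]; rewrite /= /update /= (f 0) // (f vQ) // sI cE.
  rewrite -kE; move: iv; rewrite /inv => iv {inv0 potK kE E sAct sCnt sWp}.
  have [o1 o2 o3 o4] := ov.
  have [a0|a0] := eqVneq (s' vAct 0) 0; rewrite /=.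
    have [h1 h2 h3] := start a0; do 4!(split; first by lia).
    rewrite a0 in iv o1 o3 *; have [F1 F2] := dec_start As_uniq As_lt iv (ltac:(by rewrite sA)).
    rewrite nth_mkseq // in F1 F2.
    eexists; last first.
      by exists rs, [::], 0; split; [exact: F1 | | reflexivity];
        split; [exact: o1 | exact: o2 | by move=> _; apply: o3 | by []].
    by rewrite /pot /= a0; exact: F2.
  have [a1|a1] := eqVneq (s' vAct 0) 1; rewrite /=.
    rewrite a1 in iv o1 o3 o4 *.
    have un : s' vU 0 < n by apply: (dec_u tl_lt As_uniq As_lt iv).
    have wpE := o3 ltac:(by []).
    have [su|su] := eqVneq (s' aSink _) 2; rewrite /=.
      have [F1 F2] := dec_collect tl_lt As_uniq As_lt iv su.
      split; first by lia.
      split; first exact: b.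
      split; first exact: b.
      do 3!(split; first by lia).
      split; first exact: b.
      split; first by rewrite o1 /=; lia.
      split; first by lia.
      eexists; last first.
        exists rs, p, 0; split; [exact: F1 | | reflexivity].
        split; rewrite /=.
        + by rewrite o1 addn0.
        + by apply: written_upd; [apply: written_upd | ]; rewrite ?wpE //; lia.
        + by [].
        + move=> _; rewrite take0; split; [by [] | by [] | by [] | by rewrite wpE; lia |].
          split; first by rewrite wpE; by_cells.
            by rewrite wpE; by_cells.
          by move=> i; rewrite muln0.
      by rewrite /pot /= a1 subn0; exact: F2.
    have {}su : s' aSink (s' vU 0) <> 2 by apply/eqP.
    have [st0|st0] := ltnP 0 (s' aStuck (s' vU 0)); rewrite /=.
      have [F1 F2] := dec_discard tl_lt As_uniq As_lt iv su st0.
      split; first by exact: leq_trans (leq_subr _ _) (b _ _).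
      split; first by lia.
      eexists; last first.
        exists rs, p, 0; split; [exact: F1 | | reflexivity].
        by split; [exact: o1 | exact: o2 | by move=> _; exact: wpE | by []].
      by rewrite /pot /= a1; exact: F2.
    have {}st0 : s' aStuck (s' vU 0) = 0 by lia.
    have cu0 := dec_pointer tl_lt As_uniq As_lt iv su st0.
    have [p1 p2] := di_ptr iv un.
    have xm : s' aCur2 (s' vU 0) - 1 < 2 * m by lia.
    have rx := di_res iv xm.
    split; first by exact: leq_trans (leq_subr _ _) (b _ _).
    rewrite !rarcE -/(inp_tail inp _) -/(ahead tl _).
    have [rc|rc] := leqP c (s' aRes (s' aCur2 (s' vU 0) - 1)); rewrite /=.
      have [F1 F2] := dec_next tl_lt As_uniq As_lt lists iv cu0 rc.
      split; first exact: b.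
      rewrite (f aNext) //; eexists; last first.
        exists rs, p, 0; split; [rewrite /inv /= a1; exact: F1 | | reflexivity].
        by split; rewrite /= ?a1; [exact: o1 | exact: o2 | by move=> _; exact: wpE | by []].
      by rewrite /pot /= a1; exact: F2.
    have [p' [F1 F2]] := dec_walk tl_lt tl_neq As_uniq As_lt iv cu0 rc.
    rewrite (negbTE (rarc_neq _)).
    split; first by lia.
    split; first by exact: leq_trans (leq_subr _ _) (b _ _).
    split; first by exact: leq_trans (leq_subr _ _) (b _ _).
    split; first by rewrite /ahead /inp_tail -sI -(f 0).
    rewrite /upd (negbTE (rarc_neq _)) in F1 F2.
    eexists; last first.
      exists rs, p', 0; split; [rewrite /inv /= a1; exact: F1 | | reflexivity].
      by split; rewrite /= ?a1; [exact: o1 | exact: o2 | by move=> _; exact: wpE | by []].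
    by rewrite /pot /= a1; exact: F2.
  have {a0 a1} a2 : s' vAct 0 = 2 by have := di_act iv; lia.
  have pn := psz ltac:(by rewrite a2).
  rewrite a2 in iv o1 o3 o4 *.
  have [wp vE lenE [bE wpE] [q1 q2 q3]] := o4 erefl.
  have [g1 g2] := dec_follow iv wp; rewrite -vE in g1 g2.
  have [_ _ pp pu _] := di_path iv ltac:(by []).
  have [vu|vu] := eqVneq (s' vV 0) (s' vU 0); rewrite /=.
    have F1 := dec_finish As_uniq As_lt iv.
    have wE := g2 vu; rewrite wE take_size in q3.
    split; first exact: b.
    split; first by lia.
    eexists; last first.
      exists (rcons rs (s' vA 0, p)), p, 0; split; [exact: F1 | | reflexivity].
      split; rewrite /=.
      + by rewrite o1 size_rcons; lia.
      + apply: written_rcons.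
        * by apply: written_upd => //; lia.
        * by rewrite /= q1 bE; by_cells.
        * by rewrite /= pu q2 bE; by_cells.
        * by rewrite /= bE lenE wE; by_cells.
        * by move=> i il; rewrite /= q3 // bE; by_cells.
      + by move=> _; rewrite size_code_rcons wpE wE /=; lia.
      + by [].
    by rewrite /pot /= a2 /dec_pot /= wE subnn; lia.
  have [kl opE hE tE] := g1 ltac:(by apply/eqP).
  rewrite !rarcE -/(inp_tail inp _) -/(ahead tl _).
  have steps : steps_code tl (take (w + 1) p) =
      steps_code tl (take w p) ++ step_code tl (s' aExit (s' vV 0)).
    by rewrite tE /steps_code map_rcons -cats1 flatten_cat.
  split; first exact: b.
  split; first by rewrite /ahead /inp_tail -sI -(f 0).
  split; first by apply: leq_trans (leq_div _ _) _; exact: b.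
  split; first by rewrite /ahead /inp_tail -sI -(f 0).
  split; first by lia.
  split; first by lia.
  eexists; last first.
    exists rs, p, (w + 1); split; [rewrite /inv /= a2; exact: iv | | reflexivity].
    split; rewrite /= ?a2.
    + exact: o1.
    + by apply: written_upd; [apply: written_upd | ]; rewrite ?wpE //; lia.
    + by [].
    + move=> _; split; [by lia | exact: hE | by rewrite /= lenE |
        by rewrite /= bE wpE; lia |].
      split; rewrite /=.
      * by rewrite wpE q1; by_cells.
      * by rewrite wpE q2; by_cells.
      * move=> i il; rewrite steps nth_cat size_steps_code size_take_min (minn_idPl wp).
        case: ltnP => h; first by rewrite wpE q3 //; by_cells.
        have [iE|iE] : i = 2 * w \/ i = 2 * w + 1 by lia.
          by rewrite iE subnn wpE /=; by_cells.
        by rewrite iE addKn wpE /=; by_cells.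
  by rewrite /pot /= a2 /dec_pot /=; lia.
- exists [::], [::], 0; split=> //; split=> //; rewrite ?sAct ?sCnt //.
Qed.

End Phases.

(** * The search for a sparse level cut *)

Definition edge_count_body : cmd :=
 (vE ::= $ vE + ($ vI <= aDist @[arc_tail ($ vX)]) *
                (aDist @[arc_head ($ vX)] + 1 <= $ vI) ;;
  vX ::= $ vX + 1)%ram.

Definition vertex_count_body : cmd :=
 (vS ::= $ vS + ($ vI <= aDist @[$ vV]) ;; vV ::= $ vV + 1)%ram.

Definition level_body : cmd :=
 ((vE ::= 0 ;; vS ::= 0 ;; vX ::= 0 ;; vV ::= 0) ;;
  (While ($ vX + 1 <= 2 * inp_m) edge_count_body ;;
   (While ($ vV + 1 <= inp_n) vertex_count_body ;;
    If (($ vQ * $ vE <= $ vS) * ($ vQ * $ vE <= inp_n - $ vS))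
      (vFound ::= 1) (vI ::= $ vI + 1))))%ram.

Definition side_body : cmd :=
 (put aOut [$ vV + 1] ($ vI <= aDist @[$ vV]) ;; vV ::= $ vV + 1)%ram.

Definition cut_loop : cmd :=
 ((vI ::= 1 ;; vFound ::= 0) ;;
  (While ($ vFound == 0) level_body ;;
   (vV ::= 0 ;; While ($ vV + 1 <= inp_n) side_body)))%ram.

Section Phases.
Variables (W : nat) (test : nat -> nat -> bool) (B : nat).
Local Notation D := 20.
Hypothesis B_ge2 : 2 <= B.
Hypothesis W_ge : B ^ D <= W.
Local Notation runs := (runs W test B).

Variables (inp : nat -> nat).
Local Notation n := (inp 0).
Local Notation m := (inp 1).
Local Notation tl := (inp_tail inp).

Lemma edge_count_runs s : s aInp = inp -> s vX 0 = 0 -> s vE 0 = 0 -> 2 * m < B ->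
  runs (While ($ vX + 1 <= 2 * inp_m)%ram edge_count_body) s (100 * (2 * m + 1))
    (fun s' => s' vE 0 = crossing m tl (s aDist) (s vI 0)).
Proof.
move=> sI sX sE mB.
pose I k s' := s' vX 0 + k = 2 * m /\ s' vE 0 = \sum_(x < s' vX 0)
  ((s vI 0 <= s aDist (tl x)) * (s aDist (ahead tl x) < s vI 0)).
apply: runs_weaken
  (runs_while B_ge2 W_ge (I := I) (k0 := 2 * m) (K := ccost edge_count_body) _ _ _) => //.
- by rewrite [2 * m + 1]addn1 leq_mul2r; apply/orP; right.
- move=> s' _ f [/= H [k [kE kS]]]; rewrite (f 0) // sI in H.
  have E : s' vX 0 = 2 * m by move: H; case: leqP => //; lia.
  by rewrite kS E.
- move=> k s' b f [kE kS] /=; rewrite (f 0) // sI; case: leqP => // h _.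
  apply: (wp_runs B_ge2 W_ge); [by [] | by [] |]; rewrite /= /update /= (f 0) // (f vI) // (f aDist) // sI.
  rewrite rarcE -/(inp_tail inp _) -/(ahead tl _) addn1.
  have le : \sum_(x < s' vX 0)
    ((s vI 0 <= s aDist (tl x)) * (s aDist (ahead tl x) < s vI 0)) <= s' vX 0.
    rewrite -[X in _ <= X]card_ord -sum1_card; apply: leq_sum => x _.
    by rewrite mulnb leq_b1.
  split; first by rewrite kS mulnb; apply: leq_trans (leq_add le (leq_b1 _)) _; lia.
  split; first by lia.
  exists (k - 1); first by lia.
  by split=> /=; rewrite addn1; [lia | rewrite big_ord_recr /= kS].
- by split; rewrite sX // big_ord0.
Qed.

Lemma vertex_count_runs s : s aInp = inp -> s vV 0 = 0 -> s vS 0 = 0 -> n < B ->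
  runs (While ($ vV + 1 <= inp_n)%ram vertex_count_body) s (100 * (n + 1))
    (fun s' => s' vS 0 = above n (s aDist) (s vI 0)).
Proof.
move=> sI sX sE nB.
pose I k s' := s' vV 0 + k = n /\ s' vS 0 = \sum_(v < s' vV 0) (s vI 0 <= s aDist v).
apply: runs_weaken
  (runs_while B_ge2 W_ge (I := I) (k0 := n) (K := ccost vertex_count_body) _ _ _) => //.
- by rewrite [n + 1]addn1 leq_mul2r; apply/orP; right.
- move=> s' _ f [/= H [k [kE kS]]]; rewrite (f 0) // sI in H.
  have E : s' vV 0 = n by move: H; case: leqP => //; lia.
  by rewrite kS E.
- move=> k s' b f [kE kS] /=; rewrite (f 0) // sI; case: leqP => // h _.
  apply: (wp_runs B_ge2 W_ge); [by [] | by [] |]; rewrite /= /update /= (f vI) // (f aDist) //.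
  have le : \sum_(v < s' vV 0) (s vI 0 <= s aDist v) <= s' vV 0.
    rewrite -[X in _ <= X]card_ord -sum1_card; apply: leq_sum => x _.
    by apply: leq_b1.
  split; first by rewrite kS; apply: leq_trans (leq_add le (leq_b1 _)) _; lia.
  split; first by lia.
  exists (k - 1); first by lia.
  by split=> /=; rewrite addn1; [lia | rewrite big_ord_recr /= kS].
- by split; rewrite sX // big_ord0.
Qed.

Lemma side_runs s : s aInp = inp -> s vV 0 = 0 -> n < B ->
  runs (While ($ vV + 1 <= inp_n)%ram side_body) s (100 * (n + 1))
    (fun s' => s' aOut 0 = s aOut 0 /\
       forall v, v < n -> s' aOut (v + 1) = (s vI 0 <= s aDist v)).
Proof.
move=> sI sX nB.
pose I k s' := [/\ s' vV 0 + k = n, s' aOut 0 = s aOut 0 &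
  forall v, v < s' vV 0 -> s' aOut (v + 1) = (s vI 0 <= s aDist v)].
apply: runs_weaken
  (runs_while B_ge2 W_ge (I := I) (k0 := n) (K := ccost side_body) _ _ _) => //.
- by rewrite [n + 1]addn1 leq_mul2r; apply/orP; right.
- move=> s' _ f [/= H [k [kE k0 kS]]]; rewrite (f 0) // sI in H.
  have E : s' vV 0 = n by move: H; case: leqP => //; lia.
  by rewrite E in kS.
- move=> k s' b f [kE k0 kS] /=; rewrite (f 0) // sI; case: leqP => // h _.
  apply: (wp_runs B_ge2 W_ge); [by [] | by [] |]; rewrite /= /update /= (f vI) // (f aDist) //.
  split; first by case: leqP; lia.
  split; first by lia.
  exists (k - 1); first by lia.
  split=> /=; first by lia.
    by rewrite addn1.
  move=> v vl; rewrite eqn_add2r; case: eqP => [->//|vn]; apply: kS; lia.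
- by split; rewrite ?sX.
Qed.

Definition good_level (d : nat -> nat) q i :=
  q * crossing m tl d i <= above n d i /\ q * crossing m tl d i <= below n d i.

(** The level [i0], known to be good, caps the search and keeps the level counter within a cell. *)
Lemma level_runs s i0 : s aInp = inp -> 2 * m < B -> n < B -> i0 < B ->
  s vI 0 < i0 \/ s vI 0 = i0 /\ good_level (s aDist) (s vQ 0) i0 ->
  runs level_body s (500 * (2 * m + n + 1)) (fun s' =>
    s' vFound 0 = 1 /\ s' vI 0 = s vI 0 /\ good_level (s aDist) (s vQ 0) (s vI 0) \/
    s' vFound 0 = s vFound 0 /\ s' vI 0 = s vI 0 + 1 /\
      ~ good_level (s aDist) (s vQ 0) (s vI 0)).
Proof.
move=> sI mB nB iB hi.
apply: (@runs_weaken W test B _ _ (ccost (vE ::= 0 ;; vS ::= 0 ;; vX ::= 0 ;; vV ::= 0)%ram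
  + (100 * (2 * m + 1) + (100 * (n + 1) +
     ccost (If (($ vQ * $ vE <= $ vS) * ($ vQ * $ vE <= inp_n - $ vS))
      (vFound ::= 1) (vI ::= $ vI + 1))%ram)))).
- by rewrite /=; lia.
- by move=> s' _ _; exact: id.
apply: (runs_pre B_ge2 W_ge) => //; rewrite /= /update /=.
do 4!(split; first by []).
set s0 := (X in bounded _ X) => b0 f0.
apply: runs_seq; apply: (runs_weaken (leqnn _)) (edge_count_runs _ _ _ mB) => //.
move=> s1 b1 f1 E1; apply: runs_seq.
apply: (runs_weaken (leqnn _)) (vertex_count_runs _ _ _ nB) => //; rewrite ?(f1 aInp, f1 vV, f1 vS) //.
move=> s2 b2 f2 E2.
apply: (wp_runs B_ge2 W_ge); [by [] | by [] |]; rewrite /= /update /=.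
rewrite (f2 vE) // (f2 vQ) // (f2 aInp) // (f2 vI) // (f1 vQ) // (f1 aInp) // (f1 vI) //.
rewrite (f2 vFound) // (f1 vFound) // E1 E2 (f1 aDist) // (f1 vI) // /s0 /= sI.
have -> : n - above n (s aDist) (s vI 0) = below n (s aDist) (s vI 0).
  by rewrite -{1}(above_below n (s aDist) (s vI 0)) addKn.
have iB' : s vI 0 < B by case: hi => [|[-> _]]; lia.
have [h1|h1] := leqP (_ * _) (above _ _ _); rewrite /=; last first.
  split; first by lia.
  right; split=> //; split=> // -[g1 g2].
  by have := leq_ltn_trans g1 h1; rewrite ltnn.
have [h2|h2] := leqP (_ * _) (below _ _ _); rewrite /=; last first.
  split; first by lia.
  right; split=> //; split=> // -[g1 g2].
  by have := leq_ltn_trans g2 h2; rewrite ltnn.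
split; first by lia.
by left; split=> //; split.
Qed.

Lemma cut_runs s i0 : s aInp = inp -> 2 * m < B -> n < B -> i0 < B -> 1 <= i0 ->
  good_level (s aDist) (s vQ 0) i0 ->
  runs cut_loop s (2000 * ((i0 + 1) * (2 * m + n + 1))) (fun s' => exists2 i,
    1 <= i <= i0 & [/\ good_level (s aDist) (s vQ 0) i, s' aOut 0 = s aOut 0 &
      forall v, v < n -> s' aOut (v + 1) = (i <= s aDist v)]).
Proof.
move=> sI mB nB iB i1 gi.
(* Each iteration either sets the flag or raises the level, and the level cannot pass [i0]. *)
pose I k s' := [/\ s' vFound 0 <= 1, 1 <= s' vI 0, s' vI 0 <= i0,
  s' vFound 0 = 1 -> good_level (s aDist) (s vQ 0) (s' vI 0) &
  k = i0 + 1 - s' vI 0 - s' vFound 0].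
set K := 500 * (2 * m + n + 1).
apply: (@runs_weaken W test B _ _ (ccost (vI ::= 1 ;; vFound ::= 0)%ram +
  ((K + expr_cost ($ vFound == 0)%ram).+1 * i0.+1 +
   (ccost (vV ::= 0)%ram + 100 * (n + 1))))).
- rewrite /K /= !mulnDr !mulnDl; lia.
- by move=> s' _ _; exact: id.
apply: (runs_pre B_ge2 W_ge) => //; rewrite /= /update /=.
do 2!(split; first by lia).
set s0 := (X in bounded _ X) => b0 f0.
apply: runs_seq; apply: (runs_weaken (leqnn _))
  (runs_while B_ge2 W_ge (I := I) (k0 := i0) (K := K) _ _ _) => //.
- move=> s1 b1 f1 [/= H [k [k1 k2 k3 k4 k5]]].
  have F1 : s1 vFound 0 = 1 by move: H; case: eqP => //; lia.
  apply: (runs_pre B_ge2 W_ge) => //; rewrite /= /update /=.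
  split; first by [].
  set s2 := (X in bounded _ X) => b2 f2.
  apply: (runs_weaken (leqnn _)) (side_runs _ _ nB) => //; last first.
    by rewrite (f2 aInp) // (f1 aInp).
  move=> s3 b3 f3 [e1 e2]; exists (s1 vI 0); first by rewrite k2 k3.
  split; first exact: k4.
    by rewrite e1 /s2 /= (f1 aOut).
  by move=> v vn; rewrite e2 // /s2 /= (f1 aDist) // /s0 /=.
- move=> k s1 b1 f1 [k1 k2 k3 k4 k5] /= nF.
  have F0 : s1 vFound 0 = 0 by move: nF; case: (s1 vFound 0 =P 0).
  have iC : s1 vI 0 < i0 \/ s1 vI 0 = i0 /\ good_level (s1 aDist) (s1 vQ 0) i0.
    rewrite (f1 aDist) // (f1 vQ) //; have [->|ne] := eqVneq (s1 vI 0) i0; first by right.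
    by left; rewrite ltn_neqAle ne.
  apply: (runs_weaken (leqnn _)) (level_runs _ mB nB iB iC) => //; last by rewrite (f1 aInp).
  move=> s2 b2 f2; rewrite (f1 aDist) // (f1 vQ) // /s0 /=.
  case=> [[e1 [e2 e3]]|[e1 [e2 e3]]].
    exists (k - 1); first by lia.
    by split; rewrite ?e1 ?e2 //; lia.
  have lt : s1 vI 0 < i0.
    by case: iC => // -[E]; rewrite (f1 aDist) // (f1 vQ) // /s0 /= -E.
  exists (k - 1); first by lia.
  by split; rewrite ?e1 ?e2 ?F0 //; lia.
- by split; rewrite /s0 /=; lia.
Qed.

End Phases.

(** * The assembled program *)

Definition routing_cmd : cmd :=
 (vJ ::= 0 ;; vWp ::= 2 ;; dec_loop ;; put aOut [0] 1 ;; put aOut [1] ($ vCnt))%ram.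

Definition main_cmd : cmd :=
 (vQ ::= 1 ;; scale_loop ;; arcs_loop ;; vP ::= 1 ;; log_loop ;;
  vH ::= 2 * (4 * $ vQ * $ vDelta * $ vL) ;; sink_loop ;; vJ ::= 0 ;; flow_loop ;;
  If (inp_a <= $ vAbs + inp_z) routing_cmd cut_loop)%ram.

Section Main.
Variables (W : nat) (test : nat -> nat -> bool) (B : nat).
Local Notation D := 20.
Hypothesis B_ge2 : 2 <= B.
Hypothesis W_ge : B ^ D <= W.
Local Notation runs := (runs W test B).

Variables (inp : nat -> nat).
Local Notation n := (inp 0).
Local Notation m := (inp 1).
Local Notation na := (inp 2).
Local Notation nb := (inp 3).
Local Notation z := (inp 4).
Local Notation tl := (inp_tail inp).
Local Notation As := (mkseq (fun j => inp (5 + 2 * m + j)) na).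
Local Notation Bl := (mkseq (fun j => inp (5 + 2 * m + na + j)) nb).
Hypothesis tl_lt : forall x, x < 2 * m -> tl x < n.
Hypothesis tl_neq : forall x, x < 2 * m -> tl x != ahead tl x.
Hypothesis As_uniq : uniq As.
Hypothesis As_lt : all (ltn^~ n) As.
Hypothesis Bl_uniq : uniq Bl.
Hypothesis Bl_lt : all (ltn^~ n) Bl.
Hypothesis na_nb : na <= nb.

Variables (q dmax lmax : nat).
Hypothesis q_gt0 : 0 < q.
Hypothesis testE : forall a, test a 1 = (a < q).
Hypothesis dmaxP : forall v, v < n -> deg m tl v <= dmax.
Hypothesis lmaxP : forall l, (0 < l -> 2 ^ (l - 1) <= n) -> l <= lmax.
Hypothesis m_gt0 : 0 < m.
Hypothesis n_le : n <= 2 * m.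
Hypothesis dmax_gt0 : 0 < dmax.

Definition routed (o : nat -> nat) := exists rs : seq (nat * seq nat),
  [/\ o 0 = 1 /\ o 1 = size rs, written inp o rs, na <= size rs + z,
    forall r, r \in rs -> [/\ r.1 \in As, walk_end tl r \in Bl & arc_path m tl r.1 r.2] &
    [/\ uniq (map fst rs), uniq (map (walk_end tl) rs) &
        forall e, e < m -> load rs e <= 2 * q]].

Definition separated (o : nat -> nat) := exists d i,
  [/\ o 0 = 0, forall v, v < n -> o (v + 1) = (i <= d v), good_level inp d q i &
    z < 2 * above n d i /\ z < below n d i].

Lemma runs_set a e s : edeg e <= D -> ev test s e <= B ->
  runs (Write a (Cst 0) e) s (ccost (Write a (Cst 0) e)) (fun s' => s' a 0 = ev test s e).
Proof.
move=> De eB; apply: (wp_runs B_ge2 W_ge) => //=; first by rewrite geq_max.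
by split=> //; rewrite /update !eqxx.
Qed.

Lemma nb_le : nb <= n.
Proof.
rewrite -[nb](size_mkseq (fun j => inp (5 + 2 * m + na + j))) -[n](size_iota 0).
by apply: uniq_leq_size Bl_uniq _ => v vB; rewrite mem_iota; apply: (allP Bl_lt).
Qed.

Lemma routing_runs s c abs h0 nx H r d cur :
  s aInp = inp -> s aHead = h0 -> s aNext = nx -> arc_lists n m tl h0 nx ->
  c = 2 * q -> s vQ 0 = q -> r = s aRes ->
  flow_inv n m tl c H As (mem Bl) r d cur (s aSink) (s aStuck) na 0 (s vU 0) abs ->
  (forall v, v < n -> s aCur2 v = h0 v) -> s vAct 0 = 0 -> s vCnt 0 = 0 ->
  na <= abs + z -> 4 * q + n * (2 * n + 3) + 2 * n + 10 <= B ->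
  runs routing_cmd s (300 * (8 * (m * q) + 2 * m + 5 * n + 1) + 20) (fun s' => routed (s' aOut)).
Proof.
move=> sI sh sn lists cE sQ rE inv cuE sAct sCnt absz qB.
have sA : size As = na by rewrite size_mkseq.
have nan := na_le As_uniq As_lt.
apply: (@runs_weaken W test B _ _ (ccost (vJ ::= 0)%ram + (ccost (vWp ::= 2)%ram +
  (300 * (8 * (m * q) + 2 * m + 5 * n + 1) +
   ccost (put aOut [0] 1 ;; put aOut [1] ($ vCnt))%ram)))); first by rewrite /=; lia.
  by move=> s' _ _; exact: id.
apply: runs_seq; apply: (runs_weaken (leqnn _)) (runs_set vJ (e := Cst 0) isT _) => //.
move=> s1 b1 f1 /= J1; apply: runs_seq.
apply: (runs_weaken (leqnn _)) (runs_set vWp (e := Cst 2) isT _) => //.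
move=> s2 b2 f2 /= W2; apply: runs_seq.
have fr a : a \notin [:: vJ; vWp] -> s2 a = s a.
  by rewrite !inE negb_or => /andP[h1 h2]; rewrite f2 ?f1 ?inE.
have Eh : s2 aHead = h0 by rewrite fr.
have En : s2 aNext = nx by rewrite fr.
have inv' : flow_inv n m tl c H As (mem Bl) r d cur (s aSink) (s aStuck) (size As) 0 (s vU 0) abs.
  by rewrite sA.
have dinv := dec_init As_uniq As_lt (s2 aExit) (s2 vA 0) lists inv' cuE.
apply: (runs_weaken (leqnn _)) (dec_runs (s := s2) (c := c) (Bs := mem Bl) (abs := abs)
  (K := 8 * (m * q) + 2 * m + 5 * n) test B_ge2 W_ge tl_lt tl_neq As_uniq As_lt _ _ _ _ _ _ _ _ _ _) => //.
- move=> s3 b3 f3 [rs [p [iv J3 a3 cnt wr]]].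
  have [szc szr] := dec_size tl_lt As_uniq As_lt iv.
  apply: (wp_runs B_ge2 W_ge); [by [] | by [] |]; rewrite /= /update /=.
  split; first by lia.
  split; first by rewrite cnt; lia.
  rewrite J3 a3 in iv; have sE : size rs = abs.
    apply: (@dec_final n m tl tl_lt c As (mem Bl) As_uniq As_lt abs); rewrite sA; exact: iv.
  exists rs; split=> //.
  + by rewrite sE.
  + move=> t trs; have [t1 t2 t3] := di_rs iv trs; split=> //.
      by apply: mem_take (proj2 (di_src iv) _ (map_f _ trs)).
    have [tw _] := andP t2.
    have tn : walk_end tl t < n.
      by apply: (allP (arc_walk_ends tl_lt t1 tw)); rewrite /walk_end mem_last.
    by apply: (proj1 (di_sk iv tn)); rewrite t3.
  + split; [exact: (proj1 (di_src iv)) | exact: di_end iv |].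
    move=> e em; have := di_load iv (x := 2 * e) ltac:(lia).
    by rewrite mulKn //= cE; lia.
- by rewrite fr.
- by rewrite Eh En.
- by rewrite fr // sQ cE.
- by rewrite (fr aRes) // (fr aCur2) // (fr aSink) // (fr aStuck) // (fr vAct) // (fr vU) //
    (f2 vJ) // J1 sAct -rE.
- by rewrite fr.
- by rewrite fr.
- by lia.
- by lia.
- rewrite /dec_pot /= (f2 vJ) // J1 subn0 sA addn0.
  have d1 : \sum_(x < 2 * m) (c - s2 aRes x) <= 2 * m * c.
    rewrite -[2 * m]card_ord -sum_nat_const card_ord.
    by apply: leq_sum => x _; apply: leq_subr.
  have d2 : \sum_(v < n) rank tl v (s2 aCur2 v) <= 2 * m.
    apply: (sum_rank tl_lt) => v vn; rewrite fr // cuE //.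
    by case: (proj1 lists v vn).
  rewrite cE in d1 *.
  (* Two units of potential for each of at most [2 * q] units of flow on each of [2 * m] arcs. *)
  have d3 : 2 * (2 * m * (2 * q)) = 8 * (m * q) by rewrite !mulnA; lia.
  by rewrite -d3 !leq_add // ?leq_mul2l ?d1 ?nan ?orbT.
Qed.

(** [dmax] and [lmax] bound the degree and the logarithm that the program computes, and the time of
    every phase is charged to the product [Y]. *)
Lemma main_runs s : s aInp = inp -> (forall a i, a != aInp -> s a i = 0) ->
  let Y := m * (q * (dmax * lmax)) in
  2 * m + 2 * n + 10 <= B -> 8 * (q * (dmax * lmax)) < B -> dmax <= B ->
  4 * q + n * (2 * n + 3) + 2 * n + 10 <= B ->
  runs main_cmd s (200 * (1000 * Y)) (fun s' => routed (s' aOut) \/ separated (s' aOut)).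
Proof.
move=> sI sZ Y B1 B2 B3 B4.
have n0 : 0 < n by apply: leq_ltn_trans (tl_lt (x := 0) ltac:(lia)).
have l0 : 0 < lmax by apply: lmaxP.
have nbn := nb_le; have nan := na_le As_uniq As_lt.
set Hm := 8 * (q * (dmax * lmax)).
have Ym : m * Hm = 8 * Y by rewrite /Hm /Y mulnCA.
have mY : m <= Y by rewrite /Y leq_pmulr // !muln_gt0 q_gt0 dmax_gt0.
have HY : Hm <= 8 * Y by rewrite -Ym leq_pmull.
have Yn : n * Hm <= 16 * Y.
  by apply: leq_trans (leq_mul n_le (leqnn Hm)) _; rewrite -mulnA Ym mulnA.
have qY : m * q <= Y by rewrite /Y leq_mul2l leq_pmulr ?orbT // muln_gt0 dmax_gt0.
have qY' : q <= Y by apply: leq_trans qY; rewrite leq_pmull.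
(* A bound on the initial potential: all future relabellings, the first scan of the arcs, and the
   starts of at most [n] tokens. *)
pose K1 := Hm * (2 * m + 2 * n) + 2 * m + n * (Hm + 3).
have K1Y : K1 <= 72 * Y by rewrite /K1 !mulnDr (mulnC Hm) [Hm * _]mulnC -!mulnA; lia.
apply: (@runs_weaken W test B _ _ (ccost (vQ ::= 1)%ram + (100 * (q + 1) +
  (100 * (2 * m + 1) + (ccost (vP ::= 1)%ram + (100 * (n + 1) +
  (ccost (vH ::= 2 * (4 * $ vQ * $ vDelta * $ vL))%ram + (100 * (nb + 1) +
  (ccost (vJ ::= 0)%ram + (200 * (K1 + 1) +
  (expr_cost (inp_a <= $ vAbs + inp_z)%ram + 100 * (1000 * Y)).+1))))))))));
  [by rewrite /=; lia | by move=> s' _ _; exact: id |].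
apply: runs_seq; apply: (runs_weaken (leqnn _)) (runs_set vQ (e := Cst 1) isT _) => //;
  last by rewrite /=; lia.
move=> s1 b1 f1 /= Q1; apply: runs_seq.
apply: (runs_weaken (leqnn _)) (scale_runs B_ge2 W_ge Q1 q_gt0 testE _) => //; last by lia.
move=> s2 b2 f2 Q2; apply: runs_seq.
have g2 := same_off_cat f1 f2.
apply: (runs_weaken (leqnn _)) (arcs_runs (dmax := dmax) test B_ge2 W_ge tl_lt _ _ _ _ dmaxP _ _ B3) => //;
  rewrite ?(g2 aInp, g2 vX, g2 vDelta) ?sZ //; first 1 last.
- by move=> a aI v; rewrite g2 ?sZ //; move: aI; rewrite !inE => /or4P[] /eqP->.
- by lia.
- by rewrite Q2; lia.
move=> s3 b3 f3 [lists curs res [dl1 dl2]].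
have g3 := same_off_cat g2 f3.
apply: runs_seq.
apply: (runs_weaken (leqnn _)) (runs_set vP (e := Cst 1) isT _) => //; last by rewrite /=; lia.
move=> s4 b4 f4 /= P4; have g4 := same_off_cat g3 f4; apply: runs_seq.
apply: (runs_weaken (leqnn _)) (log_runs test B_ge2 W_ge _ P4 _ _) => //;
  rewrite ?(g4 aInp, g4 vL) ?sZ //; last by lia.
move=> s5 b5 f5 [l1 l2]; have g5 := same_off_cat g4 f5.
have h5 := same_off_cat f4 f5; have i5 := same_off_cat f3 h5.
have lm := lmaxP l2.
have D5 : s5 vDelta 0 <= dmax by rewrite h5.
have Q5 : s5 vQ 0 = q by rewrite i5.
apply: runs_seq; apply: (runs_weaken (leqnn _)) (runs_set vH (s := s5)
  (e := (2 * (4 * $ vQ * $ vDelta * $ vL))%ram) isT _) => //; last first.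
  rewrite /= Q5; apply: leq_trans (ltnW B2); rewrite -!mulnA mulnA leq_mul2l /= leq_mul2l.
  by rewrite leq_mul ?orbT.
move=> s6 b6 f6 /=; rewrite Q5 => H6; apply: runs_seq.
have g6 := same_off_cat g5 f6; have h6 := same_off_cat h5 f6.
have i6 := same_off_cat i5 f6.
apply: (runs_weaken (leqnn _)) (sink_runs (s := s6) test B_ge2 W_ge _ _ _ _) => //;
  rewrite ?(g6 aInp, g6 vJ) ?sZ //; [ | by move=> v; rewrite g6 ?sZ | by lia].
move=> s7 b7 f7 sk7; apply: runs_seq.
apply: (runs_weaken (leqnn _)) (runs_set vJ (e := Cst 0) isT _) => //.
move=> s8 b8 f8 /= J8; apply: runs_seq.
have j8 := same_off_cat f7 f8; have g8 := same_off_cat g6 j8.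
have h8 := same_off_cat h6 j8; have i8 := same_off_cat i6 j8.
set H := 2 * (4 * q * s5 vDelta 0 * s5 vL 0) in H6.
have HE : s8 vH 0 = H by rewrite j8.
have HHm : H <= Hm.
  by rewrite /H /Hm -!mulnA mulnA leq_mul2l /= leq_mul2l leq_mul ?orbT.
have Q8 : s8 vQ 0 = q by rewrite i8.
have inv8 : flow_inv n m tl (2 * q) H As (mem Bl) (s8 aRes) (s8 aDist) (s8 aCur)
    (s8 aSink) (s8 aStuck) (s8 vJ 0) (s8 vAct 0) (s8 vU 0) (s8 vAbs 0).
  rewrite J8 (g8 vAct) // (g8 vAbs) // !sZ //.
  refine (@flow_init n m tl tl_lt _ _ lists (2 * q) H As (mem Bl) As_uniq As_lt
    (s8 aRes) (s8 aDist) (s8 aCur) (s8 aSink) (s8 aStuck) (s8 vU 0) _ _ _ _ _).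
  - by move=> x xm; rewrite h8 // res // Q2.
  - by move=> v _; rewrite g8 // sZ.
  - by move=> v vn; rewrite h8 //; case: (curs v vn).
  - by move=> v _; rewrite f8 // sk7.
  - by move=> v _; rewrite g8 // sZ.
have pot8 : flow_pot n m tl (s8 vH 0) As (s8 aDist) (s8 aCur) (s8 vJ 0) (s8 vAct 0)
    (s8 vU 0) <= K1.
  rewrite HE J8 (g8 vAct) // sZ // /flow_pot mul0n addn0 subn0 size_mkseq /K1.
  apply: leq_add; last by apply: leq_mul nan _; rewrite leq_add2r.
  apply: leq_add.
    apply: leq_trans (_ : \sum_(v < n) Hm * (deg m tl v + 2) <= _).
      by apply: leq_sum => v _; apply: leq_mul => //; apply: leq_trans (leq_subr _ _) HHm.
    by rewrite -big_distrr /= big_split /= (sum_deg tl_lt) sum_nat_const card_ord [n * 2]mulnC.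
  apply: (sum_rank tl_lt) => v vn; rewrite h8 //; case: (curs v vn) => -> _.
  by case: (proj1 lists v vn).
have HmB : H < B by apply: leq_ltn_trans HHm B2.
apply: (runs_weaken (leqnn _)) (flow_runs (s := s8) (c := 2 * q) (Bs := mem Bl) (K := K1)
  test B_ge2 W_ge tl_lt tl_neq As_uniq As_lt _ _ _ _ _ _ pot8) => //.
- move=> s9 b9 f9; rewrite HE => -[inv9 J9 a9]; rewrite J9 a9 in inv9.
  have g9 := same_off_cat g8 f9; have h9 := same_off_cat h8 f9.
  have i9 := same_off_cat i8 f9.
  have D0 : 0 < s5 vDelta 0.
    have t0 : tl 0 < n by apply: tl_lt; lia.
    rewrite h5 //; apply: leq_trans (dl2 _ t0).
    apply: leq_trans (leq_sum1 (fun x => tl x == tl 0 : nat) (i := 0) _); last by lia.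
    by rewrite eqxx.
  have Q9 : s9 vQ 0 = q by rewrite i9.
  have I9 : s9 aInp = inp by rewrite g9.
  apply: (runs_weaken (T := (expr_cost (inp_a <= $ vAbs + inp_z)%ram + 100 * (1000 * Y)).+1)
    (Q := fun s' => routed (s' aOut) \/ separated (s' aOut))) => //.
  apply: (runs_if B_ge2 W_ge) => //=; rewrite I9.
  + case: leqP => // absz _.
    apply: runs_weaken (routing_runs (s := s9) I9 erefl erefl _ erefl Q9 erefl inv9 _ a9 _ absz B4).
    * by lia.
    * by move=> s' _ _; left.
    * by rewrite !h9.
    * by move=> v vn; rewrite !h9 //; case: (curs v vn).
    * by rewrite g9 // sZ.
  + case: leqP => // absz _.
    have sA : size As = na by rewrite size_mkseq.
    have inv9' : flow_inv n m tl (2 * q) H As (mem Bl) (s9 aRes) (s9 aDist) (s9 aCur)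
      (s9 aSink) (s9 aStuck) (size As) 0 (s9 vU 0) (s9 vAbs 0) by rewrite sA.
    have [z1 z2 [i0 /andP[i1 i2] gi]] := flow_cut tl_lt As_uniq As_lt inv9' q_gt0 erefl D0 l1 erefl
      ltac:(by move=> v vn; rewrite h5 //; exact: dl2)
      ltac:(by rewrite sum_mem // !size_mkseq) ltac:(by rewrite sA; exact: absz).
    apply: runs_weaken (cut_runs (s := s9) (i0 := i0) test B_ge2 W_ge I9 _ _ _ i1 _).
    * have i0H : i0 <= Hm by apply: leq_trans i2 HHm.
      apply: leq_trans (_ : 2000 * (45 * Y) <= _); last by lia.
      rewrite leq_mul2l; apply/orP; right.
      apply: leq_trans (leq_mul (leq_add i0H (leqnn 1)) (leqnn _)) _.
      have -> : (Hm + 1) * (2 * m + n + 1) = 2 * (m * Hm) + n * Hm + Hm + 2 * m + n + 1.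
        by move: (Hm) => k; ring.
      by rewrite Ym; lia.
    * move=> s' _ _ [i /andP[j1 j2] [gl o0 ov]]; right; exists (s9 aDist), i; split.
      (* The tag 0 of a cut is the initial content of the cell, which nothing has overwritten on
         this branch. *)
      - by rewrite o0 g9 // sZ.
      - exact: ov.
      - by rewrite -Q9.
      split; first by apply: leq_trans z1 _; rewrite leq_mul2l above_anti //; lia.
      by apply: leq_trans z2 _; apply: leq_sum => v _; lia.
    * by lia.
    * by lia.
    * by lia.
    * by rewrite Q9; exact: gi.
- by rewrite g8.
- by rewrite !h8.
- by rewrite HE.
- by lia.
- by lia.
Qed.

End Main.

(** * From words to graphs *)

Lemma nth_flatten_pairs (T : Type) (t0 : T) (f g : T -> nat) (s : seq T) r i :
  i < size s ->
  nth 0 (flatten [seq [:: f e; g e] | e <- s] ++ r) (2 * i) = f (nth t0 s i) /\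
  nth 0 (flatten [seq [:: f e; g e] | e <- s] ++ r) (2 * i + 1) = g (nth t0 s i).
Proof.
elim: s i => //= e s IH [|i] // /IH[h1 h2].
by rewrite (_ : 2 * i.+1 = (2 * i).+2) // ; lia.
Qed.

Lemma size_flatten_pairs (T : Type) (f g : T -> nat) (s : seq T) :
  size (flatten [seq [:: f e; g e] | e <- s]) = 2 * size s.
Proof. by elim: s => //= e s ->; lia. Qed.

Section Interface.
Variables (n m : nat) (G : multigraph n m) (A B : {set 'I_n}) (z : nat).
Local Notation inp := (nth 0 (encode_input G A B z)).
Local Notation tl := (inp_tail inp).

Lemma tail_even (e : 'I_m) : tl (2 * e) = (ends G e).1.
Proof.
have := nth_flatten_pairs e (fun e => (ends G e).1 : nat) (fun e => (ends G e).2 : nat)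
  (s := enum 'I_m) ([seq val v | v <- enum A] ++ [seq val v | v <- enum B]) (i := e).
by rewrite size_enum_ord nth_ord_enum => /(_ (ltn_ord e))[].
Qed.

Lemma tail_odd (e : 'I_m) : tl (2 * e + 1) = (ends G e).2.
Proof.
have := nth_flatten_pairs e (fun e => (ends G e).1 : nat) (fun e => (ends G e).2 : nat)
  (s := enum 'I_m) ([seq val v | v <- enum A] ++ [seq val v | v <- enum B]) (i := e).
by rewrite size_enum_ord nth_ord_enum => /(_ (ltn_ord e))[].
Qed.

Lemma ahead_even (e : 'I_m) : ahead tl (2 * e) = (ends G e).2.
Proof. by rewrite -tail_odd /ahead /rarc ifF //; lia. Qed.

Lemma ahead_odd (e : 'I_m) : ahead tl (2 * e + 1) = (ends G e).1.
Proof. by rewrite -tail_even /ahead /rarc ifT ?addnK //; lia. Qed.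

Lemma arcP x : x < 2 * m -> exists e : 'I_m, x = 2 * e \/ x = 2 * e + 1.
Proof.
move=> xm; have em : x %/ 2 < m by lia.
by exists (Ordinal em) => /=; lia.
Qed.

Lemma graph_tl_lt x : x < 2 * m -> tl x < n.
Proof. by case/arcP=> e [] ->; rewrite ?tail_even ?tail_odd. Qed.

Lemma graph_tl_neq x : x < 2 * m -> tl x != ahead tl x.
Proof.
have := ends_neq G => neq.
case/arcP=> e [] ->; first by rewrite tail_even ahead_even; exact: neq.
by rewrite tail_odd ahead_odd eq_sym; exact: neq.
Qed.

Lemma input_A : mkseq (fun j => inp (5 + 2 * m + j)) #|A| = [seq val v | v <- enum A].
Proof.
apply: (@eq_from_nth _ 0) => [|j]; first by rewrite size_mkseq size_map -cardE.
rewrite size_mkseq => jA; rewrite nth_mkseq // -addnA /=.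
rewrite catA nth_cat size_cat size_flatten_pairs size_enum_ord size_map -cardE.
rewrite add0n ltn_add2l jA.
by rewrite nth_cat size_flatten_pairs size_enum_ord ifF ?addKn // ltnNge leq_addr.
Qed.

Lemma input_B :
  mkseq (fun j => inp (5 + 2 * m + #|A| + j)) #|B| = [seq val v | v <- enum B].
Proof.
apply: (@eq_from_nth _ 0) => [|j]; first by rewrite size_mkseq size_map -cardE.
rewrite size_mkseq => jA; rewrite nth_mkseq //.
rewrite (_ : 5 + 2 * m + #|A| + j = 5 + (2 * m + #|A| + j)) /=; last by rewrite !addnA.
rewrite catA nth_cat size_cat size_flatten_pairs size_enum_ord size_map -cardE.
by rewrite add0n ltnNge leq_addr addKn.
Qed.

Lemma uniq_val_enum (X : {set 'I_n}) : uniq [seq val v | v <- enum X].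
Proof. by rewrite (map_inj_uniq val_inj) enum_uniq. Qed.

Lemma all_val_enum (X : {set 'I_n}) : all (ltn^~ n) [seq val v | v <- enum X].
Proof. by apply/allP => _ /mapP[v _ ->] /=; exact: ltn_ord. Qed.

(** Without self-loops, at most one of the two arcs of an edge leaves [v]. *)
Lemma degE (v : 'I_n) : deg m tl v = degree G v.
Proof.
rewrite /deg (sum_arcs (fun x => (tl x == v) : nat)) /degree cardsE -sum1_card.
rewrite [RHS]big_mkcond; apply: eq_bigr => e _ /=.
rewrite tail_even tail_odd unfold_in /= !val_eqE !(eq_sym v).
have := ends_neq G e.
have [E1|_] := eqVneq (ends G e).1 v; have [E2|_] := eqVneq (ends G e).2 v => //.
by rewrite E1 E2 eqxx.
Qed.

Lemma deg_le_max v : v < n -> deg m tl v <= max_degree G.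
Proof.
move=> vn; rewrite (degE (Ordinal vn)).
exact: (leq_bigmax (F := degree G) (Ordinal vn)).
Qed.

Lemma max_degree_le : max_degree G <= m.
Proof.
by apply/bigmax_leqP => v _; rewrite -[X in _ <= X]card_ord max_card.
Qed.

Lemma joins_arc x (e : 'I_m) (u v : 'I_n) : x %/ 2 = e -> tl x = u -> ahead tl x = v ->
  joins G e u v.
Proof.
move=> xe; have [->|->] : x = 2 * e \/ x = 2 * e + 1 by lia.
  rewrite tail_even ahead_even => /val_inj h1 /val_inj h2.
  by rewrite /joins -h1 -h2 -surjective_pairing eqxx.
rewrite tail_odd ahead_odd => /val_inj h1 /val_inj h2.
by rewrite /joins -h1 -h2 -surjective_pairing eqxx orbT.
Qed.

Section Cut.
Variables (d : nat -> nat) (i : nat).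
Let X := [set v : 'I_n | i <= d v].

Lemma card_above : #|X| = above n d i.
Proof. by rewrite cardsE -sum1_card big_mkcond. Qed.

Lemma card_below : #|~: X| = below n d i.
Proof.
have := above_below n d i; have := cardsC X.
by rewrite card_above card_ord; lia.
Qed.

(** Exactly one of the two arcs of a crossing edge goes from the upper to the lower side. *)
Lemma card_crossing : #|edges_between G X (~: X)| = crossing m tl d i.
Proof.
rewrite /crossing (sum_arcs (fun x => (i <= d (tl x)) * (d (ahead tl x) < i))).
rewrite cardsE -sum1_card big_mkcond; apply: eq_bigr => e _ /=.
rewrite tail_even ahead_even tail_odd ahead_odd unfold_in /=.
have -> : [exists u in X, exists v in ~: X, joins G e u v] =
    (i <= d (ends G e).1) && (d (ends G e).2 < i) ||
    (i <= d (ends G e).2) && (d (ends G e).1 < i).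
  apply/existsP/idP => [[u /andP[uX /existsP[v /andP[vX]]]]|].
    rewrite !inE -ltnNge in uX vX.
    by case/orP=> /eqP -> /=; rewrite uX vX ?orbT.
  case/orP=> /andP[h1 h2]; [exists (ends G e).1 | exists (ends G e).2]; rewrite inE h1 /=;
    apply/existsP; [exists (ends G e).2 | exists (ends G e).1];
    by rewrite !inE -ltnNge h2 /joins -surjective_pairing ?eqxx ?orbT.
by rewrite !ltnNge; case: (i <= d (ends G e).1); case: (i <= d (ends G e).2).
Qed.

End Cut.

Section Routes.
Variables (v0 : 'I_n) (e0 : 'I_m).
Let vert k : 'I_n := insubd v0 k.
Let edge k : 'I_m := insubd e0 k.

(** The defaults [v0] and [e0] are never reached on a valid path, whose numbers are all in range. *)
Definition decode_steps (p : seq nat) : gpath n m :=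
  [seq (edge (x %/ 2), vert (ahead tl x)) | x <- p].

Definition decode_route (q : nat * seq nat) : 'I_n * 'I_n * gpath n m :=
  (vert q.1, vert (walk_end tl q), decode_steps q.2).

Lemma vertK k : k < n -> val (vert k) = k.
Proof. by move=> kn; rewrite /vert insubdK. Qed.

Lemma edgeK k : k < m -> val (edge k) = k.
Proof. by move=> km; rewrite /edge insubdK. Qed.

Lemma vert_inj : {in ltn^~ n &, injective vert}.
Proof. by move=> a b an bn /(congr1 val); rewrite !vertK. Qed.

Lemma walk_decode a p : a < n -> arc_walk m tl a p -> walk G (vert a) (decode_steps p).
Proof.
elim: p a => //= x p IH a an /and3P[xm /eqP xa pw].
have hn := ahead_lt graph_tl_lt xm.
rewrite IH // andbT; apply: (joins_arc (x := x)).
- by rewrite edgeK //; lia.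
- by rewrite vertK.
- by rewrite vertK.
Qed.

Lemma ends_decode p : unzip2 (decode_steps p) = map vert (map (ahead tl) p).
Proof. by rewrite /unzip2 /decode_steps -!map_comp; apply: eq_map. Qed.

Lemma path_decode a p : a < n -> arc_path m tl a p ->
  is_path G (vert a) (vert (walk_end tl (a, p))) (decode_steps p).
Proof.
move=> an /andP[pw pu]; rewrite /is_path walk_decode // ends_decode /walk_end /=.
rewrite last_map eqxx -[_ && _]/(uniq (map vert (a :: map (ahead tl) p))).
rewrite map_inj_in_uniq //.
have lt := arc_walk_ends graph_tl_lt an pw.
by move=> b b' bp bp'; apply: vert_inj; [exact: (allP lt b bp) | exact: (allP lt b' bp')].
Qed.

Lemma encode_decode q : q.1 < n -> arc_path m tl q.1 q.2 ->
  encode_route (decode_route q) = route_code tl q.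
Proof.
case: q => a p /= an /andP[pw pu].
have lt := arc_walk_ends graph_tl_lt an pw.
rewrite /encode_route /route_code /= vertK // vertK; last first.
  by apply: (allP lt); rewrite /walk_end mem_last.
congr [:: _, _, _ & _]; first by rewrite size_map.
rewrite /steps_code /decode_steps; congr flatten; rewrite -map_comp.
apply/eq_in_map => x xp /=; have xm := arc_walk_lt pw xp.
have xe : x %/ 2 < m by lia.
rewrite edgeK // vertK //; exact: (ahead_lt graph_tl_lt xm).
Qed.

Lemma load_decode rs (e : 'I_m) :
  (forall q, q \in rs -> q.1 < n /\ arc_path m tl q.1 q.2) ->
  edge_load (map decode_route rs) e = load rs e.
Proof.
move=> rsP; rewrite /edge_load count_map; apply: eq_in_count => q qrs /=.
have [_ /andP[qw _]] := rsP q qrs.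
have -> : unzip1 (decode_steps q.2) = map edge [seq x %/ 2 | x <- q.2].
  by rewrite /unzip1 /decode_steps -!map_comp.
apply/mapP/idP => [[k kq ->]|eq]; last first.
  by exists (val e); [exact: eq | apply/val_inj; rewrite edgeK // ltn_ord].
rewrite edgeK //; case/mapP: kq => x xq ->; have := arc_walk_lt qw xq; lia.
Qed.

Lemma routing_decode rs :
  (forall q, q \in rs -> [/\ q.1 \in [seq val v | v <- enum A],
     walk_end tl q \in [seq val v | v <- enum B] & arc_path m tl q.1 q.2]) ->
  uniq (map fst rs) -> uniq (map (walk_end tl) rs) ->
  partial_routing G A B (map decode_route rs).
Proof.
move=> rsP u1 u2.
have inA q : q \in rs -> q.1 < n by case/rsP=> /mapP[v _ ->] _ _; exact: ltn_ord.
have inB q : q \in rs -> walk_end tl q < n.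
  by case/rsP=> _ /mapP[v _ ->] _; exact: ltn_ord.
have valv (v : 'I_n) : vert (val v) = v by apply/val_inj; rewrite vertK // ltn_ord.
apply/and3P; split.
- apply/allP => _ /mapP[q qrs ->] /=; have qn := inA q qrs.
  have [/mapP[v vA qv] /mapP[w wB qw] qp] := rsP q qrs.
  have := path_decode qn qp; rewrite -surjective_pairing => ->.
  by rewrite mem_enum in vA; rewrite mem_enum in wB; rewrite qv qw !valv vA wB.
- have -> : [seq q.1.1 | q <- map decode_route rs] = map vert (map fst rs).
    by rewrite -!map_comp.
  rewrite map_inj_in_uniq // => _ _ /mapP[q qr ->] /mapP[q' qr' ->].
  by apply: vert_inj; exact: inA.
- have -> : [seq q.1.2 | q <- map decode_route rs] = map vert (map (walk_end tl) rs).
    by rewrite -!map_comp.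
  rewrite map_inj_in_uniq // => _ _ /mapP[q qr ->] /mapP[q' qr' ->].
  by apply: vert_inj; exact: inB.
Qed.

Lemma code_decode rs :
  (forall q, q \in rs -> q.1 < n /\ arc_path m tl q.1 q.2) ->
  flatten [seq encode_route q | q <- map decode_route rs] = routes_code tl rs.
Proof.
move=> rsP; rewrite -map_comp; congr flatten; apply/eq_in_map => q qrs /=.
by have [h1 h2] := rsP q qrs; apply: encode_decode.
Qed.

End Routes.

End Interface.

(* An edge that leads from each vertex other than the root to a vertex nearer to
   the root determines that vertex. *)
Lemma connected_leq n m (G : multigraph n m) : connected_graph G -> n <= m.+1.
Proof.
case=> n0 conn; pose r := Ordinal n0.
(* Tuples of fixed length make reachability in [k] steps a boolean, as [ex_minn] requires to define
   the distance. *)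
pose reach v k := [exists p : k.-tuple 'I_n, path (adj G) r p && (last r p == v)].
have exP v : exists k, reach v k.
  have /connectP[p pp vE] := conn r v; exists (size p).
  by apply/existsP; exists (in_tuple p); rewrite /= pp vE eqxx.
pose dist v := ex_minn (exP v).
have distP v k : reach v k -> dist v <= k.
  by rewrite /dist; case: ex_minnP => d _ dmin; apply: dmin.
pose nearer v e := [exists w, joins G e w v && (dist w < dist v)].
pose f v := [pick e | nearer v e].
have near v : v != r -> exists e, nearer v e.
  move=> vr; have : reach v (dist v) by rewrite /dist; case: ex_minnP.
  case/existsP=> -[p /= /eqP sp] /andP[pp /eqP vE].
  case/lastP: p pp vE sp => [|p w] /=; first by move=> _ E; rewrite E eqxx in vr.
  rewrite rcons_path last_rcons size_rcons => /andP[pp /existsP[e je]] wv sp.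
  exists e; apply/existsP; exists (last r p); rewrite -wv je /= wv -sp ltnS.
  by apply: distP; apply/existsP; exists (in_tuple p); rewrite /= pp eqxx.
(* [None], the value at the root, accounts for the additional 1. *)
suff inj : injective f.
  by have := leq_card f inj; rewrite card_option !card_ord.
move=> v v'; rewrite /f; case: pickP => [e ev|nv]; case: pickP => [e' ev'|nv'] //.
  case=> E; rewrite -{}E {e'} in ev'.
  case/existsP: ev => w /andP[jw dw]; case/existsP: ev' => w' /andP[jw' dw'].
  (* One edge cannot lead towards the root in both directions: each endpoint would be strictly
     nearer than the other. *)
  move: jw jw'; rewrite /joins => /orP[]/eqP-> /orP[]/eqP[] E1 E2 //.
  - by move: dw dw'; rewrite E1 E2 => h1 h2; have := ltn_trans h1 h2; rewrite ltnn.
  - by move: dw dw'; rewrite E1 E2 => h1 h2; have := ltn_trans h1 h2; rewrite ltnn.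
move=> _; have root u : nearer u =1 xpred0 -> u = r.
  by move=> nu; apply/eqP; apply: contraT => /near[e]; rewrite nu.
by rewrite (root v nv) (root v' nv').
Qed.

Lemma sum_degree n m (G : multigraph n m) : \sum_(v < n) degree G v = 2 * m.
Proof.
rewrite -(sum_deg (@graph_tl_lt n m G set0 set0 0)).
by apply: eq_bigr => v _; rewrite degE.
Qed.

Lemma sum_degree_le n m (G : multigraph n m) : 2 * m <= n * max_degree G.
Proof.
rewrite -(sum_degree G); apply: leq_trans (_ : \sum_(v < n) max_degree G <= _).
  by apply: leq_sum => v _; apply: (leq_bigmax (F := degree G) v).
by rewrite sum_nat_const card_ord.
Qed.

(** Degrees at most 1 would give [2 m <= n <= m + 1]. The bound 2 turns [z < 2 |X|] into the
    required [|X| >= z / Delta]. *)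
Lemma max_degree_ge2 n m (G : multigraph n m) : connected_graph G -> 1 < m ->
  1 < max_degree G.
Proof.
move=> /connected_leq nm m2; rewrite ltnNge; apply/negP => d1.
have := sum_degree_le G; have : n * max_degree G <= n * 1 by rewrite leq_mul2l d1 orbT.
lia.
Qed.

(** * Real estimates for the scale and the logarithm *)

Section Reals.
Variable R : realType.
Local Open Scope ring_scope.

Lemma scale_testE (psi : R) a : 0 < psi ->
  real_test psi a 1 = (a < (Num.truncn psi^-1).+1)%N.
Proof.
move=> p0; have i0 : 0 <= psi^-1 by rewrite invr_ge0 ltW.
rewrite /real_test ltnS truncn_ge_nat //.
by rewrite -[psi^-1]div1r ler_pdivlMr.
Qed.

(** [2 (x + 1) <= 3 x] for [x = 1 / psi], which is greater than 2. *)
Lemma scale_le (psi : R) : 0 < psi < 1 / 2 ->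
  2 * (Num.truncn psi^-1).+1%:R <= 3 / psi.
Proof.
case/andP=> p0 p2; have i2 : 2 < psi^-1.
  by rewrite -[psi^-1]div1r ltr_pdivlMr // mulrC -ltr_pdivlMr // mul1r -[_^-1]div1r.
have := truncn_itv (ltW (lt_trans (ltr0n _ 2) i2)) => /andP[+ _].
rewrite -[(Num.truncn psi^-1).+1%:R]natr1.
move: ((Num.truncn _)%:R) i2 => t; move: (psi^-1) => x; lra.
Qed.

Lemma scale_gt (psi : R) : 0 < psi -> 1 < (Num.truncn psi^-1).+1%:R * psi.
Proof.
move=> p0; have := truncnS_gt psi^-1.
by rewrite -[X in X < _]div1r ltr_pdivrMr.
Qed.

Lemma ln2_ge : 1 / 2 <= ln (2 : R).
Proof.
have := @le_ln1Dx R (- (1 / 2)) ltac:(lra).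
have -> : 1 + - (1 / 2) = 2^-1 :> R by lra.
rewrite lnV ?posrE ?ltr0n //; lra.
Qed.

(** From [2 ^ l <= m + 1 <= m ^ 2] and [ln 2 >= 1 / 2] follow [l <= 4 ln m] and [1 <= 2 ln m]. *)
Lemma log_le (m n l : nat) : (1 < m)%N -> (n <= m.+1)%N -> (2 ^ l <= n)%N ->
  (l + 1)%:R <= 6 * ln (m%:R : R).
Proof.
move=> m2 nm pl; have h2 := ln2_ge.
have hm : ln (2 : R) <= ln (m%:R : R).
  by rewrite ler_ln ?posrE ?ltr0n ?ler_nat //; lia.
have : ln ((2 ^ l)%:R : R) <= ln ((m ^ 2)%:R : R).
  rewrite ler_ln ?posrE ?ltr0n ?expn_gt0 ?ler_nat //; last by lia.
  by apply: leq_trans pl _; apply: leq_trans nm _; nia.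
rewrite !natrX !lnXn ?ltr0n //; last by lia.
rewrite natrD -(mulr_natr (ln 2)) -(mulr_natr (ln m%:R)).
have l0 : 0 <= (l%:R : R) by apply: ler0n.
move: (l%:R : R) l0 (ln 2) (ln m%:R) h2 hm => t t0 a b h2 hm h3.
have h4 : 1 / 2 * t <= a * t by rewrite ler_wpM2r.
lra.
Qed.

End Reals.

Local Open Scope nat_scope.

(** With one edge, the header and its two endpoints fill the input cells 0 to 6, so the source is in
    cell 7 and the sink in cell 8. The output cell 5 keeps its initial 0, the number of the edge. *)
Definition small_cmd : cmd :=
 (put aOut [0] 1 ;;
  If (inp_a == 0) Skip
    (put aOut [1] 1 ;; put aOut [2] (aInp @[7]) ;; put aOut [3] (aInp @[8]) ;;
     put aOut [4] 1 ;; put aOut [6] (aInp @[8])))%ram.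

Definition route_or_cut : cmd := (If (inp_m <= 1) small_cmd main_cmd)%ram.

Lemma disjoint_card_le n (A B : {set 'I_n}) : [disjoint A & B] -> #|A| + #|B| <= n.
Proof.
move=> dAB; rewrite -[X in _ <= X]card_ord -(cardsUI A B) (disjoint_setI0 dAB).
by rewrite cards0 addn0 max_card.
Qed.

(* With at most one edge, the time bound does not allow for computing 1 / psi, but
   the only possible demand is routed along the edge itself. *)
Lemma small_runs W test Bd n m (G : multigraph n m) (A B : {set 'I_n}) z :
  2 <= Bd -> Bd ^ 20 <= W -> connected_graph G -> [disjoint A & B] -> #|A| <= #|B| ->
  m <= 1 -> n <= Bd ->
  runs W test Bd small_cmd (input_state (encode_input G A B z)) (ccost small_cmd)
    (fun s' => exists r : routing n m, [/\ outputs s' (encode_outcome (Routed r)),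
      partial_routing G A B r, routing_value r = #|A| & forall e, edge_load r e <= 1]).
Proof.
move=> B2 WB conn dAB AB m1 nB; have nm := connected_leq conn.
have cAB := disjoint_card_le dAB.
have EA := input_A G A B z; have EB := input_B G A B z.
apply: (wp_runs B2 WB); [by [] | by [] |].
have L2 : nth 0 (encode_input G A B z) 2 = #|A| by [].
rewrite /input_state; move: (nth 0 (encode_input G A B z)) EA EB L2 => L EA EB L2.
rewrite /small_cmd /=; split; first by lia.
rewrite /update /= L2; have [A0|A0] := eqVneq #|A| 0; rewrite /=.
  by exists [::]; split=> //; case=> [|[|i]].
(* Two disjoint nonempty sets need [n >= 2], while connectedness gives [n <= m + 1 <= 2]; so the
   edge joins the source to the sink. *)
have mE : m = 1 by lia.
have nE : n = 2 by lia.
move: G A B conn dAB AB A0 cAB nB EA EB {nm m1 L2}.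
rewrite {n}nE {m}mE => G A B conn dAB AB A0 cAB nB.
have /cards1P[u Au] : #|A| == 1 by lia.
have /cards1P[v Bv] : #|B| == 1 by lia.
rewrite Au Bv !cards1 !enum_set1 => -[E7] [E8].
have {}E7 : L 7 = u by exact: E7.
have {}E8 : L 8 = v by exact: E8.
have uv : u != v.
  by apply: contraTneq dAB => uv; rewrite Au Bv uv disjoints1 inE eqxx.
have je : joins G ord0 u v.
  have := ends_neq G ord0; rewrite /joins; case: (ends G ord0) => a b /= ab.
  rewrite !xpair_eqE; move: ab uv; rewrite -!val_eqE /=.
  by have := ltn_ord a; have := ltn_ord b; have := ltn_ord u; have := ltn_ord v; lia.
have uB := ltn_ord u; have vB := ltn_ord v.
rewrite E7 E8; do 5!(split; first by lia).
exists [:: (u, v, [:: (ord0, v)])]; split.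
- by case=> [|[|[|[|[|[|[|i]]]]]]].
- rewrite /partial_routing /= /is_path /= je eqxx !inE /= eqxx.
  by rewrite eqxx uv.
- by [].
- by move=> e; rewrite /edge_load /=; case: (_ \in _).
Qed.

(** * From the memory contents to the real-valued guarantees *)

Section Correctness.
Variables (R : realType) (n m : nat) (G : multigraph n m) (A B : {set 'I_n}) (z : nat).
Variable (psi : R).
Hypothesis psi_range : (0 < psi < 1 / 2)%R.
Hypothesis m_gt1 : 1 < m.
Hypothesis n_gt0 : 0 < n.
Hypothesis degree_ge2 : 1 < max_degree G.
Local Notation inp := (nth 0 (encode_input G A B z)).
Local Notation q := (Num.truncn (psi^-1)%R).+1.

Lemma congestion_le k : 0 < max_degree G -> k <= 2 * q ->
  (k%:R <= 4 * (max_degree G)%:R / psi :> R)%R.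
Proof.
move=> d0 kq; have /andP[p0 _] := psi_range.
apply: (le_trans (y := ((2 * q)%:R)%R)); first by rewrite ler_nat.
rewrite natrM; apply: le_trans (scale_le psi_range) _.
rewrite ler_pM2r ?invr_gt0 //.
have : (1 <= (max_degree G)%:R :> R)%R by rewrite ler1n.
by lra.
Qed.

Lemma routed_outcome s : routed inp q (s aOut) -> exists o : outcome n m,
  outputs s (encode_outcome o) /\ correct_outcome G A B z psi o.
Proof.
case=> rs [[o0 o1] wr val rsP [u1 u2 ld]].
pose v0 : 'I_n := Ordinal n_gt0; pose e0 : 'I_m := Ordinal (ltnW m_gt1).
have rsP' r : r \in rs -> [/\ r.1 \in [seq \val v | v <- enum A],
    walk_end (inp_tail inp) r \in [seq \val v | v <- enum B] &
    arc_path m (inp_tail inp) r.1 r.2].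
  by rewrite -(input_A G A B z) -(input_B G A B z); apply: rsP.
have rsP2 r : r \in rs -> r.1 < n /\ arc_path m (inp_tail inp) r.1 r.2.
  case/rsP'=> /mapP[v _ rv] _ rp; split=> //.
  by rewrite rv; exact: ltn_ord.
exists (Routed (map (decode_route G A B z v0 e0) rs)); split.
  rewrite /encode_outcome (code_decode v0 e0 rsP2) size_map.
  by case=> [|[|i]] //= il; apply: wr.
split.
- exact: routing_decode.
- by rewrite /routing_value size_map leq_subLR addnC.
- by move=> e; apply: congestion_le; [exact: ltnW | rewrite load_decode //; apply: ld].
Qed.

Lemma separated_outcome s : separated inp q (s aOut) -> exists o : outcome n m,
  outputs s (encode_outcome o) /\ correct_outcome G A B z psi o.
Proof.
have /andP[p0 _] := psi_range.
case=> d [i [o0 ov [ca cb] [za zb]]].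
change (is_true (z < 2 * above n d i)) in za; change (is_true (z < below n d i)) in zb.
change (is_true (q * crossing m (inp_tail inp) d i <= above n d i)) in ca.
change (is_true (q * crossing m (inp_tail inp) d i <= below n d i)) in cb.
pose X := [set v : 'I_n | i <= d v].
have cX : #|X| = above n d i by exact: card_above.
have cY : #|~: X| = below n d i by exact: card_below.
exists (Separated m X (~: X)); split.
  case=> [|k] //=; rewrite ltnS size_map size_enum_ord => kl.
  rewrite (nth_map (Ordinal n_gt0)) ?size_enum_ord //.
  have := ov k kl; rewrite addn1 => ->.
  by rewrite (nth_ord_enum _ (Ordinal kl)) inE.
have size_ok k : z <= 2 * k -> (z%:R / (max_degree G)%:R <= k%:R :> R)%R.
  move=> zk; rewrite ler_pdivrMr ?ltr0n; last by lia.
  by rewrite -natrM ler_nat; apply: leq_trans zk _; rewrite mulnC leq_mul2l degree_ge2 orbT.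
split.
- by rewrite /is_cut eqxx -!card_gt0 cX cY; apply/and3P; split=> //; lia.
- by apply: size_ok; rewrite cX; lia.
- by apply: size_ok; rewrite cY; lia.
- rewrite /sparsity (card_crossing G A B z) cX cY.
  have mp : (0 < (minn (above n d i) (below n d i))%:R :> R)%R by rewrite ltr0n; lia.
  rewrite ler_pdivrMr //.
  (* Together with [1 < q psi] this bounds the sparsity by [psi]. *)
  have qe : q * crossing m (inp_tail inp) d i <= minn (above n d i) (below n d i).
    by rewrite leq_min ca cb.
  move: qe mp; rewrite -(ler_nat R) natrM.
  have := scale_gt p0.
  have e0 : (0 <= (crossing m (inp_tail inp) d i)%:R :> R)%R by apply: ler0n.
  move: ((crossing _ _ _ _)%:R)%R e0 ((minn _ _)%:R)%R (q%:R)%R => e e0 t w w1 we t0.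
  apply: le_trans (_ : (w * psi) * e <= _)%R; first by rewrite ler_peMl // ltW.
  by rewrite mulrAC mulrC ler_pM2l.
Qed.

(** [q <= 3 / (2 psi)] and [trunc_log 2 n + 1 <= 6 ln m] multiply to [9 ln m / psi], rounded up to
    10. *)
Lemma time_le K t :
  t <= K * (m * (q * (max_degree G * (trunc_log 2 n + 1)))) -> n <= m.+1 ->
  (t%:R <= (10 * K)%:R * (m%:R * (max_degree G)%:R * ln m%:R / psi) :> R)%R.
Proof.
move=> tl nm; have /andP[p0 _] := psi_range.
apply: (le_trans (y := ((K * (m * (q * (max_degree G * (trunc_log 2 n + 1)))))%:R)%R)).
  by rewrite ler_nat.
have l1 := log_le R m_gt1 nm (trunc_logP (isT : 1 < 2) n_gt0).
have q1 := scale_le psi_range.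
have L0 : (0 <= ln (m%:R : R))%R by rewrite ln_ge0 // ler1n ltnW.
rewrite !natrM.
move: (K%:R)%R (ler0n R K) (m%:R)%R (ler0n R m) ((max_degree G)%:R)%R (ler0n R (max_degree G))
  L0 l1 => k k0 a a0 e e0 L0.
move: (_ %:R)%R (ler0n R (trunc_log 2 n + 1)) => l l0 l1.
move: (q%:R)%R (ler0n R q) q1 => w w0 q1.
have wl : (w * l <= 3 / 2 / psi * (6 * ln a))%R.
  by apply: ler_pM => //; move: q1; rewrite -mulrA; lra.
have -> : (k * (a * (w * (e * l))) = k * a * e * (w * l))%R by ring.
apply: le_trans (ler_wpM2l _ wl) _; first by rewrite !mulr_ge0.
have -> : (k * a * e * (3 / 2 / psi * (6 * ln a)) = 9 * (k * a * e * (ln a / psi)))%R.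
  by field; rewrite gt_eqF.
have -> : (10 * k * (a * e * ln a / psi) = 10 * (k * a * e * (ln a / psi)))%R.
  by field; rewrite gt_eqF.
apply: ler_wpM2r; last by lra.
by rewrite !mulr_ge0 // invr_ge0 ltW.
Qed.

Lemma large_time_le K t :
  t <= 100 + K * (m * (q * (max_degree G * (trunc_log 2 n + 1)))) -> n <= m.+1 ->
  (t%:R <= (10 * K + 100)%:R * (1 + m%:R * (max_degree G)%:R * ln m%:R / psi) :> R)%R.
Proof.
move=> tT nm; have /andP[p0 _] := psi_range; have t1 := time_le (leqnn _) nm (K := K).
apply: (le_trans (y := ((100 + K * (m * (q * (max_degree G * (trunc_log 2 n + 1)))))%:R)%R)).
  by rewrite ler_nat.
rewrite natrD natrD mulrDl [X in (_ <= X)%R]addrC; apply: lerD.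
  rewrite ler_peMr ?ler0n // lerDl !mulr_ge0 ?ler0n ?ln_ge0 ?ler1n ?(ltnW m_gt1) //.
  by rewrite invr_ge0 ltW.
by apply: le_trans t1 _; rewrite ler_wpM2l ?ler0n // lerDr ler01.
Qed.

End Correctness.

Lemma small_time_le (R : realType) (psi : R) m d K t : (0 < psi < 1 / 2)%R -> t <= 100 ->
  (t%:R <= (10 * K + 100)%:R * (1 + m%:R * d%:R * ln m%:R / psi) :> R)%R.
Proof.
case/andP=> p0 _ t100; have m1 : (0 <= ln (m%:R : R))%R.
  by case: (posnP m) => [->|m0]; [rewrite ln0 | rewrite ln_ge0 // ler1n].
apply: (le_trans (y := ((10 * K + 100)%:R)%R)); first by rewrite ler_nat; lia.
rewrite ler_peMr ?ler0n // lerDl.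
by rewrite !mulr_ge0 ?ler0n // invr_ge0 ltW.
Qed.

(** * The theorem *)

Lemma input_bounded n m (G : multigraph n m) (A B : {set 'I_n}) z Bd :
  n + m + z <= Bd -> bounded Bd (input_state (encode_input G A B z)).
Proof.
move=> nB a i; rewrite /input_state; case: ifP => // _.
have cB (X : {set 'I_n}) : #|X| <= Bd.
  by apply: leq_trans (max_card _) _; rewrite card_ord; lia.
have vB (v : 'I_n) : v <= Bd by have := ltn_ord v; lia.
have : all (leq^~ Bd) (encode_input G A B z).
  rewrite /encode_input !all_cat; apply/and4P; split.
  - by rewrite /= !cB !andbT; apply/and3P; split; lia.
  - by apply/allP => k /flatten_mapP[e _]; rewrite !inE => /orP[] /eqP->; exact: vB.
  - by apply/allP => _ /mapP[v _ ->]; exact: vB.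
  - by apply/allP => _ /mapP[v _ ->]; exact: vB.
move/all_nthP => H; have [il|il] := ltnP i (size (encode_input G A B z)); first exact: H.
by rewrite nth_default.
Qed.

(** All these quantities are polynomials of degree at most 3 in [N]; since [N >= 5], the two spare
    powers absorb the coefficients. *)
Lemma poly_bounds N n m q d l : n + m + q + 2 <= N -> 0 < n -> 0 < m -> 0 < q -> 5 <= N ->
  d <= m -> l <= n ->
  [/\ 2 * m + 2 * n + 10 <= N ^ 5, 8 * (q * (d * (l + 1))) < N ^ 5, d <= N ^ 5 &
      4 * q + n * (2 * n + 3) + 2 * n + 10 <= N ^ 5].
Proof.
move=> nN n0 m0 q0 N5 dm ln.
have N2 : 5 * N <= N ^ 2 by rewrite expnS expn1 leq_mul2r N5 orbT.
have N3 : 5 * N ^ 2 <= N ^ 3 by rewrite (expnS N 2) leq_mul2r N5 orbT.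
have N4 : 5 * N ^ 3 <= N ^ 4 by rewrite (expnS N 3) leq_mul2r N5 orbT.
have N5' : 5 * N ^ 4 <= N ^ 5 by rewrite (expnS N 4) leq_mul2r N5 orbT.
have h1 : q * (d * (l + 1)) <= N ^ 3.
  by rewrite !expnS expn0 muln1 !leq_mul //; lia.
have h2 : n * (2 * n + 3) <= 5 * N ^ 2.
  by apply: leq_trans (_ : N * (5 * N) <= _); [apply: leq_mul; lia | rewrite expnS expn1 mulnCA].
by split; lia.
Qed.

Section Program.
Variables (R : realType) (n m : nat) (G : multigraph n m) (A B : {set 'I_n}) (z : nat).
Variable psi : R.
Hypothesis conn : connected_graph G.
Hypothesis AB_disjoint : [disjoint A & B].
Hypothesis AB_card : #|A| <= #|B|.
Hypothesis psi_range : (0 < psi < 1 / 2)%R.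
Local Notation q := (Num.truncn (psi^-1)%R).+1.
Local Notation N := (n + m + z + 2 + q).
Local Notation s0 := (input_state (encode_input G A B z)).

Lemma inv_psi_gt2 : (2 < psi^-1)%R.
Proof.
have /andP[p0 p2] := psi_range.
by rewrite -[(psi^-1)%R]div1r ltr_pdivlMr // mulrC -ltr_pdivlMr.
Qed.

(** The origin of the exponent 200: cells are at most [N ^ 5], expressions have degree at most 20,
    and [N <= x + 1 <= x ^ 2]. *)
Lemma word_size W :
  (((n + m + z + 2)%:R + psi^-1) ^+ (2 * 100) <= W%:R :> R)%R -> (N ^ 5) ^ 20 <= W.
Proof.
set x := ((n + m + z + 2)%:R + psi^-1)%R.
have x2 : (2 <= x)%R.
  by rewrite /x -[2%:R%R]add0r lerD ?ler0n // ltW // inv_psi_gt2.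
have Nx : (N%:R <= x + 1)%R.
  rewrite natrD -addrA lerD2l -[(q%:R)%R]natr1 lerD2r.
  by have := truncn_itv (ltW (lt_trans (ltr0n R 2) inv_psi_gt2)) => /andP[].
have {}Nx : (N%:R <= x ^+ 2)%R.
  by apply: le_trans Nx _; rewrite expr2; move: x x2 => y y2; nra.
rewrite -(ler_nat R); apply: le_trans.
rewrite -expnM (_ : 5 * 20 = 100) // natrX exprM.
by apply: lerXn2r; rewrite ?nnegrE ?exprn_ge0 ?(le_trans _ x2) ?ler0n.
Qed.

Lemma n_gt0 : 0 < n. Proof. by case: conn. Qed.

Lemma q_gt2 : 2 < q.
Proof.
have h := inv_psi_gt2; rewrite ltnS truncn_ge_nat ?ltW //.
exact: lt_trans (ltr0n R 2) h.
Qed.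

Lemma N_ge5 : 5 <= N. Proof. by have := q_gt2; lia. Qed.

Lemma N_le_pow : N <= N ^ 5.
Proof. by rewrite -{1}(expn1 N) leq_pexp2l //; have := N_ge5; lia. Qed.

Lemma pow_ge2 : 2 <= N ^ 5.
Proof. by apply: leq_trans N_le_pow; have := N_ge5; lia. Qed.

Lemma input_small : bounded (N ^ 5) s0.
Proof. by apply: input_bounded; apply: leq_trans N_le_pow; lia. Qed.

(* (N ^ 5) ^ 20 <= W is introduced late because lia would expand it. *)
Lemma route_or_cut_small W : m <= 1 -> (N ^ 5) ^ 20 <= W -> exists t s o,
  [/\ exec W (real_test psi) route_or_cut s0 t s, t <= 100,
      outputs s (encode_outcome o) & correct_outcome G A B z psi o].
Proof.
move=> m1; have d0 : 'I_m -> 0 < max_degree G.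
  by move=> e; have := sum_degree_le G; have := ltn_ord e; case: (max_degree G) => //; lia.
have nN : n <= N ^ 5 by apply: leq_trans N_le_pow; lia.
move=> W_ge; have R1 := @small_runs W (real_test psi) (N ^ 5) n m G A B z pow_ge2 W_ge conn
  AB_disjoint AB_card m1 nN.
have [|t [s [E tT _ _ [r [out pr val ld]]]]] :=
  @runs_if W (real_test psi) (N ^ 5) 20 pow_ge2 W_ge (inp_m <= 1)%ram small_cmd main_cmd
    s0 _ _ isT (fun _ => R1) _ input_small.
  by rewrite /= m1.
exists t, s, (Routed r); split=> //; first by apply: leq_trans tT _.
split=> //; first by rewrite val leq_subr.
move=> e; apply: (congestion_le psi_range); [exact: d0 e | exact: leq_trans (ld e) _].
Qed.

Lemma route_or_cut_large W : 1 < m -> (N ^ 5) ^ 20 <= W -> exists t s o,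
  [/\ exec W (real_test psi) route_or_cut s0 t s,
      t <= 100 + 200 * (1000 * (m * (q * (max_degree G * (trunc_log 2 n + 1))))),
      outputs s (encode_outcome o) & correct_outcome G A B z psi o].
Proof.
move=> m1; have n0 := n_gt0.
have /andP[p0 _] := psi_range; have nm := connected_leq conn.
have d2 := max_degree_ge2 conn m1.
have lm : trunc_log 2 n <= n.
  exact: leq_trans (ltnW (ltn_expl _ (isT : 1 < 2))) (trunc_logP (isT : 1 < 2) n0).
have n2m : n <= 2 * m by lia.
have [c1 c2 c3 c4] := @poly_bounds N n m q (max_degree G) (trunc_log 2 n)
  ltac:(lia) n0 (ltnW m1) isT N_ge5 (max_degree_le G) lm.
have EA := input_A G A B z; have EB := input_B G A B z.
have lmaxP l : (0 < l -> 2 ^ (l - 1) <= n) -> l <= trunc_log 2 n + 1.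
  case: l => // l /(_ isT); rewrite subn1 addn1 /= => h.
  by rewrite ltnS; apply: trunc_log_max.
move=> W_ge; have R1 : runs W (real_test psi) (N ^ 5) main_cmd s0
    (200 * (1000 * (m * (q * (max_degree G * (trunc_log 2 n + 1))))))
    (fun s => routed (nth 0 (encode_input G A B z)) q (s 1) \/
              separated (nth 0 (encode_input G A B z)) q (s 1)).
  apply: (@main_runs W (real_test psi) (N ^ 5) pow_ge2 W_ge (nth 0 (encode_input G A B z))
    (@graph_tl_lt n m G A B z) (@graph_tl_neq n m G A B z) _ _ _ _ AB_card q (max_degree G)
    (trunc_log 2 n + 1)) => //.
  - by rewrite [X in uniq X]EA uniq_val_enum.
  - by rewrite [X in all _ X]EA all_val_enum.
  - by rewrite [X in uniq X]EB uniq_val_enum.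
  - by rewrite [X in all _ X]EB all_val_enum.
  - by move=> a; apply: scale_testE.
  - exact: deg_le_max.
  - exact: ltnW m1.
  - exact: ltnW d2.
  - by move=> a i /negbTE a0; rewrite /input_state a0.
have [|t [s [E tT _ _ oc]]] :=
  @runs_if W (real_test psi) (N ^ 5) 20 pow_ge2 W_ge (inp_m <= 1)%ram small_cmd main_cmd
    s0 _ _ isT _ (fun _ => R1) input_small.
  by rewrite /= leqNgt m1.
have [o [out cor]] : exists o : outcome n m,
    outputs s (encode_outcome o) /\ correct_outcome G A B z psi o.
  by case: oc => [/(routed_outcome psi_range m1 n0 d2)|/(separated_outcome psi_range m1 n0 d2)].
exists t, s, o; split=> //; apply: leq_trans tT _.
by rewrite -addSn leq_add2r.
Qed.

End Program.

Local Open Scope ring_scope.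

Theorem theorem3p8 (R : realType) :
  exists (prog : cmd) (C k : nat),
  forall (n m : nat) (G : multigraph n m) (A1 B1 : {set 'I_n}) (z : nat)
         (psi : R),
    connected_graph G ->
    [disjoint A1 & B1] ->
    (#|A1| <= #|B1|)%N ->
    0 < psi < 1 / 2 ->
    forall W : nat,
      ((n + m + z + 2)%:R + psi^-1) ^+ k <= W%:R ->
      exists (t : nat) (s : state) (o : outcome n m),
        [/\ exec W (real_test psi) prog
              (input_state (encode_input G A1 B1 z)) t s,
            t%:R <= C%:R *
              (1 + m%:R * (max_degree G)%:R * ln m%:R / psi),
            outputs s (encode_outcome o)
          & correct_outcome G A1 B1 z psi o].
Proof.
have [K KE] : exists K, forall Y, (200 * (1000 * Y) = K * Y)%N.
  by exists (200 * 1000)%N => Y; rewrite mulnA.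
exists route_or_cut, (10 * K + 100)%N, (2 * 100)%N.
move=> n m G A B z psi conn dAB AB psi2 W /(word_size psi2) WN.
have [m1|m1] := leqP m 1.
  have [t [s [o [E tT out cor]]]] := route_or_cut_small conn dAB AB psi2 m1 WN.
  by exists t, s, o; split=> //; exact: small_time_le.
have [t [s [o [E tT out cor]]]] := route_or_cut_large conn dAB AB psi2 m1 WN.
exists t, s, o; split=> //; rewrite KE in tT.
exact: (large_time_le psi2 m1 (n_gt0 conn) tT (connected_leq conn)).
Qed.
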